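(* For each $n\ge 1$ let $A_n=(a_{ij})_{n,n}$ be a square random matrix, where $\{a_{ij}=a_{ij}^{(n)},\ 1\le i,j\le n\}$ is a collection of independent real random variables with common mean $0$ and variance $1$. Assume moreover that $$\sup_{n}\max_{1\le i,j\le n}\mathbb{E}\,a_{ij}^4<\infty .$$ Then, as $n\to\infty$, $$\frac{\log|\det A_n|-\frac12\log (n-1)!}{\sqrt{\frac12\log n}}\ \stackrel{d}{\longrightarrow}\ N(0,1).$$
   Context: The entries $a_{ij}=a_{ij}^{(n)}$ may depend on $n$ and need not be identically distributed. $\stackrel{d}{\longrightarrow}$ denotes convergence in distribution, and $N(0,1)$ is the standard Gaussian law. By convention $\log 0=-\infty$. *)

(* Defs.v *)
From HB Require Import structures.
From mathcomp Require Import all_boot all_order all_algebra.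
From mathcomp Require Import all_classical all_reals all_analysis.

Set Implicit Arguments.
Unset Strict Implicit.
Unset Printing Implicit Defensive.

Import Order.TTheory GRing.Theory Num.Theory.
Import numFieldNormedType.Exports.

Local Open Scope classical_set_scope.
Local Open Scope ring_scope.

Definition mutually_independent (d : measure_display) (T : measurableType d)
    (R : realType) (P : probability T R) (I : finType)
    (X : I -> {RV P >-> R}) : Prop :=
  forall (J : {set I}) (B : I -> set R),
    (forall i, measurable (B i)) ->
    P (\bigcap_(i in [set` J]) (X i @^-1` B i)) =
    (\prod_(i in J) P (X i @^-1` B i))%E.

(* Convergence of distribution functions at the continuity points of the
   limit.  The X n may live on different probability spaces and take the values
   -oo and +oo; the limit law mu is a probability measure on the real line, so
   this is weak convergence in [-oo, +oo] to mu. *)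
Definition cvg_in_distribution (R : realType) (d : nat -> measure_display)
    (T : forall n : nat, measurableType (d n))
    (P : forall n : nat, probability (T n) R)
    (X : forall n : nat, T n -> \bar R)
    (mu : probability (measurableTypeR R) R) : Prop :=
  forall x : R,
    {for x, continuous (fun y : R => mu [set` `]-oo, y]])} ->
    P n [set w | (X n w <= x%:E)%E] @[n --> \oo] --> mu [set` `]-oo, x]].

Definition random_matrix (R : realType) (d : measure_display)
    (T : measurableType d) (P : probability T R) (n : nat)
    (a : 'I_n -> 'I_n -> {RV P >-> R}) (w : T) : 'M[R]_n :=
  \matrix_(i, j) a i j w.

(* lne sends 0 to -oo, so a singular matrix gives the value -oo (for n >= 2).
   For n <= 1 the normalising constant is 0 and the value is immaterial. *)
Definition normalized_log_det (R : realType) (n : nat) (A : 'M[R]_n) : \bar R :=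
  ((lne `|\det A|%:E - (2^-1 * ln ((n.-1)`!)%:R)%:E) *
   ((Num.sqrt (2^-1 * ln n%:R))^-1)%:E)%E.

(* Main.v *)
(* Let Q_k be the orthogonal projector onto the complement of the span of the
   first k rows and m = n - k its rank.  Then (det A)^2 is the product over k
   of r_k Q_k r_k^T, and r_k Q_k r_k^T / m = 1 + Y_k + Z_k, where Y_k collects
   the off-diagonal and Z_k the diagonal terms of the quadratic form.  Both are
   martingale differences with respect to the rows, with conditional variances
   2 (m - W_k) / m^2 and at most K W_k / m^2, where W_k is the sum of the
   squared diagonal entries of Q_k.

   The key estimate is E W_k <= C m^2 / n: projecting out one more row lowers
   W_k by about (2 / m) W_k on average.  It makes the sum of the Z_k bounded in
   L^2, so that the logarithm of the product is sum_k (Y_k - 1/m) + O(1) after a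
   second-order Taylor expansion.  The last M rows are not in the range of the
   expansion; there a small-ball estimate for a linear form bounds the distance
   from below, and the contribution to the logarithm is O(1) as well.  The
   variance of sum_k Y_k is about 2 log n, and Lindeberg's replacement argument
   with test functions t |-> Phi((a - t) / sqrt u), on which adding an
   independent Gaussian acts as a shift of u, gives the Gaussian limit. *)
Require Import Defs.
From HB Require Import structures.
From mathcomp Require Import all_boot all_order all_algebra.
From mathcomp Require Import all_classical all_reals all_analysis.
From mathcomp Require Import measurable_realfun ring lra.
Import Order.TTheory GRing.Theory Num.Theory.
Import numFieldNormedType.Exports.
Local Open Scope classical_set_scope.
Local Open Scope ring_scope.

Set Implicit Arguments.
Unset Strict Implicit.
Unset Printing Implicit Defensive.

(** * Expectation, independence and decoupling *)

(** The obstacle is that only fourth moments of the entries are bounded, so [Z_k] is controlled in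
    L^2 only, and the trivial bound W_k <= m would let the variances of the [Z_k] add up to order
    log n, as much as those of the [Y_k]. With E W_k <= C m^2 / n each of them is O(1/n). The same
    estimate absorbs the gap between 2/m and the conditional variance of [Y_k], and it makes the
    linear form behind the small-ball bound spread out, since the fourth powers of its coefficients
    add up to at most W_k.

    A probability of order 1/n per row is still too large for a union bound over n rows, so the
    lower tail of [Z_k] needs its own argument; its upper tail is left uncontrolled, and the
    expansion of the logarithm has to tolerate large positive values.

    The factorial (n-1)! arises because the factors m multiply to n!, while the second-order terms
    -Y_k^2/2 drift by -1/m each, that is by -log n + O(1) in total.

    Conditioning on earlier rows is expressed by integrating over two independent copies: estimates
    are proved for a fixed projector and then averaged over the random one. *)

Lemma eq_ler (R : numDomainType) (x y : R) : x = y -> x <= y.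
Proof. by move=> ->. Qed.

Section expectation.
Context (d : measure_display) (T : measurableType d) (R : realType)
  (P : probability T R).
Implicit Types (f g : T -> R) (A : set T).

Definition itg f := P.-integrable setT (EFin \o f).
(** [Ex] is the finite part of the integral, hence informative only for integrable functions; this
    is why estimates of [Ex] below mostly come paired with [itg]. *)
Definition Ex f : R := \int[P]_w f w.
Definition Pr A : R := fine (P A).

Lemma itg_meas f : itg f -> measurable_fun setT f.
Proof. by move=> /measurable_int/measurable_EFinP. Qed.

Lemma itg_cst c : itg (fun=> c).
Proof. exact: finite_measure_integrable_cst. Qed.

Lemma itgD f g : itg f -> itg g -> itg (fun w => f w + g w).
Proof. by move=> hf hg; exact: (integrableD measurableT hf hg). Qed.

Lemma itgZ c f : itg f -> itg (fun w => c * f w).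
Proof. by move=> hf; exact: (integrableZl measurableT c hf). Qed.

Lemma itgN f : itg f -> itg (fun w => - f w).
Proof. by move=> hf; exact: (integrableN hf). Qed.

Lemma itgB f g : itg f -> itg g -> itg (fun w => f w - g w).
Proof. by move=> hf hg; apply: itgD => //; exact: itgN. Qed.

Lemma itg_norm f : itg f -> itg (fun w => `|f w|).
Proof. by move=> hf; exact: (integrable_norm hf). Qed.

Lemma itg_sum I (s : seq I) (p : pred I) (F : I -> T -> R) :
  (forall i, p i -> itg (F i)) -> itg (fun w => \sum_(i <- s | p i) F i w).
Proof.
move=> h; elim: s => [|i s ih].
  by rewrite (_ : (fun _ => _) = fun=> 0); [exact: itg_cst|
    apply/funext => w; rewrite big_nil].
case: (boolP (p i)) => pi; last first.
  rewrite (_ : (fun _ => _) = fun w => \sum_(i <- s | p i) F i w)//.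
  by apply/funext => w; rewrite big_cons (negbTE pi).
rewrite (_ : (fun _ => _) = fun w => F i w + \sum_(i <- s | p i) F i w)//.
  by apply: itgD => //; exact: h.
by apply/funext => w; rewrite big_cons pi.
Qed.

Lemma le_itg f g : measurable_fun setT f -> (forall w, `|f w| <= g w) ->
  itg g -> itg f.
Proof.
move=> mf fg hg; apply: (le_integrable _ _ _ hg) => //.
  exact/measurable_EFinP.
by move=> w _ /=; rewrite lee_fin (le_trans (fg w))// ler_norm.
Qed.

Lemma bounded_itg f c : measurable_fun setT f -> (forall w, `|f w| <= c) ->
  itg f.
Proof. by move=> mf fc; apply: (le_itg mf fc); exact: itg_cst. Qed.

Lemma Ex_cst c : Ex (fun=> c) = c.
Proof.
rewrite /Ex Rintegral_cst// (_ : fine _ = 1) ?mulr1//.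
by rewrite -[RHS]/(fine 1%E); congr fine; exact: probability_setT.
Qed.

Lemma ExD f g : itg f -> itg g -> Ex (fun w => f w + g w) = Ex f + Ex g.
Proof. by move=> hf hg; exact: RintegralD. Qed.

Lemma ExB f g : itg f -> itg g -> Ex (fun w => f w - g w) = Ex f - Ex g.
Proof. by move=> hf hg; exact: RintegralB. Qed.

Lemma ExZ c f : itg f -> Ex (fun w => c * f w) = c * Ex f.
Proof. by move=> hf; exact: RintegralZl. Qed.

Lemma le_Ex f g : itg f -> itg g -> (forall w, f w <= g w) -> Ex f <= Ex g.
Proof. by move=> hf hg fg; exact: le_Rintegral. Qed.

Lemma Ex_ge0 f : (forall w, 0 <= f w) -> 0 <= Ex f.
Proof. by move=> f0; exact: Rintegral_ge0. Qed.

Lemma Ex_sum I (s : seq I) (p : pred I) (F : I -> T -> R) :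
  (forall i, p i -> itg (F i)) ->
  Ex (fun w => \sum_(i <- s | p i) F i w) = \sum_(i <- s | p i) Ex (F i).
Proof.
move=> h; elim: s => [|i s ih].
  rewrite big_nil (_ : (fun _ => _) = fun=> 0) ?Ex_cst//.
  by apply/funext => w; rewrite big_nil.
rewrite big_cons; case: ifPn => pi; last first.
  rewrite -ih; congr Ex; apply/funext => w.
  by rewrite big_cons (negbTE pi).
rewrite -ih -ExD//; [|exact: h|exact: itg_sum].
by congr Ex; apply/funext => w; rewrite big_cons pi.
Qed.

Lemma normEx f : itg f -> `|Ex f| <= Ex (fun w => `|f w|).
Proof. by move=> hf; exact: le_normr_Rintegral. Qed.

Lemma integral_Ex f : itg f -> (\int[P]_w (f w)%:E)%E = (Ex f)%:E.
Proof. by move=> hf; rewrite fineK//; exact: integrable_fin_num. Qed.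

Lemma Pr_ge0 A : 0 <= Pr A.
Proof. exact: fine_ge0. Qed.

Lemma PrE A : measurable A -> P A = (Pr A)%:E.
Proof. by move=> mA; rewrite /Pr fineK// fin_num_measure. Qed.

Lemma Pr_le1 A : measurable A -> Pr A <= 1.
Proof. by move=> mA; rewrite -lee_fin -PrE// probability_le1. Qed.

Lemma itg_indic A : measurable A -> itg (\1_A : T -> R).
Proof. by move=> mA; exact: integrable_indic. Qed.

Lemma Ex_indic A : measurable A -> Ex (\1_A : T -> R) = Pr A.
Proof. by move=> mA; rewrite /Ex /Rintegral integral_indic// setIT. Qed.

Lemma le_Pr A B : measurable A -> measurable B -> A `<=` B -> Pr A <= Pr B.
Proof.
move=> mA mB AB; rewrite -lee_fin -!PrE//.
by apply: le_measure; rewrite ?inE.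
Qed.

Lemma PrU A B : measurable A -> measurable B -> Pr (A `|` B) <= Pr A + Pr B.
Proof.
move=> mA mB; rewrite -lee_fin EFinD -!PrE//; last exact: measurableU.
exact: measureU2.
Qed.

Lemma Pr_bigU (I : Type) (s : seq I) (p : pred I) (A : I -> set T) :
  (forall i, measurable (A i)) ->
  Pr (\big[setU/set0]_(i <- s | p i) A i) <= \sum_(i <- s | p i) Pr (A i).
Proof.
move=> mA; elim: s => [|i s ih]; first by rewrite !big_nil /Pr measure0.
rewrite !big_cons; case: ifPn => // pi.
rewrite (le_trans (PrU _ _))// ?lerD2l//; first exact: bigsetU_measurable.
Qed.

Lemma markov_Ex f A c : 0 < c -> measurable A -> itg f ->
  (forall w, 0 <= f w) -> (forall w, A w -> c <= f w) -> Pr A <= Ex f / c.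
Proof.
move=> c0 mA hf f0 fA; rewrite ler_pdivlMr// mulrC -Ex_indic// -ExZ//; last first.
  exact: itg_indic.
apply: le_Ex => //; first exact/itgZ/itg_indic.
move=> w; rewrite indicE; case: (boolP (w \in A)) => [|_].
  by rewrite inE => /fA; rewrite mulr1.
by rewrite mulr0.
Qed.

End expectation.

Section independence.
Context (d : measure_display) (T : measurableType d) (R : realType)
  (P : probability T R) (I : finType) (X : I -> {RV P >-> R}).
Hypothesis X_indep : mutually_independent X.

Definition cyl (J : {set I}) : set (set T) :=
  [set A | exists2 B : I -> set R, (forall i, measurable (B i)) &
     A = \bigcap_(i in [set` J]) (X i @^-1` B i)].

(** The carrier stays [T]: that a function depends only on the variables indexed by [J] is expressed
    as measurability of the same function on [sigT J]. The generating cylinders are closed under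
    intersection, which gives access to the uniqueness theorem for measures. *)
Definition sigT (J : {set I}) := g_sigma_algebraType (cyl J).

Lemma measurable_RV (i : I) (B : set R) : measurable B ->
  measurable (X i @^-1` B).
Proof. by move=> mB; rewrite -[_ @^-1` _]setTI; exact: (measurable_funP (X i)). Qed.

Lemma cyl_measurable J : cyl J `<=` measurable.
Proof.
move=> A [B mB ->]; apply: fin_bigcap_measurable => //.
by move=> i _; exact: measurable_RV.
Qed.

Lemma sigT_measurable J (A : set T) : (measurable : set (set (sigT J))) A ->
  measurable A.
Proof.
apply: smallest_sub; first exact: sigma_algebra_measurable.
exact: cyl_measurable.
Qed.

Lemma cylI J : setI_closed (cyl J).
Proof.
move=> A A' [B mB ->] [B' mB' ->]; exists (fun i => B i `&` B' i).
  by move=> i; exact: measurableI.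
by rewrite -bigcapI.
Qed.

Lemma cylT J : cyl J setT.
Proof.
by exists (fun=> setT) => //; apply/seteqP; split.
Qed.

Lemma cyl_indep (J K : {set I}) A B : {in J, forall i, i \notin K} -> cyl J A -> cyl K B ->
  P (A `&` B) = (P A * P B)%E.
Proof.
move=> JK [F mF ->] [G mG ->].
pose H i := if i \in J then F i else G i.
have mH i : measurable (H i) by rewrite /H; case: ifP.
rewrite !X_indep//.
have -> : \bigcap_(i in [set` J]) (X i @^-1` F i) `&`
    \bigcap_(i in [set` K]) (X i @^-1` G i) =
    \bigcap_(i in [set` (J :|: K)%SET]) (X i @^-1` H i).
  apply/seteqP; split => [w [hF hG] i /=|w h].
    rewrite finset.in_setU /H => /orP[iJ|iK].
      by rewrite iJ; exact: hF.
    by rewrite (contraTF (@JK i) iK); exact: hG.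
  split => i /= iJ.
    by have := h i; rewrite /= finset.in_setU iJ /H iJ; exact.
  by have := h i; rewrite /= finset.in_setU iJ orbT /H (contraTF (@JK i) iJ); exact.
rewrite X_indep// (@big_setID _ _ _ _ _ J)/=.
have -> : ((J :|: K) :&: J = J)%SET.
  by apply/setP => i; rewrite !inE; case: (i \in J); rewrite ?andbF.
have -> : ((J :|: K) :\: J = K)%SET.
  apply/setP => i; rewrite !inE; case: (boolP (i \in J)) => // /JK.
  by move=> /negbTE.
congr (_ * _)%E; apply: eq_bigr => i iJ; rewrite /H ?iJ//.
by rewrite (contraTF (@JK i) iJ).
Qed.

(** Both sides are finite measures in [A], the restriction of [P] to [B] and a multiple of [P], so
    agreement on the pi-system [G] extends to the sigma-algebra it generates. *)
Lemma pi_indep (G : set (set T)) (B : set T) : G `<=` measurable ->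
  setI_closed G -> G setT -> measurable B ->
  (forall A, G A -> P (A `&` B) = (P A * P B)%E) ->
  forall A, <<s G >> A -> P (A `&` B) = (P A * P B)%E.
Proof.
move=> Gm GI GT mB h A sA.
have PB0 : 0 <= Pr P B by exact: Pr_ge0.
have e1 : P (A `&` B) = mrestr P mB A by [].
rewrite e1 (g_sigma_algebra_measure_unique G Gm (fun=> setT) _ _ _
  (mscale (NngNum PB0) P))//=.
- by rewrite /mscale/= muleC -PrE.
- by rewrite bigcup_const//; exists 0%N.
- move=> C GC; rewrite /mrestr h// /mscale/= muleC -PrE//.
- by move=> k; rewrite /mrestr setTI ltey_eq fin_num_measure.
Qed.

Lemma sigma_indep (J K : {set I}) A B : {in J, forall i, i \notin K} ->
  (measurable : set (set (sigT J))) A -> (measurable : set (set (sigT K))) B ->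
  P (A `&` B) = (P A * P B)%E.
Proof.
move=> JK mA mB; apply: (@pi_indep (cyl J)) => //.
- exact: cyl_measurable.
- exact: cylI.
- exact: cylT.
- exact: sigT_measurable mB.
move=> {mA}A mA; rewrite setIC muleC; apply: (@pi_indep (cyl K)) => //.
- exact: cyl_measurable.
- exact: cylI.
- exact: cylT.
- exact: cyl_measurable mA.
by move=> {mB}B mB; rewrite setIC muleC; exact: cyl_indep JK mA mB.
Qed.

Lemma measurable_id_sigT J : measurable_fun setT (id : T -> sigT J).
Proof. by move=> _ A mA; rewrite setTI; exact: sigT_measurable mA. Qed.

Lemma measurable_fun_sigT d' (T' : measurableType d') J (f : T -> T') :
  measurable_fun setT (f : sigT J -> T') -> measurable_fun setT f.
Proof.
by move=> mf; apply: (measurableT_comp mf); exact: measurable_id_sigT.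
Qed.

Lemma measurable_sigT_RV (J : {set I}) i : i \in J ->
  measurable_fun setT (X i : sigT J -> R).
Proof.
move=> iJ _ B mB; rewrite setTI; apply: sub_sigma_algebra.
exists (fun j => if j == i then B else setT).
  by move=> j; case: ifP.
apply/seteqP; split => [w Bw j _ /=|w h].
  by case: eqP => // ->.
by have := h i iJ; rewrite /= eqxx.
Qed.


Definition id_sigT J : T -> sigT J := id.

HB.instance Definition _ J :=
  isMeasurableFun.Build _ _ _ _ (@id_sigT J) (@measurable_id_sigT J).

Definition diag_sigT J K (w : T) : sigT J * sigT K := (w, w).

Lemma measurable_diag_sigT J K : measurable_fun setT (@diag_sigT J K).
Proof. by apply/measurable_fun_pair; exact: measurable_id_sigT. Qed.

HB.instance Definition _ J K :=
  isMeasurableFun.Build _ _ _ _ (@diag_sigT J K) (@measurable_diag_sigT J K).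

(* On the product of the two sigma-algebras, the diagonal pushes [P] to the
   product of its restrictions, so one may integrate two independent copies. *)
Lemma decoupling (J K : {set I}) (phi : T -> T -> R) :
  {in J, forall i, i \notin K} ->
  measurable_fun setT ((fun z => phi z.1 z.2) : sigT J * sigT K -> R) ->
  (forall w w', 0 <= phi w w') ->
  measurable_fun setT ((fun w => \int[P]_w' (phi w w')%:E)%E : sigT J -> \bar R)
  /\ (\int[P]_w (phi w w)%:E = \int[P]_w \int[P]_w' (phi w w')%:E)%E.
Proof.
move=> JK mphi phi0.
pose PJ := distribution P (@id_sigT J).
pose PK := distribution P (@id_sigT K).
pose PD := distribution P (@diag_sigT J K).
pose f : sigT J * sigT K -> \bar R := fun z => (phi z.1 z.2)%:E.
have mf : measurable_fun setT f by exact/measurable_EFinP.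
have f0 z : (0 <= f z)%E by rewrite /f lee_fin.
have inner w : (\int[PK]_w' f (w, w') = \int[P]_w' (phi w w')%:E)%E.
  rewrite ge0_integral_distribution//.
  by apply: (measurableT_comp mf); exact: measurable_pair1.
have mF := @measurable_fun_fubini_tonelli_F _ _ (sigT J) (sigT K) R PK f mf f0.
have eF : fubini_F PK f = (fun w => \int[P]_w' (phi w w')%:E)%E.
  by apply/funext => w; rewrite /fubini_F inner.
rewrite eF in mF; split => //.
have PDE (A : set (sigT J * sigT K)) : measurable A -> (PJ \x PK)%E A = PD A.
  move=> mA0; apply: product_measure_unique => // {mA0}A B mA mB.
  by rewrite /PD /PJ /PK /distribution /pushforward/= -(sigma_indep JK mA mB).
transitivity (\int[PD]_z f z)%E.
  by rewrite ge0_integral_distribution.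
transitivity (\int[(PJ \x PK)%E]_z f z)%E.
  by apply: eq_measure_integral => A mA _; exact: (esym (PDE A mA)).
rewrite fubini_tonelli1// ge0_integral_distribution//; last 2 first.
- by rewrite eF.
- by move=> w; rewrite eF; apply: integral_ge0 => w' _; rewrite lee_fin.
by rewrite eF.
Qed.

(** In the applications [w] carries the earlier rows and [w'] the current one, so the inner
    expectation stands for a conditional one. The integrable bound [B] makes the iterated integral
    finite, and Tonelli transfers this to the diagonal. *)
Lemma decoupling_Ex (J K : {set I}) (phi : T -> T -> R) (B : T -> R) :
  {in J, forall i, i \notin K} ->
  measurable_fun setT ((fun z => phi z.1 z.2) : sigT J * sigT K -> R) ->
  (forall w w', 0 <= phi w w') ->
  (forall w, itg P (phi w)) -> (forall w, Ex P (phi w) <= B w) -> itg P B ->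
  [/\ measurable_fun setT ((fun w => Ex P (phi w)) : sigT J -> R),
      itg P (fun w => Ex P (phi w)), itg P (fun w => phi w w) &
      Ex P (fun w => phi w w) = Ex P (fun w => Ex P (phi w))].
Proof.
move=> JK mphi phi0 iphi leB iB.
have [mI eI] := decoupling JK mphi phi0.
have eE : (fun w => \int[P]_w' (phi w w')%:E)%E = EFin \o (fun w => Ex P (phi w)).
  by apply/funext => w /=; rewrite integral_Ex.
have mE : measurable_fun setT ((fun w => Ex P (phi w)) : sigT J -> R).
  by apply/measurable_EFinP; rewrite -eE.
have E0 w : 0 <= Ex P (phi w) by exact: Ex_ge0.
have iE : itg P (fun w => Ex P (phi w)).
  apply: (le_itg _ _ iB); first exact: measurable_fun_sigT mE.
  by move=> w; rewrite ger0_norm.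
have md : measurable_fun setT (fun w => phi w w).
  exact: (measurableT_comp mphi (@measurable_diag_sigT J K)).
have id : itg P (fun w => phi w w).
  apply/integrableP; split; first exact/measurable_EFinP.
  under eq_integral do rewrite /= ger0_norm//.
  by rewrite eI eE integral_Ex// ltry.
split => //; apply: EFin_inj; rewrite -integral_Ex// eI eE integral_Ex//.
Qed.

Lemma ge0_Ex_indepM (J K : {set I}) (f g : T -> R) : {in J, forall i, i \notin K} ->
  measurable_fun setT (f : sigT J -> R) -> measurable_fun setT (g : sigT K -> R) ->
  (forall w, 0 <= f w) -> (forall w, 0 <= g w) -> itg P f -> itg P g ->
  itg P (fun w => f w * g w) /\ Ex P (fun w => f w * g w) = Ex P f * Ex P g.
Proof.
move=> JK mf mg f0 g0 fi gi.
have [//||||||_ _ h ->] := @decoupling_Ex J K (fun w w' => f w * g w')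
  (fun w => Ex P g * f w).
- apply: measurable_funM; first exact: (measurableT_comp mf).
  exact: (measurableT_comp mg).
- by move=> w w'; rewrite mulr_ge0.
- by move=> w; exact: itgZ.
- by move=> w; rewrite ExZ// mulrC.
- exact: itgZ.
split => //; rewrite mulrC -ExZ//; congr Ex; apply/funext => w.
by rewrite ExZ// mulrC.
Qed.

(** Reduction to nonnegative factors: positive and negative parts stay measurable for the same
    sigma-algebra, and the four products recombine. *)
Lemma Ex_indepM (J K : {set I}) (f g : T -> R) : {in J, forall i, i \notin K} ->
  measurable_fun setT (f : sigT J -> R) -> measurable_fun setT (g : sigT K -> R) ->
  itg P f -> itg P g ->
  itg P (fun w => f w * g w) /\ Ex P (fun w => f w * g w) = Ex P f * Ex P g.
Proof.
move=> JK mf mg fi gi.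
have pE (h : T -> R) w : h w = h^\+ w - h^\- w by rewrite -{1}(funrposBneg h).
have ip (h : T -> R) : itg P h -> itg P h^\+ by move=> ?; exact: integrable_funrpos.
have im (h : T -> R) : itg P h -> itg P h^\- by move=> ?; exact: integrable_funrneg.
have mp (L : {set I}) (h : T -> R) : measurable_fun setT (h : sigT L -> R) ->
    measurable_fun setT (h^\+ : sigT L -> R).
  by move=> mh; exact: measurable_funrpos.
have mm (L : {set I}) (h : T -> R) : measurable_fun setT (h : sigT L -> R) ->
    measurable_fun setT (h^\- : sigT L -> R).
  by move=> mh; exact: measurable_funrneg.
have pos := @funrpos_ge0 T R; have neg := @funrneg_ge0 T R.
have [i1 e1] := ge0_Ex_indepM JK (mp _ _ mf) (mp _ _ mg) (pos f) (pos g) (ip _ fi) (ip _ gi).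
have [i2 e2] := ge0_Ex_indepM JK (mp _ _ mf) (mm _ _ mg) (pos f) (neg g) (ip _ fi) (im _ gi).
have [i3 e3] := ge0_Ex_indepM JK (mm _ _ mf) (mp _ _ mg) (neg f) (pos g) (im _ fi) (ip _ gi).
have [i4 e4] := ge0_Ex_indepM JK (mm _ _ mf) (mm _ _ mg) (neg f) (neg g) (im _ fi) (im _ gi).
have -> : (fun w => f w * g w) = fun w => (f^\+ w * g^\+ w - f^\+ w * g^\- w)
   - (f^\- w * g^\+ w - f^\- w * g^\- w).
  by apply/funext => w; rewrite (pE f) (pE g); ring.
have eE h : itg P h -> Ex P h = Ex P h^\+ - Ex P h^\-.
  by move=> hi; rewrite -ExB//; [congr Ex; apply/funext => w|exact: ip|exact: im].
split; first by do ! apply: itgB.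
rewrite ExB ?ExB//; [|exact: itgB|exact: itgB].
by rewrite e1 e2 e3 e4 (eE f)// (eE g)//; ring.
Qed.

End independence.

(** * Moments of linear and quadratic forms *)

Section moments.
Context (d : measure_display) (T : measurableType d) (R : realType)
  (P : probability T R).
Implicit Types (f g u v : T -> R).
Notation itg := (itg P).
Notation Ex := (Ex P).

Lemma eq_itg f g : f =1 g -> itg f -> itg g.
Proof. by move=> /funext ->. Qed.

Lemma eq_Ex f g : f =1 g -> Ex f = Ex g.
Proof. by move=> /funext ->. Qed.

Lemma cauchy_schwarz_Ex u v : measurable_fun setT u -> measurable_fun setT v ->
  itg (fun w => u w ^+ 2) -> itg (fun w => v w ^+ 2) ->
  itg (fun w => u w * v w) /\
  Ex (fun w => u w * v w) ^+ 2 <= Ex (fun w => u w ^+ 2) * Ex (fun w => v w ^+ 2).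
Proof.
move=> mu mv iu iv.
have iuv : itg (fun w => u w * v w).
  apply: (@le_itg _ _ _ _ _ (fun w => u w ^+ 2 + v w ^+ 2)); last exact: itgD.
    exact: measurable_funM.
  move=> w; rewrite normrM -(real_normK (num_real (u w))) -(real_normK (num_real (v w))).
  have := normr_ge0 (u w); have := normr_ge0 (v w); nra.
split => //; set a := Ex (fun w => v w ^+ 2); set b := Ex (fun w => u w * v w).
set c := Ex (fun w => u w ^+ 2).
have a0 : 0 <= a by apply: Ex_ge0 => w; exact: sqr_ge0.
have key t : 0 <= c + 2 * t * b + t ^+ 2 * a.
  have <- : Ex (fun w => (u w + t * v w) ^+ 2) = c + 2 * t * b + t ^+ 2 * a.
    rewrite (@eq_Ex _ (fun w => (u w ^+ 2 + 2 * t * (u w * v w)) + t ^+ 2 * v w ^+ 2)).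
      rewrite ExD ?ExD ?ExZ//; [exact: itgZ|apply: itgD => //; exact: itgZ|exact: itgZ].
    by move=> w; ring.
  by apply: Ex_ge0 => w; exact: sqr_ge0.
have [a_gt0|a_le0] := ltP 0 a.
  have := key (- b / a).
  have -> : c + 2 * (- b / a) * b + (- b / a) ^+ 2 * a = c - b ^+ 2 / a.
    by field; rewrite gt_eqF.
  by rewrite subr_ge0 ler_pdivrMr.
have a00 : a = 0 by apply/eqP; rewrite eq_le a_le0 a0.
have [->|b0] := eqVneq b 0; first by rewrite a00 mulr0 expr0n.
(* When E v^2 = 0 the quadratic degenerates to c + 2 t b, and for b nonzero this value of t makes it
   equal to -1. *)
have := key (- (c + 1) / (2 * b)); rewrite a00.
have -> : c + 2 * (- (c + 1) / (2 * b)) * b + (- (c + 1) / (2 * b)) ^+ 2 * 0 = -1.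
  by field.
by rewrite ler0N1.
Qed.

Lemma le_moment2 f : measurable_fun setT f -> itg (fun w => f w ^+ 4) ->
  itg (fun w => f w ^+ 2) /\ itg f.
Proof.
move=> mf i4; have i2 : itg (fun w => f w ^+ 2).
  apply: (@le_itg _ _ _ _ _ (fun w => 1 + f w ^+ 4)).
  - exact: measurable_funX.
  - move=> w; rewrite ger0_norm ?sqr_ge0// (_ : f w ^+ 4 = (f w ^+ 2) ^+ 2); last by ring.
    have := sqr_ge0 (f w); nra.
  - by apply: itgD => //; exact: itg_cst.
split => //; apply: (@le_itg _ _ _ _ _ (fun w => 1 + f w ^+ 2)) => //.
- move=> w; rewrite -(real_normK (num_real (f w))).
  have := normr_ge0 (f w); nra.
- by apply: itgD => //; exact: itg_cst.
Qed.

End moments.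

Lemma hyper_num1 (R : realType) (k : R) : 1 <= k -> 3 * k <= 16 * k ^+ 2.
Proof. by move=> ?; nra. Qed.

Lemma hyper_num2 (R : realType) (x y z t1 t2 t3 k : R) :
  4 * k * y <= t1 -> 3 * k * z <= t3 -> x <= t2 ->
  x + 8 * k * y + 3 * k * z <= t2 + 2 * t1 + t3.
Proof. by move=> ? ? ?; nra. Qed.

(** * Fourth moments of functions of a subfamily of the variables *)

Section L4.
Context (d : measure_display) (T : measurableType d) (R : realType)
  (P : probability T R) (I : finType) (X : I -> {RV P >-> R}).
Hypothesis X_indep : mutually_independent X.
Implicit Types (f g : T -> R) (J K : {set I}).
Notation itg := (itg P).
Notation Ex := (Ex P).

Lemma measurable_sigT_sub d' (T' : measurableType d') J K (f : T -> T') :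
  J \subset K ->
  measurable_fun setT (f : sigT X J -> T') -> measurable_fun setT (f : sigT X K -> T').
Proof.
move=> JK mf _ A mA; rewrite setTI.
have : (measurable : set (set (sigT X J))) (f @^-1` A).
  by rewrite -[_ @^-1` _]setTI; exact: mf.
apply: sub_smallest2r => [|B [F mF ->]]; first exact: smallest_sigma_algebra.
exists (fun i => if i \in J then F i else setT); first by move=> i; case: ifP.
apply/seteqP; split => [w h i /= iK|w h i /= iJ].
  by case: ifPn => // iJ; exact: h.
by have := h i (fintype.subsetP JK _ iJ); rewrite /= iJ.
Qed.

Definition L4 J f :=
  measurable_fun setT (f : sigT X J -> R) /\ itg (fun w => f w ^+ 4).

Lemma L4_meas J f : L4 J f -> measurable_fun setT f.
Proof. by case=> mf _; exact: measurable_fun_sigT mf. Qed.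

Lemma L4_sub J K f : J \subset K -> L4 J f -> L4 K f.
Proof. by move=> JK [mf i4]; split => //; exact: measurable_sigT_sub mf. Qed.

Lemma L4_cst J c : L4 J (fun=> c).
Proof. by split; [exact: measurable_cst|exact: itg_cst]. Qed.

Lemma itg_mon4 J f g (a b : nat) : (a + b <= 4)%N -> L4 J f -> L4 J g ->
  itg (fun w => f w ^+ a * g w ^+ b).
Proof.
move=> ab hf hg; have [mf f4] := hf; have [mg g4] := hg.
apply: (@le_itg _ _ _ _ _ (fun w => 1 + (f w ^+ 4 + g w ^+ 4))).
- by apply: measurable_funM; apply: measurable_funX; [exact: (L4_meas hf)|exact: (L4_meas hg)].
- move=> w; rewrite normrM !normrX.
  (* With 1 included in the maximum, every monomial of degree at most 4 is bounded by [M ^+ 4], and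
     [M ^+ 4] is one of the three terms of the majorant. *)
  set M := Num.max 1 (Num.max `|f w| `|g w|).
  have M1 : 1 <= M by rewrite le_max lexx.
  have fM : `|f w| <= M by rewrite !le_max lexx orbT.
  have gM : `|g w| <= M by rewrite !le_max lexx !orbT.
  have h1 : `|f w| ^+ a * `|g w| ^+ b <= M ^+ 4.
    apply: (@le_trans _ _ (M ^+ (a + b))); last exact: (ler_weXn2l M1 ab).
    rewrite exprD; apply: ler_pM; rewrite ?exprn_ge0//.
      by apply: lerXn2r; rewrite // nnegrE (le_trans ler01).
    by apply: lerXn2r; rewrite // nnegrE (le_trans ler01).
  apply: (le_trans h1); rewrite /M.
  have e4 (x : R) : `|x| ^+ 4 = x ^+ 4.
    by rewrite -normrX ger0_norm// (_ : x ^+ 4 = (x ^+ 2) ^+ 2) ?sqr_ge0//; ring.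
  have p4 (x : R) : 0 <= x ^+ 4 by rewrite -e4 exprn_ge0.
  have [_|_] := leP 1 (Num.max _ _); last first.
    by rewrite expr1n lerDl addr_ge0.
  have [_|_] := leP `|f w| `|g w|; rewrite e4.
    by rewrite addrA lerDr addr_ge0.
  by rewrite (addrC (f w ^+ 4)) addrA lerDr addr_ge0.
- by apply: itgD; [exact: itg_cst|exact: itgD].
Qed.

Lemma L4D J f g : L4 J f -> L4 J g -> L4 J (fun w => f w + g w).
Proof.
move=> hf hg; split; first by apply: measurable_funD; [exact: hf.1|exact: hg.1].
apply: (@eq_itg _ _ _ _ (fun w => f w ^+ 4 * g w ^+ 0 + 4 * (f w ^+ 3 * g w ^+ 1) +
  6 * (f w ^+ 2 * g w ^+ 2) + 4 * (f w ^+ 1 * g w ^+ 3) + f w ^+ 0 * g w ^+ 4)).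
  by move=> w; rewrite !expr0 !expr1; ring.
have m a b (h : (a + b <= 4)%N) := itg_mon4 h hf hg.
exact: (itgD (itgD (itgD (itgD (m 4 0 isT) (itgZ 4 (m 3 1 isT)))
  (itgZ 6 (m 2 2 isT))) (itgZ 4 (m 1 3 isT))) (m 0 4 isT)).
Qed.

Lemma L4Z J c f : L4 J f -> L4 J (fun w => c * f w).
Proof.
move=> [mf i4]; split; first by apply: measurable_funM => //; exact: measurable_cst.
apply: (@eq_itg _ _ _ _ (fun w => c ^+ 4 * f w ^+ 4)); last exact: itgZ.
by move=> w; rewrite exprMn.
Qed.

(** * Adding [g r] to [f], with [r] centred and independent of [f] and [g] *)

Section step.
Variables (J K : {set I}) (f g r : T -> R).
Hypotheses (JK : {in J, forall i, i \notin K}) (hf : L4 J f) (hg : L4 J g)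
  (hr : L4 K r) (r0 : Ex r = 0).

Let mfg a b : measurable_fun setT ((fun w => f w ^+ a * g w ^+ b) : sigT X J -> R).
Proof.
by apply: measurable_funM; apply: measurable_funX; [exact: hf.1|exact: hg.1].
Qed.

Let mr a : measurable_fun setT ((fun w => r w ^+ a) : sigT X K -> R).
Proof. by apply: measurable_funX; exact: hr.1. Qed.

Let ir a : (a <= 4)%N -> itg (fun w => r w ^+ a).
Proof.
move=> a4; apply: (@eq_itg _ _ _ _ (fun w => r w ^+ a * r w ^+ 0)).
  by move=> w; rewrite expr0 mulr1.
by apply: (itg_mon4 _ hr hr); rewrite addn0.
Qed.

Let prodE a b c : (a + b <= 4)%N -> (c <= 4)%N ->
  itg (fun w => f w ^+ a * g w ^+ b * r w ^+ c) /\
  Ex (fun w => f w ^+ a * g w ^+ b * r w ^+ c) =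
  Ex (fun w => f w ^+ a * g w ^+ b) * Ex (fun w => r w ^+ c).
Proof.
move=> ab c4; apply: (Ex_indepM X_indep JK) => //; last exact: ir.
exact: (itg_mon4 ab hf hg).
Qed.

Lemma step_Ex1 : Ex (fun w => f w + g w * r w) = Ex f.
Proof.
have [i1 e1] := @prodE 0 1 1 isT isT.
have eq1 w : f w ^+ 0 * g w ^+ 1 * r w ^+ 1 = g w * r w.
  by rewrite expr0 !expr1 mul1r.
rewrite ExD//; last by apply: eq_itg i1.
  rewrite -(eq_Ex P eq1) e1 (@eq_Ex _ _ _ _ (fun w => r w ^+ 1) r) ?r0 ?mulr0 ?addr0//.
exact: (le_moment2 (L4_meas hf) hf.2).2.
Qed.

Lemma step_Ex2 : Ex (fun w => (f w + g w * r w) ^+ 2) =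
  Ex (fun w => f w ^+ 2) + Ex (fun w => g w ^+ 2) * Ex (fun w => r w ^+ 2).
Proof.
have [i1 e1] := @prodE 1 1 1 isT isT.
have [i2 e2] := @prodE 0 2 2 isT isT.
have i0 := (le_moment2 (L4_meas hf) hf.2).1.
rewrite (@eq_Ex _ _ _ _ _ (fun w => f w ^+ 2 + (2 * (f w ^+ 1 * g w ^+ 1 * r w ^+ 1) +
  f w ^+ 0 * g w ^+ 2 * r w ^+ 2))); last by move=> w; rewrite expr0 !expr1; ring.
rewrite ExD//; last by apply: itgD => //; exact: itgZ.
rewrite ExD//; last exact: itgZ.
rewrite ExZ// e1 e2 (@eq_Ex _ _ _ _ (fun w => r w ^+ 1) r)// r0 !mulr0 add0r.
congr (_ + _ * _); apply: eq_Ex => w; by rewrite expr0 mul1r.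
Qed.

Lemma step_L4 : L4 (J :|: K)%SET (fun w => f w + g w * r w).
Proof.
apply: L4D; first exact: L4_sub (finset.subsetUl _ _) hf.
split.
  apply: measurable_funM.
    exact: measurable_sigT_sub (finset.subsetUl _ _) hg.1.
  exact: measurable_sigT_sub (finset.subsetUr _ _) hr.1.
apply: (@eq_itg _ _ _ _ (fun w => f w ^+ 0 * g w ^+ 4 * r w ^+ 4)).
  by move=> w; rewrite expr0 mul1r exprMn.
exact: (@prodE 0 4 4 isT isT).1.
Qed.

Variable K0 : R.
Hypotheses (K01 : 1 <= K0) (r4 : Ex (fun w => r w ^+ 4) <= K0).

(** The term with a single [r] vanishes. In the cubic term |f g^3| <= (f^2 g^2 + g^4)/2 and |E r^3|
    <= K0, so the binomial coefficients 6 and 1 become 6 + 2 and 1 + 2. *)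
Lemma step_Ex4 : Ex (fun w => (f w + g w * r w) ^+ 4) <=
  Ex (fun w => f w ^+ 4) + 8 * K0 * Ex (fun w => f w ^+ 2 * g w ^+ 2)
  + 3 * K0 * Ex (fun w => g w ^+ 4).
Proof.
have [i1 e1] := @prodE 3 1 1 isT isT.
have [i2 e2] := @prodE 2 2 2 isT isT.
have [i3 e3] := @prodE 1 3 3 isT isT.
have [i4 e4] := @prodE 0 4 4 isT isT.
rewrite (@eq_Ex _ _ _ _ _ (fun w => f w ^+ 4 + (4 * (f w ^+ 3 * g w ^+ 1 * r w ^+ 1) +
  (6 * (f w ^+ 2 * g w ^+ 2 * r w ^+ 2) + (4 * (f w ^+ 1 * g w ^+ 3 * r w ^+ 3) +
  f w ^+ 0 * g w ^+ 4 * r w ^+ 4))))); last by move=> w; rewrite expr0 !expr1; ring.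
have j3 : itg (fun w => 4 * (f w ^+ 1 * g w ^+ 3 * r w ^+ 3)) by exact: itgZ.
have j34 := itgD j3 i4.
have j2 : itg (fun w => 6 * (f w ^+ 2 * g w ^+ 2 * r w ^+ 2)) by exact: itgZ.
have j234 := itgD j2 j34.
have j1 : itg (fun w => 4 * (f w ^+ 3 * g w ^+ 1 * r w ^+ 1)) by exact: itgZ.
have j1234 := itgD j1 j234.
rewrite (ExD hf.2 j1234) (ExD j1 j234) (ExD j2 j34) (ExD j3 i4) !ExZ// e1 e2 e3 e4.
rewrite (@eq_Ex _ _ _ _ (fun w => r w ^+ 1) r)// r0 !mulr0 add0r.
rewrite (@eq_Ex _ _ _ _ (fun w => f w ^+ 0 * g w ^+ 4) (fun w => g w ^+ 4)); last first.
  by move=> w; rewrite expr0 mul1r.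
have ifg22 := @itg_mon4 J f g 2 2 isT hf hg.
have ifg13 := @itg_mon4 J f g 1 3 isT hf hg.
set a4 := Ex (fun w => f w ^+ 4); set a22 := Ex (fun w => f w ^+ 2 * g w ^+ 2).
set g4 := Ex (fun w => g w ^+ 4); set a13 := Ex (fun w => f w ^+ 1 * g w ^+ 3).
set r2 := Ex (fun w => r w ^+ 2); set r3 := Ex (fun w => r w ^+ 3).
set rr4 := Ex (fun w => r w ^+ 4).
have a22_0 : 0 <= a22 by apply: Ex_ge0 => w; rewrite mulr_ge0// sqr_ge0.
have g4_0 : 0 <= g4.
  by apply: Ex_ge0 => w; rewrite exprn_even_ge0.
have r2_K : r2 <= K0.
  apply: (@le_trans _ _ (Ex (fun w => 2^-1 * (1 + r w ^+ 4)))).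
    apply: le_Ex; [exact: ir| |].
      by apply: itgZ; apply: itgD; [exact: itg_cst|exact: hr.2].
    move=> w; rewrite (_ : r w ^+ 4 = (r w ^+ 2) ^+ 2); last by ring.
    by have := sqr_ge0 (r w ^+ 2 - 1); set y := r w ^+ 2; rewrite sqrrB1; lra.
  rewrite ExZ; last by apply: itgD; [exact: itg_cst|exact: hr.2].
  rewrite ExD ?Ex_cst//; [|exact: itg_cst|exact: hr.2].
  have hy : forall y : R, y <= K0 -> 2^-1 * (1 + y) <= K0 by move=> y; have := K01; lra.
  exact: hy.
have r3_K : `|r3| <= K0.
  apply: (le_trans (normEx (@ir 3 isT))).
  apply: (@le_trans _ _ (Ex (fun w => 2^-1 * (r w ^+ 2 + r w ^+ 4)))).
    apply: le_Ex.
    - exact: itg_norm (@ir 3 isT).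
    - by apply: itgZ; apply: itgD; exact: ir.
    move=> w; rewrite normrX; set x := `|r w|.
    have -> : r w ^+ 2 = x ^+ 2 by rewrite real_normK// num_real.
    have -> : r w ^+ 4 = x ^+ 4.
      by rewrite (_ : 4%N = (2 * 2)%N)// !exprM real_normK// num_real.
    have := sqr_ge0 (x * (x - 1)); rewrite exprMn; nra.
  rewrite ExZ; last by apply: itgD; exact: ir.
  rewrite ExD ?ir// -/r2 -/rr4; move: r4; rewrite -/rr4; lra.
have a13_K : `|a13| <= 2^-1 * (a22 + g4).
  apply: (le_trans (normEx ifg13)).
  rewrite -ExD// -?ExZ; [|exact: itgD ifg22 hg.2|exact: hg.2].
  apply: le_Ex; [exact: itg_norm|by apply: itgZ; apply: itgD => //; exact: hg.2|].
  move=> w; rewrite expr1 normrM normrX; set x := `|f w|; set y := `|g w|.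
  have -> : f w ^+ 2 = x ^+ 2 by rewrite real_normK// num_real.
  have -> : g w ^+ 2 = y ^+ 2 by rewrite real_normK// num_real.
  have -> : g w ^+ 4 = y ^+ 4.
    by rewrite (_ : 4%N = (2 * 2)%N)// !exprM real_normK// num_real.
  have := sqr_ge0 (y * (x - y)); rewrite exprMn; nra.
have rr4_0 : 0 <= rr4.
  by apply: Ex_ge0 => w; rewrite exprn_even_ge0.
have h1 : a22 * r2 <= a22 * K0 by rewrite ler_wpM2l.
have h2 : g4 * rr4 <= g4 * K0 by rewrite ler_wpM2l.
have h3 : a13 * r3 <= 2^-1 * (a22 + g4) * K0.
  apply: (le_trans (ler_norm _)); rewrite normrM.
  by apply: ler_pM.
by move: h1 h2 h3; lra.
Qed.

(** The induction step for bounds of the form B s^2 on a fourth moment, with [s] a multiple of the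
    variance. Cauchy-Schwarz bounds the mixed moment by sqrt(B B') s l, and 16 K0^2 B' <= B then
    fits 8 K0 times it into the middle term of B (s + l)^2. *)
Lemma step_hyper (B B' s l : R) : 0 <= B' -> 0 <= B -> 0 <= s -> 0 <= l ->
  16 * K0 ^+ 2 * B' <= B ->
  Ex (fun w => f w ^+ 4) <= B * s ^+ 2 -> Ex (fun w => g w ^+ 4) <= B' * l ^+ 2 ->
  Ex (fun w => (f w + g w * r w) ^+ 4) <= B * (s + l) ^+ 2.
Proof.
move=> B'0 B0 s0 l0 BB hs hl; apply: (le_trans step_Ex4).
have e2 (h : T -> R) w : (h w ^+ 2) ^+ 2 = h w ^+ 4 by rewrite -exprM.
have [_] := @cauchy_schwarz_Ex _ _ _ P (fun w => f w ^+ 2) (fun w => g w ^+ 2)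
  (measurable_funX _ (L4_meas hf)) (measurable_funX _ (L4_meas hg))
  (eq_itg (fun w => esym (e2 f w)) hf.2) (eq_itg (fun w => esym (e2 g w)) hg.2).
rewrite (eq_Ex _ (e2 f)) (eq_Ex _ (e2 g)).
set a22 := Ex (fun w => f w ^+ 2 * g w ^+ 2).
set a4 := Ex (fun w => f w ^+ 4) in hs *; set g4 := Ex (fun w => g w ^+ 4) in hl *.
move=> cs.
have a22_0 : 0 <= a22 by apply: Ex_ge0 => w; rewrite mulr_ge0// sqr_ge0.
have p4 (h : T -> R) : 0 <= Ex (fun w => h w ^+ 4).
  by apply: Ex_ge0 => w; rewrite exprn_even_ge0.
have K00 : 0 < K0 by rewrite (lt_le_trans ltr01).
have h : 4 * K0 * a22 <= B * s * l.
  rewrite -(@ler_pXn2r _ 2)// ?nnegrE; [|by rewrite !mulr_ge0// ltW|by rewrite !mulr_ge0].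
  rewrite exprMn (@le_trans _ _ ((4 * K0) ^+ 2 * (B * s ^+ 2 * (B' * l ^+ 2))))//.
    rewrite ler_wpM2l ?sqr_ge0// (le_trans cs)// ler_pM//; exact: p4.
  rewrite (_ : (4 * K0) ^+ 2 * _ = (16 * K0 ^+ 2 * B') * (B * (s * l) ^+ 2)); last by ring.
  rewrite (_ : (B * s * l) ^+ 2 = B * (B * (s * l) ^+ 2)); last by ring.
  by rewrite ler_wpM2r// mulr_ge0// sqr_ge0.
have h3 : 3 * K0 * g4 <= B * l ^+ 2.
  apply: (@le_trans _ _ (16 * K0 ^+ 2 * (B' * l ^+ 2))).
    apply: ler_pM => //; [by rewrite mulr_ge0// ltW|exact: p4|].
    exact: hyper_num1.
  by rewrite mulrA ler_wpM2r// sqr_ge0.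
rewrite (_ : B * _ = B * s ^+ 2 + 2 * (B * s * l) + B * l ^+ 2); last by ring.
exact: hyper_num2.
Qed.

End step.

End L4.

(** * Linear forms and off-diagonal quadratic forms in independent variables *)

Section forms.
Context (d : measure_display) (T : measurableType d) (R : realType)
  (P : probability T R) (I : finType) (X : I -> {RV P >-> R}).
Hypothesis X_indep : mutually_independent X.
Notation itg := (itg P).
Notation Ex := (Ex P).

Lemma set_cons (i : I) s : ([set j in i :: s] = [set j in s] :|: [set i])%SET.
Proof. by apply/setP => j; rewrite !inE orbC. Qed.

(** The new variable has a constant coefficient, so [step_hyper] applies with B' = 1. *)
Lemma linear_form4 (c : I -> R) (h : I -> T -> R) (K0 : R) (s : seq I) :
  1 <= K0 -> (forall i, L4 X [set i]%SET (h i)) -> (forall i, Ex (h i) = 0) ->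
  (forall i, Ex (fun w => h i w ^+ 4) <= K0) -> uniq s ->
  [/\ L4 X [set i in s]%SET (fun w => \sum_(i <- s) c i * h i w),
      Ex (fun w => \sum_(i <- s) c i * h i w) = 0 &
      Ex (fun w => (\sum_(i <- s) c i * h i w) ^+ 4) <=
        16 * K0 ^+ 2 * (\sum_(i <- s) c i ^+ 2) ^+ 2].
Proof.
move=> K01 hL h0 h4; elim: s => [_|i s ih /= /andP[si /ih[L1 e1 m1]]].
  have e w : \sum_(i <- [::]) c i * h i w = 0 by rewrite big_nil.
  rewrite (funext e) big_nil Ex_cst; split => //; first exact: L4_cst.
  by rewrite (eq_Ex _ (fun w => congr1 (fun x => x ^+ 4) (e w))) Ex_cst !expr0n mulr0.
have eqf w : \sum_(j <- i :: s) c j * h j w = \sum_(j <- s) c j * h j w + c i * h i w.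
  by rewrite big_cons addrC.
have dis : {in [set j in s]%SET, forall k, k \notin [set i]%SET}.
  by move=> k; rewrite !inE => ks; apply: contra si => /eqP <-.
have Lc : L4 X [set j in s]%SET (fun=> c i) by exact: L4_cst.
split.
- rewrite set_cons (funext eqf); exact: step_L4.
- by rewrite (funext eqf) (step_Ex1 X_indep dis).
rewrite (eq_Ex _ (fun w => congr1 (fun x => x ^+ 4) (eqf w))) big_cons addrC.
have K00 : 0 <= K0 by rewrite (le_trans ler01).
apply: (@step_hyper _ _ _ _ _ _ X_indep _ _ _ _ _ dis _ _ (hL i) _ K0 _ _ _ 1) => //.
- by rewrite !mulr_ge0// exprn_ge0.
- by apply: sumr_ge0 => j _; exact: sqr_ge0.
- exact: sqr_ge0.
- by rewrite mulr1.
- by rewrite Ex_cst mul1r -exprM.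
Qed.

(** Only second moments are assumed, because this is also applied to the variables [X i ^+ 2 - 1],
    whose fourth moments may be infinite. *)
Lemma linear_form2 (c : I -> R) (h : I -> T -> R) :
  (forall i, measurable_fun setT (h i : sigT X [set i]%SET -> R)) ->
  (forall i, itg (h i)) -> (forall i, itg (fun w => h i w ^+ 2)) ->
  (forall i, Ex (h i) = 0) ->
  itg (fun w => (\sum_i c i * h i w) ^+ 2) /\
  Ex (fun w => (\sum_i c i * h i w) ^+ 2) =
    \sum_i c i ^+ 2 * Ex (fun w => h i w ^+ 2).
Proof.
move=> mh ih ih2 h0.
have pE i j : i != j -> itg (fun w => h i w * h j w) /\ Ex (fun w => h i w * h j w) = 0.
  move=> ij; have [] := @Ex_indepM _ _ _ _ _ _ X_indep [set i]%SET [set j]%SET (h i) (h j).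
  - by move=> k; rewrite !inE => /eqP ->.
  - exact: mh.
  - exact: mh.
  - exact: ih.
  - exact: ih.
  by move=> ? ->; rewrite !h0 mulr0.
have ip i j : itg (fun w => h i w * h j w).
  by have [<-|/pE[]//] := eqVneq i j; exact: eq_itg (ih2 i).
have eqf w : (\sum_i c i * h i w) ^+ 2 =
    \sum_i \sum_j (c i * c j) * (h i w * h j w).
  rewrite expr2 big_distrl/=; apply: eq_bigr => i _.
  by rewrite big_distrr/=; apply: eq_bigr => j _; rewrite mulrACA.
have is1 i : itg (fun w => \sum_j (c i * c j) * (h i w * h j w)).
  by apply: itg_sum => j _; exact: itgZ.
rewrite (eq_Ex _ eqf); split.
  by apply: (eq_itg (fun w => esym (eqf w))); apply: itg_sum => i _.
rewrite Ex_sum//; apply: eq_bigr => i _; rewrite Ex_sum; last by move=> j _; exact: itgZ.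
rewrite (bigD1 i)//= ExZ// big1 ?addr0// => j ji.
by rewrite ExZ// (pE i j _).2 ?mulr0// eq_sym.
Qed.

(** The off-diagonal form built one index at a time: the new variable multiplies twice a linear form
    in those already present, which exhibits a martingale with steps of the shape [f + g r]. [quadv]
    adds up the squared coefficients over unordered pairs. *)
Fixpoint quad (q : I -> I -> R) (x : I -> R) (s : seq I) : R :=
  if s is i :: s' then quad q x s' + (2 * \sum_(j <- s') q i j * x j) * x i else 0.

Fixpoint quadv (q : I -> I -> R) (s : seq I) : R :=
  if s is i :: s' then quadv q s' + \sum_(j <- s') q i j ^+ 2 else 0.

Lemma offdiag_cons (F : I -> I -> R) i (s : seq I) : i \notin s ->
  (forall i j, F i j = F j i) ->
  \sum_(k <- i :: s) \sum_(j <- i :: s | j != k) F k j =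
  \sum_(k <- s) \sum_(j <- s | j != k) F k j + 2 * \sum_(j <- s) F i j.
Proof.
move=> si Fs; rewrite big_cons big_cons eqxx/=.
rewrite big_seq_cond [X in X + _](_ : _ = \sum_(j <- s) F i j); last first.
  rewrite [RHS]big_seq; apply: eq_bigl => j; case: (boolP (j \in s)) => //= js.
  by apply: contraTneq js => ->.
rewrite [X in _ + X](_ : _ = \sum_(k <- s) (F i k + \sum_(j <- s | j != k) F k j)).
  rewrite big_split/=; ring.
rewrite big_seq [RHS]big_seq; apply: eq_bigr => k ks.
rewrite big_cons (_ : i != k); first by rewrite (Fs k i).
by apply: contraNneq si => ->.
Qed.

Lemma quadE q x s : uniq s -> (forall i j, q i j = q j i) ->
  quad q x s = \sum_(i <- s) \sum_(j <- s | j != i) q i j * x i * x j.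
Proof.
move=> + qs; elim: s => [_|i s ih /= /andP[si us]]; first by rewrite big_nil.
rewrite offdiag_cons//; last by move=> j k; rewrite qs mulrAC.
rewrite ih//; congr (_ + _); rewrite -mulrA mulr_suml; congr (2 * _).
by apply: eq_bigr => j _; ring.
Qed.

Lemma quadvE q s : uniq s -> (forall i j, q i j = q j i) ->
  2 * quadv q s = \sum_(i <- s) \sum_(j <- s | j != i) q i j ^+ 2.
Proof.
move=> + qs; elim: s => [_|i s ih /= /andP[si us]]; first by rewrite big_nil mulr0.
rewrite offdiag_cons//; last by move=> j k; rewrite qs.
by rewrite -ih//; ring.
Qed.

Lemma quadv_ge0 q s : 0 <= quadv q s.
Proof.
elim: s => //= i s ih; rewrite addr_ge0//.
by apply: sumr_ge0 => j _; exact: sqr_ge0.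
Qed.

Variable K0 : R.
Hypotheses (K01 : 1 <= K0) (X4i : forall i, itg (fun w => X i w ^+ 4))
  (X1 : forall i, Ex (X i) = 0) (X2 : forall i, Ex (fun w => X i w ^+ 2) = 1)
  (X4 : forall i, Ex (fun w => X i w ^+ 4) <= K0).

Lemma L4_X i : L4 X [set i]%SET (X i).
Proof. by split => //; apply: measurable_sigT_RV; rewrite inE. Qed.

Lemma linear_formX2 (c : I -> R) : 
  itg (fun w => (\sum_i c i * X i w) ^+ 2) /\
  Ex (fun w => (\sum_i c i * X i w) ^+ 2) = \sum_i c i ^+ 2.
Proof.
have i2 i := le_moment2 (L4_meas (L4_X i)) (X4i i).
have [||||i3 ->] := @linear_form2 c (fun i => X i).
- by move=> i; exact: (L4_X i).1.
- by move=> i; exact: (i2 i).2.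
- by move=> i; exact: (i2 i).1.
- exact: X1.
by split => //; apply: eq_bigr => i _; rewrite X2 mulr1.
Qed.

Lemma quad_moments q (s : seq I) : uniq s ->
  [/\ L4 X [set i in s]%SET (fun w => quad q (fun i => X i w) s),
      Ex (fun w => quad q (fun i => X i w) s) = 0,
      Ex (fun w => quad q (fun i => X i w) s ^+ 2) = 4 * quadv q s &
      Ex (fun w => quad q (fun i => X i w) s ^+ 4) <=
        16 * K0 ^+ 2 * (16 * (16 * K0 ^+ 2)) * quadv q s ^+ 2].
Proof.
elim: s => [_|i s ih /= /andP[si us]].
  by rewrite /= !expr0n !Ex_cst !mulr0; split => //; exact: L4_cst.
have [L1 e1 v1 m1] := ih us.
have dis : {in [set j in s]%SET, forall k, k \notin [set i]%SET}.
  by move=> k; rewrite !inE => ks; apply: contra si => /eqP <-.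
have [Ll _ l4] := linear_form4 (q i) K01 L4_X X1 X4 us.
have Lg : L4 X [set j in s]%SET (fun w => 2 * \sum_(j <- s) q i j * X j w).
  exact: L4Z.
have lv : Ex (fun w => (\sum_(j <- s) q i j * X j w) ^+ 2) = \sum_(j <- s) q i j ^+ 2.
  (* Coefficients extended by zero, so that the second moment formula for sums over all of [I]
     applies. *)
  pose c j := if j \in s then q i j else 0.
  have := (linear_formX2 c).2.
  have e (F : I -> R) : \sum_(j <- s) F j = \sum_j (if j \in s then F j else 0).
    by rewrite big_uniq//= big_mkcond.
  rewrite e -(_ : \sum_j c j ^+ 2 = \sum_j (if j \in s then q i j ^+ 2 else 0)).
    move=> <-; apply: eq_Ex => w; rewrite e; congr (_ ^+ 2).
    by apply: eq_bigr => j _; rewrite /c; case: ifP => //; rewrite mul0r.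
  by apply: eq_bigr => j _; rewrite /c; case: ifP => //; rewrite expr0n.
have K00 : 0 <= K0 by rewrite (le_trans ler01).
split.
- rewrite set_cons; exact: (step_L4 X_indep dis L1 Lg (L4_X i)).
- by rewrite (step_Ex1 X_indep dis L1 Lg (L4_X i)).
- rewrite (step_Ex2 X_indep dis L1 Lg (L4_X i) (X1 i)).
  rewrite v1 X2 mulr1 mulrDr; congr (_ + _); rewrite -lv -ExZ.
    by apply: eq_Ex => w; rewrite exprMn; congr (_ * _); rewrite expr2; ring.
  exact: (le_moment2 (L4_meas Ll) Ll.2).1.
(* The linear form carries a factor 2, hence B' is 2^4 times the constant 16 K0^2 of
   [linear_form4]. *)
apply: (@step_hyper _ _ _ _ _ _ X_indep _ _ _ _ _ dis L1 Lg (L4_X i) (X1 i) K0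
  K01 (X4 i) _ (16 * (16 * K0 ^+ 2))) => //.
- by rewrite !mulr_ge0// exprn_ge0.
- by rewrite !mulr_ge0// exprn_ge0.
- exact: quadv_ge0.
- by apply: sumr_ge0 => j _; exact: sqr_ge0.
rewrite (@eq_Ex _ _ _ _ _ (fun w => 16 * (\sum_(j <- s) q i j * X j w) ^+ 4)); last first.
  by move=> w; rewrite exprMn -natrX.
rewrite ExZ; last exact: Ll.2.
by rewrite -mulrA ler_wpM2l.
Qed.

End forms.

(** * The quadratic form of one row against a projector *)

Section kernel_forms.
Context (R : realType) (I : finType).
Implicit Types (q : I -> I -> R) (m : R) (x : I -> R).

Definition xf q m x := (\sum_i \sum_j q i j * x i * x j) / m.
Definition Yf q m x := (\sum_i \sum_(j | j != i) q i j * x i * x j) / m.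
Definition Zf q m x := (\sum_i q i i * (x i ^+ 2 - 1)) / m.
(** The squared [i]-th coordinate of the projected vector, over [m]; for a projector these add up to
    [xf]. *)
Definition yf q m i x := (\sum_j q i j * x j) ^+ 2 / m.
Definition Wf q := \sum_i q i i ^+ 2.

Lemma xfE q m x : m != 0 -> \sum_i q i i = m -> xf q m x = 1 + Yf q m x + Zf q m x.
Proof.
move=> m0 qm; rewrite /xf /Yf /Zf.
have -> : \sum_i \sum_j q i j * x i * x j = m +
    \sum_i \sum_(j | j != i) q i j * x i * x j + \sum_i q i i * (x i ^+ 2 - 1).
  rewrite -qm -!big_split/=; apply: eq_bigr => i _; rewrite (bigD1 i)//=; ring.
by rewrite !mulrDl divff.
Qed.

(** Idempotence is recorded only through the diagonal of q^2 = q, which for symmetric [q] reads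
    sum_j q_ij^2 = q_ii; this is the form in which the moment computations use it. *)
Definition is_proj q m := [/\ forall i j, q i j = q j i,
  forall i, \sum_j q i j ^+ 2 = q i i & \sum_i q i i = m].

Lemma is_proj_diag_ge0 q m i : is_proj q m -> 0 <= q i i.
Proof. by move=> [_ <- _]; apply: sumr_ge0 => j _; exact: sqr_ge0. Qed.

Lemma is_proj_diag_le1 q m i : is_proj q m -> q i i <= 1.
Proof.
move=> pq; have q0 := is_proj_diag_ge0 i pq; have [_ qd _] := pq.
have h : q i i ^+ 2 <= q i i.
  rewrite -[leRHS]qd (bigD1 i)//= lerDl.
  by apply: sumr_ge0 => j _; exact: sqr_ge0.
rewrite leNgt; apply/negP => h1; have : q i i * 1 < q i i ^+ 2.
  by rewrite expr2 ltr_pM2l// (lt_trans ltr01).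
by rewrite mulr1 ltNge h.
Qed.

Lemma Wf_ge0 q : 0 <= Wf q.
Proof. by apply: sumr_ge0 => i _; exact: sqr_ge0. Qed.

Lemma Wf_le q m : is_proj q m -> Wf q <= m.
Proof.
move=> pq; have [_ _ <-] := pq; apply: ler_sum => i _.
by rewrite expr2 ler_piMl ?(is_proj_diag_ge0 i pq) ?(is_proj_diag_le1 i pq).
Qed.

Lemma is_proj_offdiag q m : is_proj q m ->
  \sum_i \sum_(j | j != i) q i j ^+ 2 = m - Wf q.
Proof.
move=> [_ qd <-]; rewrite /Wf -sumrB; apply: eq_bigr => i _.
apply/eqP; rewrite eq_sym subr_eq; apply/eqP.
by rewrite -[LHS]qd (bigD1 i)//= addrC.
Qed.

End kernel_forms.

Section row_moments.
Context (d : measure_display) (T : measurableType d) (R : realType)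
  (P : probability T R) (I : finType) (X : I -> {RV P >-> R}).
Hypothesis X_indep : mutually_independent X.
Notation itg := (itg P).
Notation Ex := (Ex P).
Variable K0 : R.
Hypotheses (K01 : 1 <= K0) (X4i : forall i, itg (fun w => X i w ^+ 4))
  (X1 : forall i, Ex (X i) = 0) (X2 : forall i, Ex (fun w => X i w ^+ 2) = 1)
  (X4 : forall i, Ex (fun w => X i w ^+ 4) <= K0).
Variables (q : I -> I -> R) (m : R).
Hypotheses (m1 : 1 <= m) (pq : is_proj q m).

Let m0 : 0 < m. Proof. exact: lt_le_trans m1. Qed.
Let K00 : 0 <= K0. Proof. exact: le_trans K01. Qed.
Notation row w := (fun i => X i w).

Definition cY := 16 * K0 ^+ 2 * (16 * (16 * K0 ^+ 2)).

Let i2 i : itg (fun w => X i w ^+ 2).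
Proof. exact: (le_moment2 (L4_meas (L4_X X4i i)) (X4i i)).1. Qed.

Lemma Yf_quad w : Yf q m (row w) = m^-1 * quad q (row w) (index_enum I).
Proof.
have [qs _ _] := pq.
by rewrite /Yf mulrC quadE// index_enum_uniq.
Qed.

Lemma Yf_moments :
  [/\ L4 X [set: I]%SET (fun w => Yf q m (row w)),
      Ex (fun w => Yf q m (row w)) = 0,
      Ex (fun w => Yf q m (row w) ^+ 2) = 2 * (m - Wf q) / m ^+ 2 &
      Ex (fun w => Yf q m (row w) ^+ 4) <= cY / m ^+ 2].
Proof.
have [qs _ _] := pq.
have [L e v h] := quad_moments X_indep K01 X4i X1 X2 X4 q (index_enum_uniq I).
have L' : L4 X [set: I]%SET (fun w => quad q (row w) (index_enum I)).
  by apply: L4_sub L; apply/fintype.subsetP => i; rewrite inE.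
have qv := quadvE (index_enum_uniq I) qs; rewrite (is_proj_offdiag pq) in qv.
split.
- rewrite (funext Yf_quad); exact: L4Z.
- rewrite (funext Yf_quad) ExZ ?e ?mulr0//.
  exact: (le_moment2 (L4_meas L') L'.2).2.
- rewrite (eq_Ex _ (fun w => congr1 (fun x => x ^+ 2) (Yf_quad w))).
  rewrite (eq_Ex _ (fun w => exprMn _ _ _)) ExZ; last first.
    exact: (le_moment2 (L4_meas L') L'.2).1.
  rewrite v -qv exprVn mulrC; congr (_ / _); ring.
- rewrite (eq_Ex _ (fun w => congr1 (fun x => x ^+ 4) (Yf_quad w))).
  rewrite (eq_Ex _ (fun w => exprMn _ _ _)) ExZ; last exact: L'.2.
  rewrite exprVn mulrC ler_pdivrMr ?exprn_gt0//.
  apply: (le_trans h); rewrite -/cY.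
  have qm : quadv q (index_enum I) <= m.
    have := Wf_ge0 q; have := quadv_ge0 q (index_enum I); move: qv; lra.
  rewrite (_ : cY / m ^+ 2 * m ^+ 4 = cY * m ^+ 2); last first.
    by field; rewrite gt_eqF.
  by rewrite ler_wpM2l ?mulr_ge0 ?exprn_ge0// lerXn2r ?nnegrE ?quadv_ge0// ltW.
Qed.

Lemma Zf_moments :
  [/\ itg (fun w => Zf q m (row w)), itg (fun w => Zf q m (row w) ^+ 2),
      Ex (fun w => Zf q m (row w)) = 0 &
      Ex (fun w => Zf q m (row w) ^+ 2) <= K0 * Wf q / m ^+ 2].
Proof.
pose h i w := X i w ^+ 2 - 1.
have ih i : itg (h i) by apply: itgB => //; exact: itg_cst.
have hE i w : h i w ^+ 2 = X i w ^+ 4 - 2 * X i w ^+ 2 + 1 by rewrite /h; ring.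
have ih2 i : itg (fun w => h i w ^+ 2).
  rewrite (funext (hE i)); apply: itgD; last exact: itg_cst.
  by apply: itgB => //; exact: itgZ.
have h0 i : Ex (h i) = 0 by rewrite ExB ?X2 ?Ex_cst ?subrr//; exact: itg_cst.
have h2 i : Ex (fun w => h i w ^+ 2) <= K0.
  rewrite (funext (hE i)) ExD ?Ex_cst; [|by apply: itgB => //; exact: itgZ|exact: itg_cst].
  rewrite ExB//; last exact: itgZ.
  by rewrite ExZ// X2; have := X4 i; lra.
have mh i : measurable_fun setT (h i : sigT X [set i]%SET -> R).
  apply: measurable_funB; last exact: measurable_cst.
  by apply: measurable_funX; exact: (L4_X X4i i).1.
have [il2 el2] := linear_form2 X_indep (fun i => q i i) mh ih ih2 h0.
have il : itg (fun w => \sum_i q i i * h i w).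
  by apply: itg_sum => i _; exact: itgZ.
have ZE w : Zf q m (row w) = m^-1 * \sum_i q i i * h i w by rewrite /Zf mulrC.
split.
- by rewrite (funext ZE); exact: itgZ.
- apply: (@eq_itg _ _ _ _ (fun w => m^-1 ^+ 2 * (\sum_i q i i * h i w) ^+ 2)).
    by move=> w; rewrite ZE exprMn.
  exact: itgZ.
- rewrite (funext ZE) ExZ// Ex_sum; last by move=> i _; exact: itgZ.
  by rewrite big1 ?mulr0// => i _; rewrite ExZ// h0 mulr0.
- rewrite (@eq_Ex _ _ _ _ _ (fun w => m^-1 ^+ 2 * (\sum_i q i i * h i w) ^+ 2)).
    rewrite ExZ// el2 exprVn mulrC ler_pM2r ?invr_gt0 ?exprn_gt0//.
    rewrite /Wf mulr_sumr; apply: ler_sum => i _.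
    by rewrite mulrC ler_wpM2r ?sqr_ge0.
  by move=> w; rewrite ZE exprMn.
Qed.

(** The factor 4^4 comes from Markov's inequality for fourth powers at level 1/4; the rest is the
    constant of [linear_form4] for variables bounded by 4 K0. *)
Definition cT := 4 ^+ 4 * (16 * ((4 * K0) ^+ 4) ^+ 2).

(* Only the lower tail matters, so the squares may be replaced by their
   truncations at [4 * K0], which have all moments. *)
Lemma Zf_lower_tail :
  Pr P [set w | 1 + Zf q m (row w) <= 2^-1] <= cT * Wf q ^+ 2 / m ^+ 4.
Proof.
pose L := 4 * K0.
have L0 : 0 < L by rewrite mulr_gt0// (lt_le_trans ltr01).
have L1 : 1 <= L by rewrite /L; move: K01; lra.
pose t i w := Num.min (X i w ^+ 2) L.
have mt i : measurable_fun setT (t i : sigT X [set i]%SET -> R).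
  apply: measurable_minr; last exact: measurable_cst.
  by apply: measurable_funX; exact: (L4_X X4i i).1.
have t0 i w : 0 <= t i w <= L.
  by rewrite /t le_min sqr_ge0 ltW//= ge_min lexx orbT.
have it i : itg (t i).
  apply: (@bounded_itg _ _ _ _ _ L); first exact: measurable_fun_sigT (mt i).
  by move=> w; have /andP[a b] := t0 i w; rewrite ger0_norm.
pose mu i := Ex (t i).
(* Truncation costs at most a quarter of the mean: min(y, L) >= y - y^2/L for y >= 0, and the fourth
   moment divided by [L] is at most 1/4. *)
have mu_ge i : 3 / 4 <= mu i.
  have -> : 3 / 4 = 1 - 4^-1 :> R by field.
  apply: (@le_trans _ _ (Ex (fun w => X i w ^+ 2 - L^-1 * X i w ^+ 4))).
    rewrite ExB ?ExZ ?X2//; last exact: itgZ.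
    rewrite lerD2l lerN2 mulrC ler_pdivrMr//.
    by rewrite /L mulrA mulVf ?mul1r ?X4// pnatr_eq0.
  apply: le_Ex => //; first by apply: itgB => //; exact: itgZ.
  move=> w; rewrite (_ : X i w ^+ 4 = X i w ^+ 2 * X i w ^+ 2); last by ring.
  have := sqr_ge0 (X i w); rewrite /t; move: (X i w ^+ 2) => y y0.
  rewrite le_min; apply/andP; split.
    by rewrite lerBlDr lerDl !mulr_ge0// invr_ge0 ltW.
  rewrite mulrA; have [yL|yL] := leP y L.
    apply: le_trans yL; rewrite lerBlDr lerDl !mulr_ge0// invr_ge0 ltW//.
  apply: (@le_trans _ _ 0); last exact: ltW.
  by rewrite subr_le0 ler_peMl// mulrC ler_pdivlMr// mul1r ltW.
have mu_le i : mu i <= L.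
  rewrite /mu -(Ex_cst P L); apply: le_Ex => //; first exact: itg_cst.
  by move=> w; have /andP[] := t0 i w.
pose h i w := t i w - mu i.
have hL i w : `|h i w| <= L.
  rewrite ler_norml /h; have /andP[a b] := t0 i w.
  have := mu_ge i; have := mu_le i; lra.
have h4L i w : h i w ^+ 4 <= L ^+ 4.
  apply: le_trans (ler_norm _) _; rewrite normrX lerXn2r// nnegrE//.
  exact: ltW.
have mh i : measurable_fun setT (h i : sigT X [set i]%SET -> R).
  by apply: measurable_funB => //; exact: measurable_cst.
have hL4 i : L4 X [set i]%SET (h i).
  split => //; apply: (@bounded_itg _ _ _ _ _ (L ^+ 4)).
    by apply: measurable_funX; exact: measurable_fun_sigT (mh i).
  by move=> w; rewrite normrX lerXn2r// nnegrE// ltW.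
have h0 i : Ex (h i) = 0 by rewrite ExB ?Ex_cst ?subrr//; exact: itg_cst.
have h4 i : Ex (fun w => h i w ^+ 4) <= L ^+ 4.
  rewrite -(Ex_cst P (L ^+ 4)); apply: le_Ex => //; last exact: itg_cst.
  exact: (hL4 i).2.
have LL : 1 <= L ^+ 4 by rewrite exprn_ege1.
have [Lf _ f4] := linear_form4 X_indep (fun i => q i i / m) LL hL4 h0 h4 (index_enum_uniq I).
have [_ _ qm] := pq.
have qi0 i : 0 <= q i i / m by rewrite divr_ge0 ?(is_proj_diag_ge0 i pq)// ltW.
have q1 : \sum_i q i i / m = 1 by rewrite -mulr_suml qm divff// gt_eqF.
set f := fun w => \sum_i q i i / m * h i w.
have iZ := Zf_moments; case: iZ => iZ _ _ _.
have := @markov_Ex _ _ _ P (fun w => f w ^+ 4)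
  [set w | 1 + Zf q m (row w) <= 2^-1] (4^-1 ^+ 4).
move=> /(_ _ _ Lf.2) H; apply: (le_trans (H _ _ _ _)).
- by rewrite exprn_gt0.
- rewrite -[X in measurable X]setTI; apply: measurable_fun_ler => //.
  apply: measurable_funD; [exact: measurable_cst|exact: itg_meas iZ].
- by move=> w; rewrite exprn_even_ge0.
- move=> w /= hw.
  (* On this event the weighted sum of truncated squares is at most 1/2, while its mean is at least
     3/4. *)
  suff hf : f w <= - 4^-1.
    rewrite (_ : f w ^+ 4 = (- f w) ^+ 4); last by ring.
    rewrite lerXn2r ?nnegrE ?invr_ge0//; [|]; move: hf; lra.
  have e1 : 1 + Zf q m (row w) = \sum_i q i i / m * X i w ^+ 2.
    rewrite /Zf mulr_suml -{1}q1 -big_split/=; apply: eq_bigr => i _; ring.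
  have e2 : f w = \sum_i q i i / m * t i w - \sum_i q i i / m * mu i.
    by rewrite -sumrB; apply: eq_bigr => i _; rewrite mulrBr.
  have e3 : \sum_i q i i / m * t i w <= \sum_i q i i / m * X i w ^+ 2.
    by apply: ler_sum => i _; rewrite ler_wpM2l// ge_min lexx.
  have e4 : 3 / 4 <= \sum_i q i i / m * mu i.
    rewrite -[leLHS]mul1r -[X in X * _ <= _]q1 mulr_suml; apply: ler_sum => i _.
    by rewrite ler_wpM2l.
  rewrite e1 in hw; rewrite e2; lra.
have hW : \sum_i (q i i / m) ^+ 2 = Wf q / m ^+ 2.
  by rewrite /Wf mulr_suml; apply: eq_bigr => i _; rewrite exprMn exprVn.
rewrite exprVn invrK mulrC /cT -/L.
rewrite (_ : _ / m ^+ 4 =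
    4 ^+ 4 * (16 * (L ^+ 4) ^+ 2 * (Wf q / m ^+ 2) ^+ 2)); last first.
  by move: (4 ^+ 4) (L ^+ 4) => a b; field; rewrite gt_eqF.
by rewrite ler_wpM2l ?exprn_ge0// -hW.
Qed.

End row_moments.

Lemma row_W_num1 (R : realType) (K s : R) : 1 <= K -> 1 <= s ->
  (4 + 2 * K) * (16 * K ^+ 2) * (s ^+ 6)^-1 <= (10 * K ^+ 2 / s ^+ 3) ^+ 2.
Proof.
move=> K1 s1; rewrite [leRHS](_ : _ = (100 * K ^+ 4) * (s ^+ 6)^-1); last first.
  by field; rewrite gt_eqF// (lt_le_trans ltr01).
rewrite ler_wpM2r ?invr_ge0 ?exprn_ge0 ?(le_trans ler01)//.
rewrite (_ : 100 * K ^+ 4 = 100 * K ^+ 2 * K ^+ 2); last by ring.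
rewrite mulrA ler_wpM2r ?sqr_ge0//; nra.
Qed.

(** * Average loss of W_k when one more row is projected out *)

Section row_W.
Context (d : measure_display) (T : measurableType d) (R : realType)
  (P : probability T R) (I : finType) (X : I -> {RV P >-> R}).
Hypothesis X_indep : mutually_independent X.
Notation itg := (itg P).
Notation Ex := (Ex P).
Variable K0 : R.
Hypotheses (K01 : 1 <= K0) (X4i : forall i, itg (fun w => X i w ^+ 4))
  (X1 : forall i, Ex (X i) = 0) (X2 : forall i, Ex (fun w => X i w ^+ 2) = 1)
  (X4 : forall i, Ex (fun w => X i w ^+ 4) <= K0).
Variables (q : I -> I -> R) (m : R).
Hypotheses (m1 : 1 <= m) (pq : is_proj q m).
Let m0 : 0 < m. Proof. exact: lt_le_trans m1. Qed.
Notation row w := (fun i => X i w).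

(** A lower bound for the decrease of W_k that is polynomial in the row: the true decrease has [xf]
    in a denominator, and 1/x >= 2 - x removes it. *)
Definition row_gain (q : I -> I -> R) (m : R) (x : I -> R) :=
  \sum_i (2 * q i i * (yf q m i x * (2 - xf q m x)) - 4 * yf q m i x ^+ 2).

Lemma YZ_moment2 :
  itg (fun w => (Yf q m (row w) + Zf q m (row w)) ^+ 2) /\
  Ex (fun w => (Yf q m (row w) + Zf q m (row w)) ^+ 2) <= (4 + 2 * K0) / m.
Proof.
have [LY _ Y2 _] := Yf_moments X_indep K01 X4i X1 X2 X4 m1 pq.
have [iZ iZ2 _ Z2] := Zf_moments X_indep X4i X2 X4 q m1.
have iY2 := (le_moment2 (L4_meas LY) LY.2).1.
have iS : itg (fun w => 2 * Yf q m (row w) ^+ 2 + 2 * Zf q m (row w) ^+ 2).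
  by apply: itgD; exact: itgZ.
have le_yz w : (Yf q m (row w) + Zf q m (row w)) ^+ 2 <=
    2 * Yf q m (row w) ^+ 2 + 2 * Zf q m (row w) ^+ 2.
  move: (Yf q m (row w)) (Zf q m (row w)) => y z.
  have := sqr_ge0 (y - z); rewrite sqrrB sqrrD; lra.
have i2 : itg (fun w => (Yf q m (row w) + Zf q m (row w)) ^+ 2).
  apply: (le_itg _ _ iS).
    apply: measurable_funX; apply: measurable_funD; last exact: (itg_meas iZ).
    exact: L4_meas LY.
  by move=> w; rewrite ger0_norm ?sqr_ge0.
split => //; apply: (le_trans (le_Ex i2 iS le_yz)).
rewrite ExD ?ExZ//; [|exact: itgZ|exact: itgZ].
have W0 := Wf_ge0 q; have Wm := Wf_le pq.
have h1 : Ex (fun w => Yf q m (row w) ^+ 2) <= 2 / m.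
  rewrite Y2 ler_pdivrMr ?exprn_gt0// (_ : 2 / m * m ^+ 2 = 2 * m); last first.
    by field; rewrite gt_eqF.
  by rewrite ler_wpM2l// gerBl.
have h2 : Ex (fun w => Zf q m (row w) ^+ 2) <= K0 / m.
  apply: (le_trans Z2); rewrite ler_pdivrMr ?exprn_gt0//.
  rewrite (_ : K0 / m * m ^+ 2 = K0 * m); last by field; rewrite gt_eqF.
  by rewrite ler_wpM2l// (le_trans ler01).
rewrite [leRHS](_ : _ = 2 * (2 / m) + 2 * (K0 / m)); last by field; rewrite gt_eqF.
by apply: lerD; rewrite ler_wpM2l.
Qed.

Lemma yf_moments i : let y := fun w => yf q m i (row w) in
  [/\ measurable_fun setT y, itg y, itg (fun w => y w ^+ 2), Ex y = q i i / m &
      Ex (fun w => y w ^+ 2) <= 16 * K0 ^+ 2 * q i i ^+ 2 / m ^+ 2].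
Proof.
move=> y; have [qs qd qt] := pq.
have [L _ l4] := linear_form4 X_indep (q i) K01 (L4_X X4i) X1 X4 (index_enum_uniq I).
have [il2 el2] := linear_formX2 X_indep X4i X1 X2 (q i).
rewrite qd in l4 el2.
have yE w : y w = m^-1 * (\sum_j q i j * X j w) ^+ 2 by rewrite /y /yf mulrC.
have y2E w : y w ^+ 2 = m^-1 ^+ 2 * (\sum_j q i j * X j w) ^+ 4.
  by rewrite yE exprMn -exprM.
have iy : itg y by rewrite (funext yE); exact: itgZ.
have iy2 : itg (fun w => y w ^+ 2) by rewrite (funext y2E); apply: itgZ; exact: L.2.
split => //; first exact: itg_meas iy.
  by rewrite (funext yE) ExZ// el2 mulrC.
rewrite (funext y2E) ExZ; last exact: L.2.
by rewrite exprVn mulrC ler_pM2r// invr_gt0 exprn_gt0.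
Qed.

(** The main term is 2 q_ii E y_i = 2 q_ii^2/m. Writing 2 - x = 1 - u with u = Y + Z, Cauchy-Schwarz
    gives E u y_i <= 10 K0^2 q_ii / m^(3/2). This error and that of the y_i^2 contribute 20 K0^2 and
    64 K0^2, hence the 84. *)
Lemma row_gain_Ex : itg (fun w => row_gain q m (row w)) /\
  Wf q * (2 / m - 84 * K0 ^+ 2 / (m * Num.sqrt m)) <=
    Ex (fun w => row_gain q m (row w)).
Proof.
have [qs qd qt] := pq.
have [iu2 u2] := YZ_moment2.
have [LY _ _ _] := Yf_moments X_indep K01 X4i X1 X2 X4 m1 pq.
have [iZ iZ2 _ Z2] := Zf_moments X_indep X4i X2 X4 q m1.
pose u w := Yf q m (row w) + Zf q m (row w).
have mu : measurable_fun setT u.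
  by apply: measurable_funD; [exact: L4_meas LY|exact: (itg_meas iZ)].
pose s := Num.sqrt m.
have s1 : 1 <= s by rewrite -sqrtr1 ler_wsqrtr.
have s0 : 0 < s by rewrite (lt_le_trans ltr01).
have ms : m = s ^+ 2 by rewrite /s sqr_sqrtr// ltW.
pose y i w := yf q m i (row w).
pose g i w := 2 * q i i * (y i w * (2 - xf q m (row w))) - 4 * y i w ^+ 2.
have gE i w : g i w = (2 * q i i) * y i w - (2 * q i i) * (u w * y i w) - 4 * y i w ^+ 2.
  by rewrite /g xfE ?gt_eqF// /u; ring.
have main i : itg (g i) /\
    q i i ^+ 2 * (2 / m - 84 * K0 ^+ 2 / (m * s)) <= Ex (g i).
  have [my iy iy2 y1 y2] := yf_moments i.
  have [iuy cs] := cauchy_schwarz_Ex mu my iu2 iy2.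
  have q0 := is_proj_diag_ge0 i pq.
  have i2 : itg (fun w => (2 * q i i) * y i w - (2 * q i i) * (u w * y i w)).
    by apply: itgB; exact: itgZ.
  rewrite (funext (gE i)); split; first by apply: itgB => //; exact: itgZ.
  rewrite ExB//; last exact: itgZ.
  rewrite ExB; [|exact: itgZ|exact: itgZ].
  rewrite !ExZ//; rewrite -/(y i) in y1 y2 cs.
  have uy : Ex (fun w => u w * y i w) <= 10 * K0 ^+ 2 / s ^+ 3 * q i i.
    apply: (le_trans (ler_norm _)).
    rewrite -(@ler_pXn2r _ 2)// ?nnegrE//; last first.
      by rewrite !mulr_ge0// ?invr_ge0 ?exprn_ge0 ?(le_trans ler01)// ltW.
    rewrite real_normK ?num_real//; apply: (le_trans cs).
    rewrite exprMn; apply: (@le_trans _ _ ((4 + 2 * K0) / m * (16 * K0 ^+ 2 * q i i ^+ 2 / m ^+ 2))).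
      by apply: ler_pM => //; apply: Ex_ge0 => w; exact: sqr_ge0.
    rewrite (_ : _ * _ = (4 + 2 * K0) * (16 * K0 ^+ 2) * (s ^+ 6)^-1 * q i i ^+ 2).
      by rewrite ler_wpM2r ?sqr_ge0// row_W_num1.
    by rewrite ms; field; rewrite gt_eqF.
  rewrite y1; move: uy y2.
  set e1 := Ex _; set e2 := Ex _ => uy y2.
  have h1 : 2 * q i i * e1 <= 20 * K0 ^+ 2 / s ^+ 3 * q i i ^+ 2.
    rewrite [leRHS](_ : _ = 2 * q i i * (10 * K0 ^+ 2 / s ^+ 3 * q i i)); last by ring.
    by rewrite ler_wpM2l// mulr_ge0.
  have K00 : 0 <= K0 by rewrite (le_trans ler01).
  have h2 : 4 * e2 <= 64 * K0 ^+ 2 / s ^+ 3 * q i i ^+ 2.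
    apply: (@le_trans _ _ (4 * (16 * K0 ^+ 2 * q i i ^+ 2 / m ^+ 2))).
      by rewrite ler_wpM2l.
    rewrite (_ : 64 * K0 ^+ 2 / s ^+ 3 * q i i ^+ 2 =
      4 * (16 * K0 ^+ 2 * q i i ^+ 2 / s ^+ 3)); last by ring.
    rewrite ler_wpM2l// ler_wpM2l ?mulr_ge0 ?sqr_ge0//.
    rewrite lef_pV2 ?posrE ?exprn_gt0// ms -exprM.
    by rewrite ler_weXn2l.
  rewrite (_ : q i i ^+ 2 * _ = 2 * q i i * (q i i / m) -
    20 * K0 ^+ 2 / s ^+ 3 * q i i ^+ 2 - 64 * K0 ^+ 2 / s ^+ 3 * q i i ^+ 2).
    move: h1 h2; lra.
  by rewrite ms; field; rewrite gt_eqF.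
have sE w : row_gain q m (row w) = \sum_i g i w by [].
rewrite (funext sE); split; first by apply: itg_sum => i _; exact: (main i).1.
rewrite Ex_sum; last by move=> i _; exact: (main i).1.
rewrite /Wf mulr_suml; apply: ler_sum => i _; exact: (main i).2.
Qed.

End row_W.

(** * Normal distribution function and Gaussian smoothing *)

Section taylor.
Context (R : realType).

Lemma mvt_between (f df : R -> R) (a b : R) :
  (forall x : R, is_derive x 1 f (df x)) ->
  exists c, [/\ Num.min a b <= c, c <= Num.max a b & f b - f a = df c * (b - a)].
Proof.
move=> fd; have cf : continuous f.
  move=> x; have [dx _] := fd x.
  exact/differentiable_continuous/derivable1_diffP.
wlog ab : a b / a <= b.
  move=> H; have /orP[|ba] := le_total a b; first exact: H.
  have [c [h1 h2 e]] := H b a ba; exists c; split.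
  - by rewrite minC.
  - by rewrite maxC.
  - by rewrite -opprB e -mulrN opprB.
have [c] := MVT_segment ab (fun x _ => fd x) (continuous_subspaceT cf).
rewrite in_itv/= => /andP[ac cb] e; exists c; split => //.
  by rewrite ge_min ac.
by rewrite le_max cb orbT.
Qed.

Lemma mvt0 (f df : R -> R) (h B : R) :
  (forall x : R, is_derive x 1 f (df x)) -> f 0 = 0 ->
  (forall x, `|x| <= `|h| -> `|df x| <= B) -> `|f h| <= B * `|h|.
Proof.
move=> fd f0 dfB; have [c [h1 h2]] := mvt_between 0 h fd.
rewrite f0 !subr0 => ->; rewrite normrM ler_wpM2r// dfB//.
move: h1 h2; have [h0|h0] := leP 0 h.
  by move=> c0 ch; rewrite !ger0_norm.
by move=> hc c0; rewrite !ler0_norm ?lerN2// ltW.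
Qed.

(** The mean value theorem is applied to the successive remainders, which gives [C] in place of the
    sharp C/6. *)
Lemma taylor3 (g g1 g2 g3 : R -> R) (C z h : R) :
  (forall x : R, is_derive x 1 g (g1 x)) -> (forall x : R, is_derive x 1 g1 (g2 x)) ->
  (forall x : R, is_derive x 1 g2 (g3 x)) -> (forall x, `|g3 x| <= C) ->
  `|g (z + h) - g z - h * g1 z - h ^+ 2 / 2 * g2 z| <= C * `|h| ^+ 3.
Proof.
move=> d1 d2 d3 gC.
have sh (f df : R -> R) (x : R) : (forall x : R, is_derive x 1 f (df x)) ->
    is_derive x 1 (fun t => f (z + t)) (df (z + x)).
  move=> fd; rewrite (_ : (fun t => _) = f \o (cst z + id)); last by [].
  by apply: is_derive_eq; rewrite /= add0r mulr1.
pose r2 t := g2 (z + t) - g2 z.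
pose r1 t := g1 (z + t) - g1 z - t * g2 z.
pose r0 t := g (z + t) - g z - t * g1 z - t ^+ 2 / 2 * g2 z.
have dr2 (x : R) : is_derive x 1 r2 (g3 (z + x)).
  rewrite (_ : r2 = (fun t => g2 (z + t)) - cst (g2 z))//.
  have := sh _ _ x d3 => ?; apply: is_derive_eq; by rewrite subr0.
have dr1 (x : R) : is_derive x 1 r1 (r2 x).
  rewrite (_ : r1 = (fun t => g1 (z + t)) - cst (g1 z) - (g2 z \*: id)); last first.
    by apply/funext => t; rewrite /r1 /= !fctE/= [_ *: _]mulrC.
  have := sh _ _ x d2 => ?; apply: is_derive_eq.
  by rewrite subr0 /r2 [_ *: _]mulr1.
have dr0 (x : R) : is_derive x 1 r0 (r1 x).
  rewrite (_ : r0 = (fun t => g (z + t)) - cst (g z) - (g1 z \*: id) -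
    ((g2 z / 2) \*: (id ^+ 2))); last first.
    apply/funext => t; rewrite /r0 /= !fctE/= [_ *: t]mulrC; congr (_ - _).
    by rewrite /GRing.scale/=; ring.
  have := sh _ _ x d1 => ?; apply: is_derive_eq.
  by rewrite subr0 /r1 /GRing.scale/=; field.
have C0 : 0 <= C by exact: le_trans (gC 0).
have b2 t : `|r2 t| <= C * `|t|.
  by apply: (mvt0 dr2); rewrite /r2 ?addr0 ?subrr.
have b1 t : `|r1 t| <= C * `|t| ^+ 2.
  rewrite expr2 mulrA; apply: (mvt0 dr1); first by rewrite /r1 addr0 subrr mul0r subr0.
  by move=> x xt; rewrite (le_trans (b2 x))// ler_wpM2l.
rewrite -/(r0 h) exprSr mulrA; apply: (mvt0 dr0).
  by rewrite /r0 addr0 subrr !mul0r expr0n/= mul0r mul0r !subr0.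
move=> x xt; rewrite (le_trans (b1 x))// ler_wpM2l//.
by rewrite lerXn2r// nnegrE.
Qed.

End taylor.

Section gauss.
Context (R : realType).
Notation mu := (@lebesgue_measure R).

Definition phi (x : R) : R := normal_pdf 0 1 x.
Definition Phi (x : R) : R := Pr (normal_prob 0 1) `]-oo, x].

Lemma phiE x : phi x = normal_peak 1 * expR (- (x ^+ 2 / 2)).
Proof.
transitivity (normal_peak (1 : R) * expR (- (x - 0) ^+ 2 / (1 ^+ 2 *+ 2))).
  by rewrite /phi normal_pdfE// oner_neq0.
by rewrite subr0 expr1n mulNr.
Qed.

Lemma peak_le1 : normal_peak (1 : R) <= 1.
Proof.
rewrite /normal_peak invf_le1; last first.
  by rewrite sqrtr_gt0 expr1n mul1r mulrn_wgt0// pi_gt0.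
rewrite -[leLHS]sqrtr1; apply: ler_wsqrtr; rewrite expr1n mul1r -mulr_natr.
by have := pi_ge2 R; lra.
Qed.

Lemma phi_ge0 x : 0 <= phi x.
Proof. exact: normal_pdf_ge0. Qed.

(** From exp(x^2/2) = exp(x^2/4)^2 >= (1 + x^2/4)^2. The bounds on [phi] times a polynomial below
    all follow from this decay of order 4. *)
Lemma phi_bound x : phi x * (1 + x ^+ 2 / 4) ^+ 2 <= 1.
Proof.
have p0 := @normal_peak_ge0 R 1; have p1 := peak_le1.
have e : (1 + x ^+ 2 / 4) ^+ 2 <= expR (x ^+ 2 / 2).
  rewrite (_ : x ^+ 2 / 2 = x ^+ 2 / 4 + x ^+ 2 / 4); last by field.
  rewrite expRD -expr2 lerXn2r ?nnegrE ?expR_ge0 ?expR_ge1Dx//.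
  by rewrite addr_ge0// mulr_ge0// sqr_ge0.
rewrite phiE; apply: (@le_trans _ _ (1 * expR (- (x ^+ 2 / 2)) * expR (x ^+ 2 / 2))).
  apply: ler_pM => //; first by rewrite mulr_ge0// expR_ge0.
    exact: sqr_ge0.
  by rewrite ler_wpM2r// expR_ge0.
by rewrite mul1r -expRD addNr expR0.
Qed.

Lemma phi_le1 x : phi x <= 1.
Proof.
apply: le_trans (phi_bound x); rewrite ler_peMr ?phi_ge0//.
by have := sqr_ge0 x; nra.
Qed.

Lemma xphi_le1 x : `|x * phi x| <= 1.
Proof.
rewrite normrM (ger0_norm (phi_ge0 x)) mulrC.
apply: le_trans (phi_bound x); rewrite ler_wpM2l ?phi_ge0//.
rewrite -(real_normK (num_real x)); have := normr_ge0 x.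
move: (`|x|) => y y0; have := sqr_ge0 (y - 2); have := sqr_ge0 (y ^+ 2); nra.
Qed.

Lemma x3phi_le x : `|x ^+ 3 * phi x| <= 8.
Proof.
rewrite normrM (ger0_norm (phi_ge0 x)) mulrC.
apply: (@le_trans _ _ (phi x * (8 * (1 + x ^+ 2 / 4) ^+ 2))).
  rewrite ler_wpM2l ?phi_ge0// normrX.
  rewrite -(real_normK (num_real x)); have := normr_ge0 x.
  move: (`|x|) => y y0; have := sqr_ge0 (y * (y - 1)); have := sqr_ge0 (y - 1); nra.
by rewrite mulrCA -[leRHS]mulr1 ler_wpM2l// phi_bound.
Qed.

Lemma is_derive_phi (x : R) : is_derive x 1 phi (- x * phi x).
Proof.
have -> : phi = (normal_peak 1) \*: (expR \o (- 2^-1 \*: (id ^+ 2))).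
  apply/funext => y; rewrite phiE /= !fctE/=; congr (_ * expR _).
  by rewrite /GRing.scale/= mulNr mulrC.
apply: is_derive_eq; rewrite /= /GRing.scale/= !fctE/= /GRing.scale/=; by field.
Qed.

Lemma is_derive_Phi (x : R) : is_derive x 1 Phi (phi x).
Proof.
have [||||d e] := @continuous_FTC1 R phi -oo%O x (x + 1).
- by rewrite ltrDl.
- by apply: (integrableS measurableT) => //; exact: integrable_normal_pdf.
- by rewrite ltNyr.
- by apply: continuous_normal_pdf; exact: oner_neq0.
rewrite (_ : Phi = fun y => \int[mu]_(t in [set` `]-oo, y]]) phi t); last exact: funext.
apply: (DeriveDef d).
rewrite -derive1E.
exact: e.
Qed.

Definition phi2 x := (x ^+ 2 - 1) * phi x.

Lemma is_derive_phi1 (x : R) : is_derive x 1 (fun x => - x * phi x) (phi2 x).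
Proof.
rewrite (_ : (fun x => _) = (- id) * phi)//.
have := is_derive_phi x => ?; apply: is_derive_eq.
by rewrite /phi2 /GRing.scale/= !fctE/=; ring.
Qed.

Lemma phi2_le x : `|phi2 x| <= 3.
Proof.
rewrite /phi2 normrM (ger0_norm (phi_ge0 x)) mulrC.
apply: (@le_trans _ _ (phi x * (3 * (1 + x ^+ 2 / 4) ^+ 2))).
  rewrite ler_wpM2l ?phi_ge0// ler_norml; have := sqr_ge0 x; have := sqr_ge0 (x ^+ 2).
  by move: (x ^+ 2) => y; nra.
by rewrite mulrCA -[leRHS]mulr1 ler_wpM2l// phi_bound.
Qed.

Lemma Phi_taylor z h :
  `|Phi (z + h) - Phi z - h * phi z - h ^+ 2 / 2 * (- z * phi z)| <= 3 * `|h| ^+ 3.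
Proof.
apply: (@taylor3 R Phi phi (fun x => - x * phi x) phi2).
- exact: is_derive_Phi.
- exact: is_derive_phi.
- exact: is_derive_phi1.
- exact: phi2_le.
Qed.

Lemma Phi_ge0 x : 0 <= Phi x.
Proof. exact: Pr_ge0. Qed.

Lemma Phi_le1 x : Phi x <= 1.
Proof. exact: Pr_le1. Qed.

Lemma le_Phi x y : x <= y -> Phi x <= Phi y.
Proof.
by move=> xy; apply: le_Pr => // z/=; rewrite !in_itv/= => /le_trans; apply.
Qed.

Lemma Phi_lip x y : `|Phi x - Phi y| <= `|x - y|.
Proof.
have [c [_ _ ->]] := mvt_between y x is_derive_Phi.
by rewrite normrM ler_piMl// ger0_norm ?phi_ge0 ?phi_le1.
Qed.

Lemma continuous_Phi : continuous Phi.
Proof.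
move=> x; have [dx _] := is_derive_Phi x.
exact/differentiable_continuous/derivable1_diffP.
Qed.

(* Taylor expansion of [b -> Phi (z * b)] at [b = 1], with remainder uniform
   in [z] because [x^3 phi x] is bounded. *)
Lemma Phi_scale z s : 1 <= s ->
  `|Phi (z / s) - Phi z + (s ^+ 2 - 1) / 2 * (z * phi z)| <= 10 * (s ^+ 2 - 1) ^+ 2.
Proof.
move=> s1; have s0 : 0 < s by rewrite (lt_le_trans ltr01).
pose b := s^-1; have b0 : 0 < b by rewrite invr_gt0.
have b1 : b <= 1 by rewrite invf_le1.
have dG1 (t : R) : is_derive t 1 (fun b => Phi (z * b)) (z * phi (z * t)).
  rewrite (_ : (fun b => _) = Phi \o (z \*: id))//.
  have := is_derive_Phi ((z \*: id) t) => ?; apply: is_derive_eq.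
  by rewrite /GRing.scale/= mulr1 mulrC.
have dG2 (t : R) : is_derive t 1 (fun b => z * phi (z * b)) (- z ^+ 3 * t * phi (z * t)).
  rewrite (_ : (fun b => _) = z \*: (phi \o (z \*: id)))//.
  have := is_derive_phi ((z \*: id) t) => ?; apply: is_derive_eq.
  by rewrite /GRing.scale/= (_ : z *: t = z * t)//; ring.
have bound c : b <= c -> `|- z ^+ 3 * c * phi (z * c)| <= 8 * s ^+ 2.
  move=> bc; have c0 : 0 < c by exact: lt_le_trans bc.
  have -> : - z ^+ 3 * c * phi (z * c) = - (c ^- 2 * ((z * c) ^+ 3 * phi (z * c))).
    by field; rewrite gt_eqF.
  rewrite normrN normrM mulrC; apply: ler_pM => //; first exact: x3phi_le.
  have cV0 : 0 <= c^-1 by rewrite invr_ge0 ltW.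
  rewrite -exprVn ger0_norm; last exact: exprn_ge0.
  rewrite lerXn2r ?nnegrE//; first exact: ltW.
  by rewrite -[s]invrK lef_pV2 ?posrE.
pose r1 t := z * phi (z * t) - z * phi z.
pose r0 t := Phi (z * t) - Phi z - (t - 1) * (z * phi z).
have dr0 (t : R) : is_derive t 1 r0 (r1 t).
  rewrite (_ : r0 = (fun b => Phi (z * b)) - cst (Phi z) - ((z * phi z) \*: (id - cst 1))).
    have := dG1 t => ?; apply: is_derive_eq.
    by rewrite /r1 !subr0 /GRing.scale/= mulr1.
  by apply/funext => u; rewrite /r0 !fctE/= [_ *: _]mulrC.
have b_r1 t : b <= t -> t <= 1 -> `|r1 t| <= 8 * s ^+ 2 * (1 - b).
  move=> bt t1; have [c [c1 c2]] := mvt_between 1 t dG2.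
  rewrite mulr1 => e; rewrite /r1 e normrM; apply: ler_pM => //.
    by apply: bound; rewrite (le_trans _ c1)// le_min b1.
  by rewrite distrC ger0_norm ?subr_ge0// lerD2l lerN2.
have b_r0 : `|r0 b| <= 8 * s ^+ 2 * (1 - b) * (1 - b).
  have [c [c1 c2]] := mvt_between 1 b dr0.
  rewrite (_ : r0 1 = 0); last by rewrite /r0 mulr1 !subrr mul0r subrr.
  rewrite subr0 => ->; rewrite normrM; apply: ler_pM => //; last first.
    by rewrite distrC ger0_norm// subr_ge0.
  move: c1 c2; rewrite (min_idPr b1) (max_idPl b1) => ? ?; exact: b_r1.
have -> : Phi (z / s) - Phi z + (s ^+ 2 - 1) / 2 * (z * phi z) =
    r0 b + (b - 1 + (s ^+ 2 - 1) / 2) * (z * phi z).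
  by rewrite /r0 -/b; ring.
have e1 : 8 * s ^+ 2 * (1 - b) * (1 - b) = 8 * (s - 1) ^+ 2.
  by rewrite /b; field; rewrite gt_eqF.
have e2 : b - 1 + (s ^+ 2 - 1) / 2 = (s - 1) ^+ 2 * ((s + 2) * b / 2).
  by rewrite /b; field; rewrite gt_eqF.
have sb : s * b = 1 by rewrite divff// gt_eqF.
have h2 : `|(b - 1 + (s ^+ 2 - 1) / 2) * (z * phi z)| <= 2 * (s - 1) ^+ 2.
  rewrite normrM -[leRHS]mulr1; apply: ler_pM => //; last exact: xphi_le1.
  rewrite e2 normrM ger0_norm ?sqr_ge0// mulrC ler_wpM2r ?sqr_ge0//.
  rewrite ger0_norm; last by rewrite !mulr_ge0// ?addr_ge0 ?ltW.
  by rewrite mulrDl sb; lra.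
apply: (le_trans (ler_normD _ _)); rewrite e1 in b_r0.
have : (s - 1) ^+ 2 <= (s ^+ 2 - 1) ^+ 2.
  have ss : s <= s ^+ 2 by rewrite expr2 ler_peMl// ltW.
  by rewrite lerXn2r ?nnegrE ?subr_ge0 ?(le_trans s1)// lerD2r.
by move: b_r0 h2; lra.
Qed.

End gauss.

Section heat.
Context (R : realType).

(* For [u > 0], the probability that [t + sqrt u * N <= a] with [N] standard
   Gaussian, so that adding a centred variable of variance [s] to [t] is
   compensated to second order by raising [u] by [s]. *)
Definition heat (a u t : R) : R := Phi ((a - t) / Num.sqrt u).

Lemma heat_ge0 a u t : 0 <= heat a u t. Proof. exact: Phi_ge0. Qed.

Lemma heat_le1 a u t : heat a u t <= 1. Proof. exact: Phi_le1. Qed.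

Lemma measurable_heat a u : measurable_fun setT (heat a u).
Proof.
apply: (measurableT_comp (continuous_measurable_fun (@continuous_Phi R))).
apply: measurable_funM; last exact: measurable_cst.
by apply: measurable_funB; [exact: measurable_cst|exact: measurable_id].
Qed.

Definition heat1 (a u t : R) : R := - phi ((a - t) / Num.sqrt u) / Num.sqrt u.
(** Half the second derivative of [heat] in [t], and at the same time its derivative in [u]: this is
    the heat equation, and it makes the second-order effect of a random increment cancel against an
    increase of [u] by its variance. *)
Definition heat2 (a u t : R) : R :=
  - (((a - t) / Num.sqrt u) * phi ((a - t) / Num.sqrt u)) / (2 * u).

Lemma heat_taylor (dl a u t y : R) : 0 < dl -> dl ^+ 2 <= u ->
  `|heat a u (t + y) - heat a u t - y * heat1 a u t - y ^+ 2 * heat2 a u t| <=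
  3 / dl ^+ 3 * `|y| ^+ 3.
Proof.
move=> dl0 ud; have u0 : 0 < u by rewrite (lt_le_trans _ ud)// exprn_gt0.
have su : 0 < Num.sqrt u by rewrite sqrtr_gt0.
have dsu : dl <= Num.sqrt u.
  by rewrite -[dl]ger0_norm ?(ltW dl0)// -sqrtr_sqr ler_wsqrtr.
have uE : u = Num.sqrt u ^+ 2 by rewrite sqr_sqrtr// ltW.
rewrite /heat /heat1 /heat2 [X in 2 * X]uE.
move: (Num.sqrt u) su dsu => r r0 dr.
have := Phi_taylor ((a - t) / r) (- y / r).
rewrite (_ : (a - t) / r + - y / r = (a - (t + y)) / r); last by field; rewrite gt_eqF.
set z := (a - t) / r => h.
rewrite (_ : _ - _ - _ - _ = Phi ((a - (t + y)) / r) - Phi z - - y / r * phi z -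
  (- y / r) ^+ 2 / 2 * (- z * phi z)); last by field; rewrite gt_eqF.
apply: (le_trans h); rewrite normrM normrN exprMn -mulrA ler_wpM2l//.
rewrite mulrC ler_wpM2r ?exprn_ge0// normfV exprVn lef_pV2 ?posrE ?exprn_gt0 ?normr_gt0 ?gt_eqF//.
by rewrite gtr0_norm// lerXn2r// nnegrE ltW.
Qed.

Lemma heat_time (dl a u t s : R) : 0 < dl -> dl ^+ 2 <= u -> 0 <= s ->
  `|heat a (u + s) t - heat a u t - s * heat2 a u t| <= 10 / dl ^+ 4 * s ^+ 2.
Proof.
move=> dl0 ud s0; have u0 : 0 < u by rewrite (lt_le_trans _ ud)// exprn_gt0.
have su : 0 < Num.sqrt u by rewrite sqrtr_gt0.
have su0 : 0 <= s / u by rewrite divr_ge0// ltW.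
pose g := Num.sqrt (1 + s / u).
have g1 : 1 <= g by rewrite -[leLHS]sqrtr1; apply: ler_wsqrtr; rewrite lerDl.
have g0 : 0 < g by rewrite (lt_le_trans ltr01).
have gE : g ^+ 2 - 1 = s / u.
  by rewrite /g sqr_sqrtr ?addr_ge0// addrAC subrr add0r.
have sg : Num.sqrt (u + s) = Num.sqrt u * g.
  have -> : u + s = u * (1 + s / u) by rewrite mulrDr mulr1 mulrCA divff ?mulr1 ?gt_eqF.
  by rewrite sqrtrM// ltW.
have := Phi_scale ((a - t) / Num.sqrt u) g1; rewrite gE /heat sg /heat2.
rewrite (_ : (a - t) / Num.sqrt u / g = (a - t) / (Num.sqrt u * g)); last first.
  by rewrite -mulrA -invfM.
set z := (a - t) / Num.sqrt u => h.
rewrite (_ : _ - _ - _ = Phi ((a - t) / (Num.sqrt u * g)) - Phi z +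
  s / u / 2 * (z * phi z)); last by field; rewrite gt_eqF.
apply: (le_trans h); rewrite exprMn -mulrA ler_wpM2l// mulrC ler_wpM2r ?sqr_ge0//.
rewrite exprVn lef_pV2 ?posrE ?exprn_gt0//.
by rewrite (_ : 4%N = (2 * 2)%N)// exprM lerXn2r// nnegrE ?sqr_ge0// ltW.
Qed.

Lemma heat2_le (dl a u t : R) : 0 < dl -> dl ^+ 2 <= u ->
  `|heat2 a u t| <= 1 / dl ^+ 2.
Proof.
move=> dl0 ud; have u0 : 0 < u by rewrite (lt_le_trans _ ud)// exprn_gt0.
rewrite /heat2 normrM normrN; apply: ler_pM => //; first exact: xphi_le1.
rewrite ger0_norm ?invr_ge0 ?mulr_ge0 ?(ltW u0)// lef_pV2 ?posrE ?exprn_gt0 ?mulr_gt0//.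
by move: ud u0; lra.
Qed.

End heat.

(** * One replacement step *)

Section heat_step.
Context (d : measure_display) (T : measurableType d) (R : realType)
  (P : probability T R).
Notation itg := (itg P).
Notation Ex := (Ex P).

(** Third absolute moments are traded for second and fourth ones; the weight [th] is left free so
    that each use can balance the two. *)
Lemma cube_le (y th : R) : 0 < th -> `|y| ^+ 3 <= th * y ^+ 2 + y ^+ 4 / th.
Proof.
move=> th0; have -> : y ^+ 2 = `|y| ^+ 2 by rewrite real_normK// num_real.
have -> : y ^+ 4 = `|y| ^+ 4.
  by rewrite (_ : 4%N = (2 * 2)%N)// !exprM real_normK// num_real.
have := normr_ge0 y; move: (`|y|) => x x0.
rewrite -subr_ge0 (_ : _ - _ = x ^+ 2 * ((th - x / 2) ^+ 2 + 3 / 4 * x ^+ 2) / th).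
  apply: divr_ge0; last exact: ltW.
  by apply: mulr_ge0; rewrite ?sqr_ge0// addr_ge0 ?sqr_ge0// mulr_ge0 ?sqr_ge0// divr_ge0.
by field; rewrite gt_eqF.
Qed.

(** The three errors are the mismatch between the variance of [Y] and [s], the third-order remainder
    in [t], and the second-order remainder in [u]. The fixed amount of smoothing dl^2 <= u makes
    them uniform in [a] and [t]. *)
Lemma heat_step (dl th a u t s : R) (Y : T -> R) : 0 < dl -> dl ^+ 2 <= u ->
  0 <= s -> 0 < th -> measurable_fun setT Y -> itg (fun w => Y w ^+ 4) ->
  Ex Y = 0 ->
  `|Ex (fun w => heat a u (t + Y w)) - heat a (u + s) t| <=
  `|Ex (fun w => Y w ^+ 2) - s| / dl ^+ 2 +
   3 / dl ^+ 3 * (th * Ex (fun w => Y w ^+ 2) + Ex (fun w => Y w ^+ 4) / th) +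
   10 / dl ^+ 4 * s ^+ 2.
Proof.
move=> dl0 ud s0 th0 mY iY4 Y0; have [iY2 iY] := le_moment2 mY iY4.
have ih : itg (fun w => heat a u (t + Y w)).
  apply: (@bounded_itg _ _ _ _ _ 1) => [|w].
    apply: (measurableT_comp (measurable_heat a u)).
    by apply: measurable_funD => //; exact: measurable_cst.
  by rewrite ger0_norm ?heat_ge0 ?heat_le1.
set e2 := Ex (fun w => Y w ^+ 2); set e4 := Ex (fun w => Y w ^+ 4).
have c3 : 0 <= 3 / dl ^+ 3 by rewrite divr_ge0// exprn_ge0// ltW.
have iA : itg (fun w => heat a u (t + Y w) - heat a u t - Y w * heat1 a u t -
    Y w ^+ 2 * heat2 a u t).
  apply: itgB; last by apply: (eq_itg (fun w => mulrC (heat2 a u t) _)); exact: itgZ.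
  apply: itgB; last by apply: (eq_itg (fun w => mulrC (heat1 a u t) _)); exact: itgZ.
  by apply: itgB => //; exact: itg_cst.
have i3 : itg (fun w => 3 / dl ^+ 3 * (th * Y w ^+ 2 + th^-1 * Y w ^+ 4)).
  by apply: itgZ; apply: itgD; exact: itgZ.
have h1 : `|Ex (fun w => heat a u (t + Y w)) - heat a u t - e2 * heat2 a u t| <=
    3 / dl ^+ 3 * (th * e2 + e4 / th).
  have -> : Ex (fun w => heat a u (t + Y w)) - heat a u t - e2 * heat2 a u t =
      Ex (fun w => heat a u (t + Y w) - heat a u t - Y w * heat1 a u t -
    Y w ^+ 2 * heat2 a u t).
    rewrite ExB; last 2 first.
    - apply: itgB; last by apply: (eq_itg (fun w => mulrC (heat1 a u t) _)); exact: itgZ.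
      by apply: itgB => //; exact: itg_cst.
    - by apply: (eq_itg (fun w => mulrC (heat2 a u t) _)); exact: itgZ.
    rewrite ExB; last 2 first.
    - by apply: itgB => //; exact: itg_cst.
    - by apply: (eq_itg (fun w => mulrC (heat1 a u t) _)); exact: itgZ.
    rewrite ExB//; last exact: itg_cst.
    rewrite Ex_cst (eq_Ex _ (fun w => mulrC (Y w) _)) ExZ// Y0 mulr0 subr0.
    by rewrite (eq_Ex _ (fun w => mulrC (Y w ^+ 2) _)) ExZ// [_ * e2]mulrC.
  apply: (le_trans (normEx iA)).
  rewrite [e4 / th]mulrC -!ExZ// -ExD; [|exact: itgZ|exact: itgZ].
  rewrite -ExZ; last by apply: itgD; exact: itgZ.
  apply: le_Ex => //; first exact: itg_norm.
  move=> w; apply: (le_trans (heat_taylor _ _ _ dl0 ud)); rewrite ler_wpM2l//.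
  by rewrite [_^-1 * _]mulrC cube_le.
have h2 := heat_time a t dl0 ud s0.
have h3 : `|(e2 - s) * heat2 a u t| <= `|e2 - s| / dl ^+ 2.
  by rewrite normrM ler_wpM2l// -[leRHS]mul1r heat2_le.
have -> : Ex (fun w => heat a u (t + Y w)) - heat a (u + s) t =
  (e2 - s) * heat2 a u t + (Ex (fun w => heat a u (t + Y w)) - heat a u t - e2 * heat2 a u t)
   - (heat a (u + s) t - heat a u t - s * heat2 a u t) by ring.
by rewrite (le_trans (ler_normB _ _))// lerD// (le_trans (ler_normD _ _))// lerD.
Qed.

End heat_step.

(** * Replacement in sums, and small balls for linear forms *)

Section heat_decouple.
Context (d : measure_display) (T : measurableType d) (R : realType)
  (P : probability T R) (I : finType) (X : I -> {RV P >-> R}).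
Hypothesis X_indep : mutually_independent X.
Notation itg := (itg P).
Notation Ex := (Ex P).

(** The comparison is made with the past frozen and then averaged. [B] is a function of [w] because
    in the main application it contains W_k. *)
Lemma heat_decouple (J K : {set I}) (a u v : R) (S : T -> R) (Y : T -> T -> R)
    (B : T -> R) : {in J, forall i, i \notin K} ->
  measurable_fun setT (S : sigT X J -> R) ->
  measurable_fun setT ((fun z => Y z.1 z.2) : sigT X J * sigT X K -> R) ->
  (forall w, measurable_fun setT (Y w)) -> itg B ->
  (forall w, `|Ex (fun w' => heat a u (S w + Y w w')) - heat a v (S w)| <= B w) ->
  `|Ex (fun w => heat a u (S w + Y w w)) - Ex (fun w => heat a v (S w))| <= Ex B.
Proof.
move=> JK mS mY mYw iB hB.
have ib (f : T -> R) u' : measurable_fun setT f -> itg (fun w => heat a u' (f w)).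
  move=> mf; apply: (@bounded_itg _ _ _ _ _ 1) => [|w].
    exact: (measurableT_comp (measurable_heat a u') mf).
  by rewrite ger0_norm ?heat_ge0 ?heat_le1.
have [|||||_ iE _ ->] := @decoupling_Ex _ _ _ _ _ _ X_indep J K
  (fun w w' => heat a u (S w + Y w w')) (fun=> 1) JK.
- apply: (measurableT_comp (measurable_heat a u)).
  apply: measurable_funD => //; exact: (measurableT_comp mS).
- by move=> w w'; exact: heat_ge0.
- move=> w; apply: ib; apply: measurable_funD => //; exact: measurable_cst.
- move=> w; rewrite -[leRHS](Ex_cst P 1); apply: le_Ex; last by move=> w'; exact: heat_le1.
    by apply: ib; apply: measurable_funD => //; exact: measurable_cst.
  exact: itg_cst.
- exact: itg_cst.
have iS := ib _ v (measurable_fun_sigT mS).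
rewrite -ExB//; apply: (le_trans (normEx (itgB iE iS))); apply: le_Ex => //.
exact: itg_norm (itgB iE iS).
Qed.

Variable K0 : R.
Hypotheses (K01 : 1 <= K0) (X4i : forall i, itg (fun w => X i w ^+ 4))
  (X1 : forall i, Ex (X i) = 0) (X2 : forall i, Ex (fun w => X i w ^+ 2) = 1)
  (X4 : forall i, Ex (fun w => X i w ^+ 4) <= K0).

(** The variance removed from the sum is stored in [u], so the induction needs the statement for all
    [u] above dl^2. *)
Lemma linear_heat (dl th a : R) (c : I -> R) (s : seq I) : 0 < dl -> 0 < th -> uniq s ->
  forall u, dl ^+ 2 <= u ->
  `|Ex (fun w => heat a u (\sum_(i <- s) c i * X i w)) -
    heat a (u + \sum_(i <- s) c i ^+ 2) 0| <=
  \sum_(i <- s) (3 / dl ^+ 3 * (th * c i ^+ 2 + K0 * c i ^+ 4 / th) +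
    10 / dl ^+ 4 * c i ^+ 4).
Proof.
move=> dl0 th0; elim: s => [_ u _|i s ih /= /andP[si us] u ud].
  rewrite !big_nil (@eq_Ex _ _ _ _ _ (fun=> heat a u 0)) ?Ex_cst ?addr0 ?subrr ?normr0//.
  by move=> w; rewrite big_nil.
have dis : {in [set j in s]%SET, forall k, k \notin [set i]%SET}.
  by move=> k; rewrite !inE => ks; apply: contra si => /eqP <-.
have [LS _ _] := linear_form4 X_indep c K01 (L4_X X4i) X1 X4 us.
have ud' : dl ^+ 2 <= u + c i ^+ 2 by rewrite (le_trans ud)// lerDl sqr_ge0.
have h := ih us _ ud'.
rewrite !big_cons.
set err := (X in _ <= X + _).
have hd := @heat_decouple [set j in s]%SET [set i]%SET a u (u + c i ^+ 2)
  (fun w => \sum_(j <- s) c j * X j w) (fun _ w' => c i * X i w') (fun=> err) dis LS.1.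
rewrite Ex_cst in hd.
rewrite (@eq_Ex _ _ _ _ _ (fun w => heat a u (\sum_(j <- s) c j * X j w + c i * X i w))); last first.
  by move=> w; rewrite big_cons addrC.
apply: le_trans (ler_distD (Ex (fun w => heat a (u + c i ^+ 2) (\sum_(j <- s) c j * X j w))) _ _) _.
apply: lerD; last by rewrite addrA.
apply: hd.
- apply: measurable_funM; first exact: measurable_cst.
  have m1 : measurable_fun setT (X i : sigT X [set i]%SET -> R).
    exact: (L4_X X4i i).1.
  exact: (measurableT_comp m1).
- by move=> w; apply: measurable_funM => //; exact: measurable_cst.
- exact: itg_cst.
move=> w; have ic4 : itg (fun w => (c i * X i w) ^+ 4).
  apply: (eq_itg (fun w => esym (exprMn 4 (c i) (X i w)))); exact: itgZ.
have [i2 i1] := le_moment2 (L4_meas (L4_X X4i i)) (X4i i).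
have := @heat_step _ _ _ P dl th a u (\sum_(j <- s) c j * X j w) (c i ^+ 2)
  (fun w => c i * X i w) dl0 ud (sqr_ge0 _) th0 _ ic4.
move=> /(_ _ _) H; apply: (le_trans (H _ _)).
- by apply: measurable_funM => //; exact: measurable_cst.
- by rewrite ExZ ?X1 ?mulr0.
rewrite (eq_Ex _ (fun w => exprMn 2 (c i) (X i w))) ExZ// X2 mulr1 subrr normr0 mul0r add0r.
rewrite (eq_Ex _ (fun w => exprMn 4 (c i) (X i w))) ExZ// /err -exprM lerD2r.
rewrite ler_wpM2l ?divr_ge0 ?exprn_ge0 ?(ltW dl0)// lerD2l ler_wpM2r ?invr_ge0 ?(ltW th0)//.
rewrite mulrC ler_wpM2r ?X4//.
by rewrite exprn_even_ge0.
Qed.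

Definition cB : R := (Phi 1 - Phi (- 1))^-1.

Lemma cB_gt0 : 0 < cB.
Proof.
have [c [_ _ e]] := mvt_between (- 1) 1 (@is_derive_Phi R).
rewrite invr_gt0 e; apply: mulr_gt0; last by rewrite opprK addr_gt0.
rewrite phiE mulr_gt0 ?expR_gt0// normal_peak_gt0// oner_neq0.
Qed.

Lemma small_ball (eps th : R) (c : I -> R) : 0 < eps -> 0 < th ->
  \sum_i c i ^+ 2 = 1 ->
  Pr P [set w | `|\sum_i c i * X i w| <= eps] <=
  cB * (4 * eps + 2 * (3 / eps ^+ 3 * (th + K0 * (\sum_i c i ^+ 4) / th) +
    10 / eps ^+ 4 * \sum_i c i ^+ 4)).
Proof.
move=> e0 th0 c1.
have LS := linear_form4 X_indep c K01 (L4_X X4i) X1 X4 (index_enum_uniq I).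
case: LS => LS _ _; set S := fun w => \sum_i c i * X i w.
have mS : measurable_fun setT S by exact: L4_meas LS.
have H a := @linear_heat eps th a c _ e0 th0 (index_enum_uniq I) (eps ^+ 2) (lexx _).
set err := 3 / eps ^+ 3 * (th + K0 * (\sum_i c i ^+ 4) / th) +
    10 / eps ^+ 4 * \sum_i c i ^+ 4.
have errE : \sum_i (3 / eps ^+ 3 * (th * c i ^+ 2 + K0 * c i ^+ 4 / th) +
    10 / eps ^+ 4 * c i ^+ 4) = err.
  rewrite big_split/= -!mulr_sumr big_split/= -!mulr_sumr c1 mulr1.
  by rewrite /err -mulr_suml -mulr_sumr.
have ib a : itg (fun w => heat a (eps ^+ 2) (S w)).
  apply: (@bounded_itg _ _ _ _ _ 1) => [|w].
    exact: (measurableT_comp (measurable_heat a _) mS).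
  by rewrite ger0_norm ?heat_ge0 ?heat_le1.
have se : Num.sqrt (eps ^+ 2) = eps by rewrite sqrtr_sqr gtr0_norm.
(* When |S| <= eps this difference is at least Phi(1) - Phi(-1). After replacement its mean is close
   to the mass that a centred Gaussian of variance 1 + eps^2 gives to an interval of length 4 eps,
   which the Lipschitz bound on [Phi] controls. *)
pose f w := heat (2 * eps) (eps ^+ 2) (S w) - heat (- (2 * eps)) (eps ^+ 2) (S w).
have := @markov_Ex _ _ _ P f [set w | `|S w| <= eps] (Phi 1 - Phi (- 1)).
move=> /(_ _ _ _ _ _) M; apply: (le_trans (M _ _ _ _ _)).
- by rewrite -invr_gt0; exact: cB_gt0.
- rewrite -[X in measurable X]setTI; apply: measurable_fun_ler => //.
  exact: measurableT_comp.
- exact: itgB.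
- move=> w; rewrite subr_ge0 /heat le_Phi// ler_wpM2r ?invr_ge0 ?sqrtr_ge0//.
  by move: e0; lra.
- move=> w /=; rewrite ler_norml => /andP[h1 h2]; rewrite /f /heat se.
  apply: lerB; apply: le_Phi.
    by rewrite ler_pdivlMr//; move: h1 h2; lra.
  by rewrite ler_pdivrMr//; move: h1 h2; lra.
rewrite mulrC -/cB ler_wpM2l//; first exact/ltW/cB_gt0.
rewrite ExB//.
have := H (2 * eps); have := H (- (2 * eps)); rewrite errE c1.
set E1 := Ex _; set E2 := Ex _; rewrite !ler_norml => /andP[h1 h2] /andP[h3 h4].
have : heat (2 * eps) (eps ^+ 2 + 1) 0 - heat (- (2 * eps)) (eps ^+ 2 + 1) 0 <= 4 * eps.
  apply: (le_trans (ler_norm _)); rewrite /heat; apply: (le_trans (Phi_lip _ _)).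
  rewrite !subr0 -mulrBl normrM ger0_norm; last by move: e0; lra.
  have sq : 1 <= Num.sqrt (eps ^+ 2 + 1).
    by rewrite -[leLHS]sqrtr1; apply: ler_wsqrtr; rewrite lerDr sqr_ge0.
  rewrite (_ : 2 * eps - - (2 * eps) = 4 * eps); last by ring.
  rewrite ler_piMr//; first by move: e0; lra.
  by rewrite ger0_norm ?invr_ge0// invf_le1// (lt_le_trans ltr01).
by move: h1 h2 h3 h4; rewrite mulr2n; lra.
Qed.

End heat_decouple.

(** * The squared determinant as a product of squared distances *)

Section deflation.
Context (R : realType) (n : nat).
Implicit Types (Q A : 'M[R]_n) (r w : 'rV[R]_n).

Definition sprod r w : R := (r *m w^T) 0 0.

Definition orthoproj Q := Q^T = Q /\ Q *m Q = Q.

(* When [r] lies in the kernel of [Q], any nonzero vector in the range of [Q]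
   serves, so that the rank drops by exactly one in all cases. *)
Definition pivot Q r : 'rV[R]_n :=
  if r *m Q != 0 then r *m Q
  else foldr (fun i w => if Q i i != 0 then row i Q else w) 0 (enum 'I_n).

Definition deflate Q r : 'M[R]_n :=
  Q - (sprod (pivot Q r) (pivot Q r))^-1 *: ((pivot Q r)^T *m pivot Q r).

Lemma sprodE r w : sprod r w = \sum_j r 0 j * w 0 j.
Proof. by rewrite /sprod mxE; apply: eq_bigr => j _; rewrite mxE. Qed.

Lemma sprodC r w : sprod r w = sprod w r.
Proof. by rewrite !sprodE; apply: eq_bigr => j _; rewrite mulrC. Qed.

Lemma sprod_ge0 w : 0 <= sprod w w.
Proof. by rewrite sprodE; apply: sumr_ge0 => j _; rewrite -expr2 sqr_ge0. Qed.

Lemma sprod_eq0 w : (sprod w w == 0) = (w == 0).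
Proof.
apply/idP/idP => [|/eqP ->]; last by rewrite /sprod mul0mx mxE.
rewrite sprodE psumr_eq0; last by move=> j _; rewrite -expr2 sqr_ge0.
move=> /allP h; apply/eqP/rowP => j; rewrite mxE.
by have := h j (mem_index_enum j); rewrite mulf_eq0 orbb => /eqP.
Qed.

Lemma sprod_mx r w : r *m w^T = (sprod r w)%:M.
Proof. by rewrite [LHS]mx11_scalar. Qed.

Lemma orthoproj_diag Q i : orthoproj Q -> \sum_j Q i j ^+ 2 = Q i i.
Proof.
move=> [Qt QQ]; rewrite -[in RHS]QQ mxE; apply: eq_bigr => j _.
by rewrite expr2 -[in X in _ = _ * X]Qt mxE.
Qed.

Lemma orthoproj_diag_ge0 Q i : orthoproj Q -> 0 <= Q i i.
Proof. by move=> /orthoproj_diag <-; apply: sumr_ge0 => j _; exact: sqr_ge0. Qed.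

Lemma orthoproj_is_proj Q : orthoproj Q -> is_proj (fun i j => Q i j) (\tr Q).
Proof.
move=> QP; have [Qt _] := QP; split => // [i j|i].
  by rewrite -[in LHS]Qt mxE.
exact: orthoproj_diag.
Qed.

Lemma orthoproj1 : orthoproj 1%:M.
Proof. by split; rewrite ?trmx1 ?mulmx1. Qed.

Lemma pivotP Q r : orthoproj Q -> \tr Q != 0 ->
  pivot Q r *m Q = pivot Q r /\ pivot Q r != 0.
Proof.
move=> [Qt QQ] trQ; rewrite /pivot; case: ifPn => [u0|_].
  by rewrite -mulmxA QQ.
have [i Qi] : exists i, Q i i != 0.
  apply/existsP; apply: contraNT trQ => /existsPn h.
  by rewrite /mxtrace big1// => i _; apply/eqP; have := h i; rewrite negbK.
have : has (fun i => Q i i != 0) (enum 'I_n).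
  by apply/hasP; exists i => //; rewrite mem_enum.
elim: (enum 'I_n) => //= j s ih; case: (boolP (Q j j != 0)) => [Qj _|_ /= /ih//].
split; first by rewrite -row_mul QQ.
by apply: contraNneq Qj => /rowP/(_ j); rewrite !mxE => ->.
Qed.

Section deflate_spec.
Variables (Q : 'M[R]_n) (r : 'rV[R]_n).
Hypotheses (QP : orthoproj Q) (trQ : \tr Q != 0).
Let w := pivot Q r.
Let N := sprod w w.

Let N0 : N != 0. Proof. by rewrite sprod_eq0 (pivotP r QP trQ).2. Qed.
Let wQ : w *m Q = w. Proof. exact: (pivotP r QP trQ).1. Qed.
Let Qw : Q *m w^T = w^T. Proof. by rewrite -{1}QP.1 -trmx_mul wQ. Qed.

Lemma deflate_orthoproj : orthoproj (deflate Q r).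
Proof.
have [Qt QQ] := QP; split.
  by rewrite /deflate linearB/= linearZ/= trmx_mul trmxK Qt.
have QM : Q *m (w^T *m w) = w^T *m w by rewrite mulmxA Qw.
have MQ : w^T *m w *m Q = w^T *m w by rewrite -mulmxA wQ.
have MM : w^T *m w *m (w^T *m w) = N *: (w^T *m w).
  by rewrite -mulmxA [w *m (w^T *m w)]mulmxA sprod_mx -/N mul_scalar_mx -scalemxAr.
rewrite /deflate -/w -/N mulmxBl !mulmxBr QQ -!scalemxAl -!scalemxAr QM MQ MM.
by rewrite [N^-1 *: (N *: _)]scalerA mulVf// scale1r subrr subr0.
Qed.

Lemma deflate_trace : \tr (deflate Q r) = \tr Q - 1.
Proof.
rewrite /deflate -/w -/N linearB/= linearZ/= mxtrace_mulC sprod_mx -/N.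
by rewrite mxtrace_scalar mulr1n mulVf.
Qed.

Lemma deflate_diag i : deflate Q r i i = Q i i - w 0 i ^+ 2 / N.
Proof.
by rewrite /deflate -/w -/N !mxE big_ord1 !mxE -expr2 mulrC.
Qed.

Lemma deflate_kernel : deflate Q r *m w^T = 0.
Proof.
rewrite /deflate -/w -/N mulmxBl Qw -scalemxAl -mulmxA sprod_mx -/N.
by rewrite mul_mx_scalar scalerA mulVf// scale1r subrr.
Qed.

Lemma pivot_sqr_le i : 0 <= w 0 i ^+ 2 / N <= Q i i.
Proof.
rewrite mulr_ge0 ?sqr_ge0 ?invr_ge0 ?sprod_ge0//=.
by rewrite -subr_ge0 -deflate_diag orthoproj_diag_ge0//; exact: deflate_orthoproj.
Qed.

End deflate_spec.

Lemma xf_sprod Q r m : xf (fun i j => Q i j) m (fun i => r 0 i) = sprod (r *m Q) r / m.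
Proof.
rewrite /xf; congr (_ / _); rewrite sprodE exchange_big/=; apply: eq_bigr => j _.
by rewrite mxE mulr_suml; apply: eq_bigr => i _; rewrite [r 0 i * _]mulrC.
Qed.

Lemma sprod_proj Q r : orthoproj Q -> sprod (r *m Q) (r *m Q) = sprod (r *m Q) r.
Proof.
by move=> [Qt QQ]; rewrite /sprod trmx_mul Qt mulmxA -[r *m Q *m Q]mulmxA QQ.
Qed.

Lemma mulmx_proj_sum Q r i : orthoproj Q -> (r *m Q) 0 i = \sum_j Q i j * r 0 j.
Proof.
move=> [Qt _]; rewrite mxE; apply: eq_bigr => j _.
by rewrite mulrC -[in LHS]Qt mxE.
Qed.

(** Cauchy-Schwarz for [r *m Q] and the [i]-th row of [Q], read off here from the nonnegative
    diagonal of the deflated projector. *)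
Lemma proj_coord_le Q r i : orthoproj Q -> \tr Q != 0 ->
  (r *m Q) 0 i ^+ 2 <= Q i i * sprod (r *m Q) r.
Proof.
move=> QP trQ; rewrite -sprod_proj//; have [u0|u0] := eqVneq (r *m Q) 0.
  by rewrite u0 mxE expr0n mulr_ge0 ?orthoproj_diag_ge0 ?sprod_ge0.
have := pivot_sqr_le r QP trQ i; rewrite /pivot u0 => /andP[_].
by rewrite ler_pdivrMr// lt_def sprod_eq0 u0 sprod_ge0.
Qed.

(** Let p be the loss in the diagonal entry q = Q_ii. If the projected row is nonzero, p = y/x >= t
    = y (2 - x); otherwise y = 0. The decrease 2 q p - p^2 grows with p up to q, so for t > 0 it is
    at least 2 q t - t^2, and t <= 2 y. For t <= 0 the decrease is nonnegative and the claimed gain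
    is not positive. *)
Lemma deflate_Wf Q r m : orthoproj Q -> \tr Q = m -> 0 < m ->
  Wf (fun i j => deflate Q r i j) <=
  Wf (fun i j => Q i j) -
  \sum_i (2 * Q i i * (yf (fun i j => Q i j) m i (fun i => r 0 i) *
    (2 - xf (fun i j => Q i j) m (fun i => r 0 i))) -
    4 * yf (fun i j => Q i j) m i (fun i => r 0 i) ^+ 2).
Proof.
move=> QP tQ m0; have trQ : \tr Q != 0 by rewrite tQ gt_eqF.
rewrite /Wf -sumrB; apply: ler_sum => i _.
rewrite deflate_diag//; have /andP[] := pivot_sqr_le r QP trQ i.
set p := _ / _ => p0 pQ.
rewrite xf_sprod /yf -mulmx_proj_sum// -sprod_proj//.
set y := _ / m; set x := _ / m.
have y0 : 0 <= y by rewrite divr_ge0 ?sqr_ge0 ?ltW.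
have x0 : 0 <= x by rewrite divr_ge0 ?sprod_ge0 ?ltW.
have yp : y * (2 - x) <= p.
  have [u0|u0] := eqVneq (r *m Q) 0.
    by rewrite /y u0 mxE expr0n mul0r mul0r.
  have N0 : 0 < sprod (r *m Q) (r *m Q) by rewrite lt_def sprod_eq0 u0 sprod_ge0.
  have -> : p = y / x.
    rewrite /p /y /x /pivot u0; field; rewrite !gt_eqF//.
  have xp : 0 < x by rewrite divr_gt0.
  rewrite ler_pdivlMr// -mulrA ler_piMr//.
  have := sqr_ge0 (x - 1); rewrite sqrrB1; lra.
have : y * (2 - x) <= 2 * y by rewrite mulrC ler_wpM2r// gerBl.
move: yp; set t := y * (2 - x) => tp ty.
have [t0|t0] := leP t 0.
  have h1 : Q i i * t <= 0 by rewrite mulr_ge0_le0// (le_trans p0).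
  have h2 : 0 <= p * (Q i i - p) by rewrite mulr_ge0// subr_ge0.
  have h3 : 0 <= y ^+ 2 by exact: sqr_ge0.
  have h4 : 0 <= Q i i * p by rewrite mulr_ge0// (le_trans p0).
  rewrite -subr_ge0 (_ : _ - _ = p * (Q i i - p) + Q i i * p - 2 * (Q i i * t) + 4 * y ^+ 2).
    by move: h1 h2 h3 h4; lra.
  by ring.
have h1 : 0 <= (p - t) * (Q i i - p) by rewrite mulr_ge0// subr_ge0.
have h2 : 0 <= (p - t) * (Q i i - t).
  by rewrite mulr_ge0// subr_ge0// (le_trans tp).
have h3 : 0 <= (2 * y - t) * (2 * y + t).
  have ty2 : 0 <= 2 * y by rewrite mulr_ge0.
  apply: mulr_ge0; first by rewrite subr_ge0.
  by apply: addr_ge0 => //; exact: ltW.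
rewrite -subr_ge0 (_ : _ - _ = (p - t) * (Q i i - p) + (p - t) * (Q i i - t)
  + (2 * y - t) * (2 * y + t)); last by ring.
by rewrite !addr_ge0.
Qed.

(** The vector is a normalised row of [Q]. Its squared coordinates are bounded by the diagonal
    entries of [Q], so a small W_k means that the distance dominates a linear form with spread out
    coefficients. *)
Lemma unit_in_range Q : orthoproj Q -> \tr Q != 0 ->
  exists v : 'I_n -> R, [/\ \sum_j v j ^+ 2 = 1,
    \sum_j v j ^+ 4 <= Wf (fun i j => Q i j) &
    forall r, (\sum_j v j * r 0 j) ^+ 2 <= sprod (r *m Q) r].
Proof.
move=> QP trQ.
have [i Qi] : exists i, Q i i != 0.
  apply/existsP; apply: contraNT trQ => /existsPn h.
  by rewrite /mxtrace big1// => i _; apply/eqP; have := h i; rewrite negbK.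
have Qi0 : 0 < Q i i by rewrite lt_def Qi orthoproj_diag_ge0.
exists (fun j => Q i j / Num.sqrt (Q i i)); split.
- under eq_bigr do rewrite exprMn exprVn sqr_sqrtr ?(ltW Qi0)//.
  by rewrite -mulr_suml orthoproj_diag// divff.
- apply: ler_sum => j _.
  rewrite (_ : 4%N = (2 * 2)%N)// exprM lerXn2r ?nnegrE ?sqr_ge0//.
    exact: orthoproj_diag_ge0.
  rewrite exprMn exprVn sqr_sqrtr ?(ltW Qi0)// ler_pdivrMr//.
  have := proj_coord_le (delta_mx 0 i) j QP trQ.
  by rewrite -rowE mxE sprodE (bigD1 i)//= big1 ?addr0 ?mxE ?eqxx ?mulr1// => k ki;
    rewrite !mxE (negbTE ki) andbF mulr0.
- move=> r.
  have -> : \sum_j Q i j / Num.sqrt (Q i i) * r 0 j = (r *m Q) 0 i / Num.sqrt (Q i i).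
    by rewrite mulmx_proj_sum// mulr_suml; apply: eq_bigr => j _; rewrite mulrAC.
  rewrite exprMn exprVn sqr_sqrtr ?(ltW Qi0)// ler_pdivrMr// mulrC.
  exact: proj_coord_le.
Qed.

(** Rows indexed by natural numbers, with the zero row beyond the last, so that the projectors can
    be defined by recursion on [nat]. *)
Definition nrow A (k : nat) : 'rV[R]_n := if insub k is Some i then row i A else 0.

Fixpoint rproj A (k : nat) : 'M[R]_n :=
  if k is k'.+1 then deflate (rproj A k') (nrow A k') else 1%:M.

Lemma rprojP A k : (k <= n)%N ->
  orthoproj (rproj A k) /\ \tr (rproj A k) = (n - k)%:R.
Proof.
elim: k => [_|k ih kn] /=.
  by split; [exact: orthoproj1|rewrite mxtrace1 subn0].
have [Qk tk] := ih (ltnW kn).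
have t0 : \tr (rproj A k) != 0 by rewrite tk pnatr_eq0 subn_eq0 -ltnNge.
split; first exact: deflate_orthoproj.
by rewrite deflate_trace// tk subnS -subn1 [in RHS]natrB ?subn_gt0.
Qed.

Lemma nrow_ord A (i : 'I_n) : nrow A i = row i A.
Proof. by rewrite /nrow valK. Qed.

Definition rpivot A k := pivot (rproj A k) (nrow A k).

Section det.
Variable A : 'M[R]_n.
Let Q k := rproj A k.
Let w k := rpivot A k.

Let trQ0 k : (k < n)%N -> \tr (Q k) != 0.
Proof. by move=> kn; rewrite (rprojP A (ltnW kn)).2 pnatr_eq0 subn_eq0 -ltnNge. Qed.

Let QP k : (k <= n)%N -> orthoproj (Q k).
Proof. by move=> kn; exact: (rprojP A kn).1. Qed.

Lemma rproj_kernel j k : (j < k)%N -> (k <= n)%N -> Q k *m (w j)^T = 0.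
Proof.
move=> jk kn; elim: k jk kn => // k ih; rewrite ltnS leq_eqVlt => /predU1P[->|jk] kn.
  exact: (deflate_kernel _ (QP (ltnW kn)) (trQ0 kn)).
have h := ih jk (ltnW kn).
rewrite /Q /= /deflate mulmxBl -/(Q k) h sub0r -scalemxAl -mulmxA.
have [wQ _] := pivotP (nrow A k) (QP (ltnW kn)) (trQ0 kn).
have wj : pivot (rproj A k) (nrow A k) *m (w j)^T = 0.
  by rewrite -wQ -mulmxA h mulmx0.
by rewrite wj mulmx0 scaler0 oppr0.
Qed.

Lemma rpivot_ortho (j k : 'I_n) : j != k -> sprod (w j) (w k) = 0.
Proof.
wlog jk : j k / (j < k)%N.
  move=> H jk; have := jk; rewrite neq_ltn => /orP[h|h]; first exact: H.
  by rewrite sprodC; apply: H => //; rewrite eq_sym.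
move=> _; rewrite sprodC /sprod.
have [wQ _] := pivotP (nrow A k) (QP (ltnW (ltn_ord k))) (trQ0 (ltn_ord k)).
rewrite /w /rpivot -{1}wQ -mulmxA (rproj_kernel jk) ?(ltnW (ltn_ord k))//.
by rewrite mulmx0 mxE.
Qed.

Lemma rproj_compl k : (k <= n)%N ->
  1%:M - Q k = \sum_(j < n | (j < k)%N) (sprod (w j) (w j))^-1 *: ((w j)^T *m w j).
Proof.
elim: k => [_|k ih kn]; first by rewrite subrr big_pred0.
rewrite /Q/= /deflate opprB addrCA -/(Q k) ih 1?ltnW// [RHS](bigD1 (Ordinal kn))//=.
congr (_ + _); apply: eq_bigl => j; rewrite -val_eqE/= ltnS.
by rewrite ltn_neqAle andbC.
Qed.

(** Gram-Schmidt: [A] is a lower triangular [L] times [V], whose rows are the pivots. A row in the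
    span of the earlier ones gets a diagonal entry 0 in [L], while its substitute pivot keeps the
    rows of [V] orthogonal, so the degenerate case needs no separate treatment. *)
Lemma det_sqr : \det A ^+ 2 = \prod_(k < n) sprod (nrow A k *m Q k) (nrow A k).
Proof.
pose V : 'M[R]_n := \matrix_k w k.
pose e (k : 'I_n) : R := (nrow A k *m Q k != 0)%:R.
pose L : 'M[R]_n := \matrix_(k, j)
  (if (j < k)%N then sprod (nrow A k) (w j) / sprod (w j) (w j)
   else if j == k then e k else 0).
have eu k : nrow A (nat_of_ord k) *m Q k = e k *: w k.
  rewrite /e /w /rpivot /pivot; case: ifPn => [_|/negPn/eqP h].
    by rewrite scale1r.
  by rewrite scale0r.
have AE : A = L *m V.
  apply/row_matrixP => k; rewrite -nrow_ord row_mul -[nrow A k]mulmx1.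
  rewrite -[in LHS](subrK (Q k) 1%:M) mulmxDr eu rproj_compl; last exact/ltnW.
  rewrite mulmx_sumr mulmx_sum_row [RHS](bigID (fun j : 'I_n => (j < k)%N))/=.
  congr (_ + _).
    apply: eq_bigr => j jk; rewrite -scalemxAr mulmxA sprod_mx mul_scalar_mx scalerA.
    by rewrite !mxE jk rowK mulrC.
  rewrite (bigD1 k) ?ltnn//= big1 ?addr0 => [|j /andP[jk njk]].
    by rewrite !mxE ltnn eqxx rowK.
  by rewrite !mxE (negbTE jk) (negbTE njk) scale0r.
have VV : V *m V^T = diag_mx (\row_k sprod (w k) (w k)).
  apply/matrixP => j k; rewrite !mxE.
  have -> : \sum_i V j i * V^T i k = sprod (w j) (w k).
    by rewrite sprodE; apply: eq_bigr => i _; rewrite !mxE.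
  by have [->|/rpivot_ortho ->] := eqVneq j k; rewrite ?mulr1n.
have Lt : is_trig_mx L.
  apply/is_trig_mxP => k j kj; rewrite mxE ltnNge (ltnW kj)/=.
  by rewrite -val_eqE/= gtn_eqF.
have -> : \det A ^+ 2 = \det L ^+ 2 * \det V ^+ 2 by rewrite {1}AE det_mulmx exprMn.
rewrite det_trig// (_ : \det V ^+ 2 = \prod_(k < n) sprod (w k) (w k)).
  rewrite -prodrXl -big_split/=; apply: eq_bigr => k _.
  rewrite !mxE ltnn eqxx -sprod_proj; last exact/QP/ltnW.
  by rewrite eu /sprod linearZ/= -scalemxAl -scalemxAr !mxE expr2 mulrA.
rewrite expr2 -{2}det_tr -det_mulmx VV det_diag.
by apply: eq_bigr => k _; rewrite mxE.
Qed.

End det.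

End deflation.

(** * Measurability of the matrix operations *)

Section borel.
Context (d : measure_display) (S : measurableType d) (R : realType) (n : nat).
Implicit Types (Q : S -> 'M[R]_n) (r w : S -> 'rV[R]_n).

Definition mxmeas p q (Q : S -> 'M[R]_(p, q)) :=
  forall i j, measurable_fun setT (fun s => Q s i j).

(** Inversion is written through [expR] and [ln], with the default value 0 for the inverse of 0 as a
    separate case. *)
Lemma measurable_nneg_inv (f : S -> R) : (forall s, 0 <= f s) ->
  measurable_fun setT f -> measurable_fun setT (fun s => (f s)^-1).
Proof.
move=> f0 mf.
have -> : (fun s => (f s)^-1) = fun s => if 0 < f s then expR (- ln (f s)) else 0.
  apply/funext => s; have [fs|fs] := ltP 0 (f s); first by rewrite expRN lnK.
  by have /eqP -> : f s == 0 by [rewrite eq_le fs f0]; rewrite invr0.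
apply: measurable_fun_ifT => //.
- exact: measurable_fun_ltr.
- apply: measurableT_comp => //; apply: measurable_funN.
  by apply: measurableT_comp => //; exact: measurable_ln.
Qed.

Lemma measurable_mulmx p q l (Q : S -> 'M[R]_(p, q)) (Q' : S -> 'M[R]_(q, l)) :
  mxmeas Q -> mxmeas Q' -> mxmeas (fun s => Q s *m Q' s).
Proof.
move=> mQ mQ' i j.
rewrite (_ : (fun s => _) = fun s => \sum_k Q s i k * Q' s k j); last first.
  by apply/funext => s; rewrite mxE.
by apply: measurable_sum => k; exact: measurable_funM.
Qed.

Lemma measurable_sprod r w : mxmeas r -> mxmeas w ->
  measurable_fun setT (fun s => sprod (r s) (w s)).
Proof.
move=> mr mw.
rewrite (_ : (fun s => _) = fun s => \sum_j r s 0 j * w s 0 j); last first.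
  by apply/funext => s; rewrite sprodE.
by apply: measurable_sum => k; exact: measurable_funM.
Qed.

Lemma measurable_neq0 (f : S -> R) : measurable_fun setT f ->
  measurable_fun setT (fun s => f s != 0).
Proof.
move=> mf; apply: measurableT_comp => //.
by apply: measurable_fun_eqr => //; exact: measurable_cst.
Qed.

Lemma mxmeas_if p q (b : S -> bool) (Q Q' : S -> 'M[R]_(p, q)) :
  measurable_fun setT b -> mxmeas Q -> mxmeas Q' ->
  mxmeas (fun s => if b s then Q s else Q' s).
Proof.
move=> mb mQ mQ' i j.
rewrite (_ : (fun s => _) = fun s => if b s then Q s i j else Q' s i j).
  exact: measurable_fun_ifT.
by apply/funext => s; case: ifP.
Qed.

Lemma measurable_pivot Q r : mxmeas Q -> mxmeas r ->
  mxmeas (fun s => pivot (Q s) (r s)).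
Proof.
move=> mQ mr; rewrite /pivot; apply: mxmeas_if.
(* Nonvanishing of a vector is tested on one real function, its squared norm. *)
- rewrite (_ : (fun s => _) = fun s => sprod (r s *m Q s) (r s *m Q s) != 0).
    by apply: measurable_neq0; apply: measurable_sprod; exact: measurable_mulmx.
  by apply/funext => s; rewrite sprod_eq0.
- exact: measurable_mulmx.
- elim: (enum 'I_n) => [|i l ih] /=.
    by move=> i j; under eq_fun do rewrite mxE; exact: measurable_cst.
  apply: mxmeas_if => //; first exact: measurable_neq0.
  by move=> j k; under eq_fun do rewrite mxE; exact: mQ.
Qed.

Lemma measurable_deflate Q r : mxmeas Q -> mxmeas r ->
  mxmeas (fun s => deflate (Q s) (r s)).
Proof.
move=> mQ mr i j; have mp := measurable_pivot mQ mr.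
rewrite (_ : (fun s => _) = fun s => Q s i j -
  (sprod (pivot (Q s) (r s)) (pivot (Q s) (r s)))^-1 *
  (pivot (Q s) (r s) 0 i * pivot (Q s) (r s) 0 j)); last first.
  by apply/funext => s; rewrite /deflate !mxE big_ord1 !mxE.
apply: measurable_funB => //; apply: measurable_funM; last exact: measurable_funM.
apply: measurable_nneg_inv; last exact: measurable_sprod.
by move=> s; exact: sprod_ge0.
Qed.

Lemma measurable_det Q : mxmeas Q -> measurable_fun setT (fun s => \det (Q s)).
Proof.
move=> mQ; rewrite /determinant; apply: measurable_sum => p.
apply: measurable_funM; first exact: measurable_cst.
exact: measurable_prod.
Qed.

End borel.

Section borel_forms.
Context (d : measure_display) (S : measurableType d) (R : realType) (I : finType).
Variables (q : S -> I -> I -> R) (m : R) (x : S -> I -> R).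
Hypotheses (mq : forall i j, measurable_fun setT (fun s => q s i j))
  (mx : forall i, measurable_fun setT (fun s => x s i)).

Lemma measurable_sum_cond (J : Type) (s : seq J) (p : pred J) (h : J -> S -> R) :
  (forall j, measurable_fun setT (h j)) ->
  measurable_fun setT (fun t => \sum_(j <- s | p j) h j t).
Proof.
move=> mh; under eq_fun do rewrite big_mkcond.
by apply: measurable_sum => j; case: (p j).
Qed.

Let mterm i j : measurable_fun setT (fun s => q s i j * x s i * x s j).
Proof. by apply: measurable_funM => //; exact: measurable_funM. Qed.

Lemma measurable_Yf : measurable_fun setT (fun s => Yf (q s) m (x s)).
Proof.
apply: measurable_funM; last exact: measurable_cst.
by apply: measurable_sum => i; apply: measurable_sum_cond => j.
Qed.

Lemma measurable_Zf : measurable_fun setT (fun s => Zf (q s) m (x s)).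
Proof.
apply: measurable_funM; last exact: measurable_cst.
apply: measurable_sum => i; apply: measurable_funM => //.
by apply: measurable_funB; [exact: measurable_funX|exact: measurable_cst].
Qed.

Lemma measurable_Wf : measurable_fun setT (fun s => Wf (q s)).
Proof. by apply: measurable_sum => i; exact: measurable_funX. Qed.

End borel_forms.

(** * Rows of the matrix as independent blocks *)

Section rows.
Context (d : measure_display) (T : measurableType d) (R : realType)
  (P : probability T R) (n : nat) (a : 'I_n -> 'I_n -> {RV P >-> R}).
Hypothesis a_indep : mutually_independent (fun ij : 'I_n * 'I_n => a ij.1 ij.2).
Notation itg := (itg P).
Notation Ex := (Ex P).
Notation X := (fun ij : 'I_n * 'I_n => a ij.1 ij.2).
Notation Am := (random_matrix a).

Lemma row_indep (i : 'I_n) : mutually_independent (a i).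
Proof.
move=> J B mB.
have := @a_indep [set (i, j) | j in J]%SET (fun ij => B ij.2) (fun ij => mB ij.2).
rewrite big_imset/=; last by move=> j k _ _ [].
move=> <-; congr (P _); apply/seteqP; split => [w h ij /=|w h j /= jJ].
  by move=> /imsetP[j jJ ->]; exact: h.
by apply: (h (i, j)); rewrite /=; apply: imset_f.
Qed.

Definition past (k : nat) : {set 'I_n * 'I_n} := [set ij : 'I_n * 'I_n | (ij.1 < k)%N]%SET.
Definition present (k : nat) : {set 'I_n * 'I_n} := [set ij : 'I_n * 'I_n | ij.1 == k :> nat]%SET.

Lemma past_present k : {in past k, forall ij, ij \notin present k}.
Proof. by move=> ij; rewrite !inE neq_ltn => ->. Qed.

Lemma pastS k : past k \subset past k.+1.
Proof. by apply/fintype.subsetP => ij; rewrite !inE => /ltnW. Qed.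

Lemma presentS k : present k \subset past k.+1.
Proof. by apply/fintype.subsetP => ij; rewrite !inE => /eqP ->. Qed.

Lemma nrow_Am k (kn : (k < n)%N) w j : nrow (Am w) k 0 j = a (Ordinal kn) j w.
Proof.
rewrite (_ : nrow (Am w) k = row (Ordinal kn) (Am w)) ?mxE//.
exact: (nrow_ord (Am w) (Ordinal kn)).
Qed.

Lemma nrow_meas k : mxmeas ((fun w => nrow (Am w) k) : sigT X (present k) -> _).
Proof.
move=> i j; rewrite (ord1 i); case: (ltnP k n) => [kn|nk].
  rewrite (_ : (fun w => _) = a (Ordinal kn) j); last first.
    by apply/funext => w; rewrite nrow_Am.
  apply: (@measurable_sigT_RV _ _ _ _ _ X (present k) (Ordinal kn, j)).
  by rewrite inE.
rewrite (_ : (fun w => _) = fun=> 0); first exact: measurable_cst.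
by apply/funext => w; rewrite /nrow insubF ?mxE// ltnNge nk.
Qed.

Lemma rproj_meas k : mxmeas ((fun w => rproj (Am w) k) : sigT X (past k) -> _).
Proof.
elim: k => [|k ih] /=; first by move=> i j; exact: measurable_cst.
apply: measurable_deflate => i j.
  exact: (@measurable_sigT_sub _ _ _ _ _ X _ _ _ _ _ (pastS k) (ih i j)).
exact: (@measurable_sigT_sub _ _ _ _ _ X _ _ _ _ _ (presentS k) (@nrow_meas k i j)).
Qed.

Lemma rprojT_meas k : mxmeas (fun w => rproj (Am w) k).
Proof. by move=> i j; exact: measurable_fun_sigT (@rproj_meas k i j). Qed.

Lemma nrowT_meas k : mxmeas (fun w => nrow (Am w) k).
Proof. by move=> i j; exact: measurable_fun_sigT (@nrow_meas k i j). Qed.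

Lemma rproj_pair_meas k :
  mxmeas ((fun z => rproj (Am z.1) k) : sigT X (past k) * sigT X (present k) -> _).
Proof.
move=> i j; exact: (measurableT_comp (@rproj_meas k i j) (@measurable_fst _ _ _ _)).
Qed.

Lemma nrow_pair_meas k :
  mxmeas ((fun z => nrow (Am z.2) k) : sigT X (past k) * sigT X (present k) -> _).
Proof.
move=> i j; exact: (measurableT_comp (@nrow_meas k i j) (@measurable_snd _ _ _ _)).
Qed.

End rows.

(** * Elementary estimates *)

Section numeric.
Variable R : realType.

Lemma mvt0_on (f df : R -> R) (h B : R) :
  (forall x, Num.min 0 h <= x -> x <= Num.max 0 h -> is_derive x 1 f (df x)) ->
  f 0 = 0 ->
  (forall x, Num.min 0 h <= x -> x <= Num.max 0 h -> `|df x| <= B) ->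
  `|f h| <= B * `|h|.
Proof.
move=> fd f0 dfB; have /orP[h0|h0] := le_total 0 h.
  rewrite (min_idPl h0) (max_idPr h0) in fd dfB.
  have [||c] := @MVT_segment R f df 0 h h0.
  - by move=> x; rewrite in_itv/= => /andP[x0 xh]; apply: fd; exact: ltW.
  - apply: derivable_within_continuous => x; rewrite in_itv/= => /andP[x0 xh].
    by have [] := fd x x0 xh.
  rewrite in_itv/= => /andP[c0 ch]; rewrite f0 !subr0 => ->.
  by rewrite normrM ler_wpM2r// dfB.
rewrite (min_idPr h0) (max_idPl h0) in fd dfB.
have [||c] := @MVT_segment R f df h 0 h0.
- by move=> x; rewrite in_itv/= => /andP[x0 xh]; apply: fd; exact: ltW.
- apply: derivable_within_continuous => x; rewrite in_itv/= => /andP[x0 xh].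
  by have [] := fd x x0 xh.
rewrite in_itv/= => /andP[c0 ch]; rewrite f0 !sub0r => /eqP; rewrite eqr_oppLR => /eqP ->.
by rewrite normrN normrM normrN ler_wpM2r// dfB.
Qed.

(** The left-hand remainder has derivative t^2/(1 + t), and 1 + t >= 1/4 between 0 and [x]. *)
Lemma ln_taylor (x : R) : - (3 / 4) <= x ->
  `|ln (1 + x) - x + x ^+ 2 / 2| <= 4 * `|x| ^+ 3.
Proof.
move=> x34; rewrite [`|x| ^+ 3]exprSr mulrA.
have lo t : Num.min 0 x <= t -> 4^-1 <= 1 + t.
  move=> h; have : - (3 / 4) <= t.
    by rewrite (le_trans _ h)// le_min x34 andbT; lra.
  lra.
have := @mvt0_on (fun t => ln (1 + t) - t + t ^+ 2 / 2) (fun t => t ^+ 2 / (1 + t)) x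
  (4 * `|x| ^+ 2); apply.
- move=> t h1 _; have t1 : 0 < 1 + t by rewrite (lt_le_trans _ (lo _ h1)).
  rewrite (_ : (fun t => _) = (@ln R \o (cst 1 + id)) - id + (2^-1 \*: (id ^+ 2))); last first.
    by apply/funext => u; rewrite !fctE/= [_ *: _]mulrC.
  have := is_derive1_ln t1 => ?; apply: is_derive_eq.
  by rewrite /GRing.scale/=; field; rewrite gt_eqF.
- by rewrite addr0 ln1 expr0n/= mul0r !subrr addr0.
move=> t h1 h2; have := lo _ h1 => t1.
have t0 : 0 < 1 + t by rewrite (lt_le_trans _ t1).
have tx : `|t| <= `|x|.
  move: h1 h2; have [x0|x0] := leP 0 x => h1 h2; first by rewrite !ger0_norm.
  by rewrite !ler0_norm ?lerN2// ltW.
rewrite normrM normfV (gtr0_norm t0) ler_pdivrMr// normrX.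
apply: (@le_trans _ _ (4 * `|x| ^+ 2 * 4^-1)).
  by rewrite mulrAC divff ?mul1r ?pnatr_eq0// lerXn2r// nnegrE.
by rewrite ler_wpM2l// mulr_ge0// exprn_ge0.
Qed.

Lemma ln_upper (x : R) : 0 < 1 + x -> ln (1 + x) <= x.
Proof. by move=> x0; apply: le_ln1Dx; rewrite -subr_gt0 opprK addrC. Qed.

(** [z] is bounded only from below, matching what is known about [Z_k]. If |z| <= |y| or |z| <= 1
    the cubic Taylor remainder is enough; for z > 1 everything is of order z^2, because 0 <= ln(1 +
    x) <= x. *)
Lemma log_remainder (y z : R) : `|y| <= 4^-1 -> - 2^-1 <= z ->
  `|ln (1 + (y + z)) - (y + z) + (y + z) ^+ 2 / 2| <= 32 * (`|y| ^+ 3 + z ^+ 2).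
Proof.
move=> y4 z2; have y4' := y4; rewrite ler_norml in y4'; have /andP[y1 y2] := y4'.
have x34 : - (3 / 4) <= y + z by lra.
have y30 : 0 <= `|y| ^+ 3 by rewrite exprn_ge0.
have [zy|yz] := leP `|z| `|y|.
  apply: (le_trans (ln_taylor x34)).
  apply: (@le_trans _ _ (4 * (2 * `|y|) ^+ 3)).
    rewrite ler_wpM2l// lerXn2r ?nnegrE ?mulr_ge0//.
    by rewrite (le_trans (ler_normD _ _))//; lra.
  rewrite exprMn; have := sqr_ge0 z; move: y30; lra.
have [z1|z1] := leP `|z| 1.
  apply: (le_trans (ln_taylor x34)).
  apply: (@le_trans _ _ (4 * (2 * `|z|) ^+ 3)).
    rewrite ler_wpM2l// lerXn2r ?nnegrE ?mulr_ge0//.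
    by rewrite (le_trans (ler_normD _ _))//; move: yz; lra.
  rewrite exprMn -(real_normK (num_real z)).
  have : `|z| ^+ 3 <= `|z| ^+ 2 by rewrite exprSr ler_piMr// exprn_ge0.
  by move: y30; lra.
have zp : 1 < z.
  by move: z1; rewrite lter_normr => /orP[//|]; move: z2; lra.
have l1 := @ln_upper (y + z); have x0 : 0 < 1 + (y + z) by lra.
have l0 : 0 <= ln (1 + (y + z)) by apply: ln_ge0; lra.
have {}l1 := l1 x0.
rewrite ler_norml; apply/andP; split; nra.
Qed.

(** Turns sums over the row index k into sums over the rank m = n - k. *)
Lemma sum_rev (F : nat -> R) n : \sum_(k < n) F (n - k)%N = \sum_(i < n) F i.+1.
Proof.
rewrite (reindex_inj rev_ord_inj)/=; apply: eq_bigr => i _.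
by rewrite subKn.
Qed.

Lemma sum_inv_sqrt n : \sum_(i < n) (Num.sqrt (i.+1%:R : R))^-1 <= 2 * Num.sqrt n%:R.
Proof.
elim: n => [|n ih]; first by rewrite big_ord0 mulr_ge0// sqrtr_ge0.
rewrite big_ord_recr/=; apply: (le_trans (lerD ih (lexx _))).
set p := Num.sqrt n%:R; set q := Num.sqrt n.+1%:R.
have p0 : 0 <= p by exact: sqrtr_ge0.
have q0 : 0 < q by rewrite sqrtr_gt0 ltr0n.
have pq : p <= q by apply: ler_wsqrtr; rewrite ler_nat.
have e : q ^+ 2 - p ^+ 2 = 1.
  by rewrite !sqr_sqrtr ?ler0n// -natr1 addrAC subrr add0r.
rewrite -subr_ge0 (_ : _ - _ = (2 * q ^+ 2 - 2 * p * q - (q ^+ 2 - p ^+ 2)) / q); last first.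
  by rewrite e; field; rewrite gt_eqF.
rewrite divr_ge0 ?(ltW q0)//.
by rewrite (_ : _ - _ = (q - p) ^+ 2); [exact: sqr_ge0|ring].
Qed.

Lemma sum_inv_32 n : \sum_(i < n) ((i.+1%:R : R) * Num.sqrt i.+1%:R)^-1 <= 3.
Proof.
(* The stronger bound is inductive: 2/sqrt(n+1) - 2/sqrt(n+2) is at least the next term. *)
suff : \sum_(i < n.+1) ((i.+1%:R : R) * Num.sqrt i.+1%:R)^-1 <= 3 - 2 / Num.sqrt n.+1%:R.
  rewrite big_ord_recr/= => h.
  apply: le_trans (le_trans h _); last by rewrite gerBl divr_ge0// sqrtr_ge0.
  by rewrite lerDl invr_ge0 mulr_ge0 ?sqrtr_ge0.
elim: n => [|n ih].
  by rewrite big_ord_recr big_ord0/= sqrtr1 mulr1 invr1; lra.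
rewrite big_ord_recr/=; apply: (le_trans (lerD ih (lexx _))).
set p := Num.sqrt n.+1%:R; set q := Num.sqrt n.+2%:R.
have p0 : 0 < p by rewrite sqrtr_gt0 ltr0n.
have q0 : 0 < q by rewrite sqrtr_gt0 ltr0n.
have pq : p <= q by apply: ler_wsqrtr; rewrite ler_nat.
have q2 : n.+2%:R = q ^+ 2 :> R by rewrite sqr_sqrtr ?ler0n.
have e : q ^+ 2 - p ^+ 2 = 1.
  by rewrite !sqr_sqrtr ?ler0n// -[in X in X - _]natr1 addrAC subrr add0r.
rewrite q2 -subr_ge0.
have -> : 3 - 2 / q - (3 - 2 / p + (q ^+ 2 * q)^-1) =
   (2 * q ^+ 2 * (q - p) - p * (q ^+ 2 - p ^+ 2)) / (p * q ^+ 3).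
  by rewrite e; field; rewrite !gt_eqF.
rewrite divr_ge0 ?mulr_ge0 ?exprn_ge0 ?(ltW p0) ?(ltW q0)//.
rewrite (_ : _ - _ = (q - p) * (2 * q ^+ 2 - p * (q + p))); last by ring.
rewrite mulr_ge0 ?subr_ge0//; nra.
Qed.

Lemma sum_inv_sqr_tail M n : (0 < M)%N ->
  \sum_(i < n | (M <= i)%N) ((i.+1%:R : R) ^+ 2)^-1 <= M%:R^-1.
Proof.
move=> M0; have [nM|Mn] := leqP n M.
  rewrite big_pred0 ?invr_ge0// => i; apply/negbTE.
  by rewrite -ltnNge (leq_trans (ltn_ord i)).
suff : \sum_(i < n | (M <= i)%N) ((i.+1%:R : R) ^+ 2)^-1 <= M%:R^-1 - n%:R^-1.
  by move=> /le_trans; apply; rewrite gerBl invr_ge0.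
elim: n Mn => // n ih; rewrite ltnS leq_eqVlt => /predU1P[<-|Mn].
  rewrite big_mkcond big_ord_recr/= leqnn big1 ?add0r; last first.
    by move=> i _; rewrite leqNgt ltn_ord.
  have M0' : 0 < M%:R :> R by rewrite ltr0n.
  rewrite -natr1; move: (M%:R : R) M0' => t t0.
  rewrite -subr_ge0 (_ : _ - _ = (t * (t + 1) ^+ 2)^-1).
    by rewrite invr_ge0 mulr_ge0 ?sqr_ge0// ltW.
  by field; rewrite !gt_eqF// addr_gt0.
rewrite big_mkcond big_ord_recr/= -big_mkcond/= (ltnW Mn).
apply: (le_trans (lerD (ih Mn) (lexx _))).
have n0 : 0 < n%:R :> R by rewrite ltr0n (leq_ltn_trans _ Mn).
rewrite -natr1; have M0' : 0 < M%:R :> R by rewrite ltr0n.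
move: (n%:R : R) n0 (M%:R : R) M0' => t t0 M' M'0.
rewrite -subr_ge0 (_ : _ - _ = (t * (t + 1) ^+ 2)^-1).
  by rewrite invr_ge0 mulr_ge0 ?sqr_ge0// ltW.
by field; rewrite !gt_eqF// ?addr_gt0.
Qed.

Lemma sum_inv_sqr n : \sum_(i < n) ((i.+1%:R : R) ^+ 2)^-1 <= 2.
Proof.
have h := @sum_inv_sqr_tail 1 n isT; rewrite invr1 in h.
rewrite (bigID (fun i : 'I_n => (1 <= i)%N))/=.
apply: (@le_trans _ _ (1 + 1)); last by lra.
apply: lerD h _; case: n => [|n]; first by rewrite big_ord0.
rewrite (bigD1 ord0)//= big1 ?addr0 ?expr1n ?invr1// => i /andP[h1 h2].
by move: h2; rewrite -val_eqE/= -lt0n (negbTE h1).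
Qed.

Lemma harmonic_lower n : ln n.+1%:R <= \sum_(i < n) (i.+1%:R : R)^-1.
Proof.
elim: n => [|n ih]; first by rewrite ln1 big_ord0.
rewrite big_ord_recr/=; apply: le_trans (lerD ih (lexx _)).
have n0 : 0 < n.+1%:R :> R by rewrite ltr0n.
have -> : n.+2%:R = n.+1%:R * (1 + n.+1%:R^-1) :> R.
  by rewrite mulrDr mulr1 divff ?natr1// gt_eqF.
have p : 0 < 1 + n.+1%:R^-1 :> R by rewrite addr_gt0// invr_gt0.
by rewrite lnM ?posrE// lerD2l ln_upper.
Qed.

Lemma harmonic_upper n : (0 < n)%N -> \sum_(i < n) (i.+1%:R : R)^-1 <= 1 + ln n%:R.
Proof.
case: n => // n _; elim: n => [|n ih].
  by rewrite big_ord_recr big_ord0/= add0r invr1 ln1 addr0.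
rewrite big_ord_recr/=; apply: (le_trans (lerD ih (lexx _))).
rewrite -addrA lerD2l.
have n0 : 0 < n.+1%:R :> R by rewrite ltr0n.
have n1 : 0 < n.+2%:R :> R by rewrite ltr0n.
have e : n.+1%:R = n.+2%:R * (1 + - n.+2%:R^-1) :> R.
  by rewrite mulrDr mulr1 mulrN divff ?gt_eqF// -[n.+2%:R]natr1 addrK.
have p : 0 < 1 + - n.+2%:R^-1 :> R.
  by rewrite subr_gt0 invf_lt1// ltr1n.
rewrite e lnM ?posrE//; have := ln_upper p.
by rewrite -addrA gerDl -lerBrDr sub0r.
Qed.

End numeric.

(** * Pointwise bounds for one factor of the logarithm *)

Section expansion.
Variable R : realType.
Implicit Types (y z t : R).

Lemma mul_le_weighted y z t : 0 < t -> `|y * z| <= t * y ^+ 2 + z ^+ 2 / t.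
Proof.
move=> t0; rewrite normrM -(@ler_pM2r _ t)// mulrDl divfK ?gt_eqF//.
have -> : y ^+ 2 = `|y| ^+ 2 by rewrite real_normK// num_real.
have -> : z ^+ 2 = `|z| ^+ 2 by rewrite real_normK// num_real.
have y0 := normr_ge0 y; have z0 := normr_ge0 z.
move: `|y| `|z| y0 z0 => u v u0 v0.
rewrite [leRHS](_ : _ = u * v * t + ((t * u - v) ^+ 2 + u * v * t)); last by ring.
by rewrite lerDl addr_ge0 ?sqr_ge0// !mulr_ge0// ltW.
Qed.

(** Outside the range of the Taylor expansion only a lower bound on the logarithm is at hand. The
    price is a constant, paid once for each of the last [M] rows. *)
Lemma log_remainder_small (x L : R) : 0 < 1 + x -> - L <= ln (1 + x) -> 0 <= L ->
  `|ln (1 + x) - x + x ^+ 2 / 2| <= 1 + L + x ^+ 2 / 2.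
Proof.
move=> x0 xL L0; have := ln_upper x0; have := sqr_ge0 (x - 1); rewrite sqrrB expr1n mulr1.
rewrite -mulr_natl; have h0 := sqr_ge0 x; move: xL; move: (ln _) => l xL h1 h2.
rewrite ler_norml; apply/andP; split; move: xL h0 h1 h2; move: (x ^+ 2) => x2; lra.
Qed.

Lemma sqrD_le y z : (y + z) ^+ 2 / 2 <= y ^+ 2 + z ^+ 2.
Proof.
rewrite -subr_ge0 [X in 0 <= X](_ : _ = (y - z) ^+ 2 / 2); last by field.
by rewrite divr_ge0// sqr_ge0.
Qed.

Let assemble_large (rho yz y3 p1 p2 p3 p4 z2 W : R) :
  rho <= 32 * (y3 + z2) -> yz <= p1 + p4 -> y3 <= p2 + p3 ->
  0 <= z2 -> 0 <= p3 -> 0 <= p1 -> 0 <= p2 -> 0 <= p4 -> 0 <= W ->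
  rho + yz + z2 / 2 + W <= 33 * (p1 + p2 + (p4 + z2) + W + p3).
Proof. lra. Qed.

Let assemble_small (rho yz p0 p1 p2 p3 p4 y2 z2 W L : R) :
  rho <= 1 + L + p0 -> yz <= p1 + p4 -> p0 <= y2 + z2 ->
  0 <= y2 -> 0 <= z2 -> 0 <= p3 -> 0 <= p1 -> 0 <= p2 -> 0 <= p4 -> 0 <= W ->
  rho + yz + z2 / 2 + W <= 33 * (p1 + p2 + y2 + (p4 + z2 + z2) + W + p3) + (1 + L).
Proof. lra. Qed.

(** [t] is the weight that splits the product y z, and [s] the one that trades |y|^3 for y^2/s + s
    y^4. *)
Lemma step_expansion_large (y z t s W : R) : 0 < t -> 0 < s -> 0 <= W ->
  `|y| <= 4^-1 -> - 2^-1 <= z ->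
  `|ln (1 + (y + z)) - (y + z) + (y + z) ^+ 2 / 2| + `|y * z| + z ^+ 2 / 2 + W <=
  33 * ((t + s^-1) * y ^+ 2 + (t^-1 + 1) * z ^+ 2 + W + s * y ^+ 4).
Proof.
move=> t0 s0 W0 y4 z2; have h1 := log_remainder y4 z2.
have h2 := mul_le_weighted y z t0.
have s0' : 0 < s^-1 by rewrite invr_gt0.
have h3 := cube_le y s0'; rewrite invrK in h3.
have hy : 0 <= y ^+ 2 := sqr_ge0 y; have hz : 0 <= z ^+ 2 := sqr_ge0 z.
have hy4 : 0 <= s * y ^+ 4.
  by apply: mulr_ge0; [exact: ltW|rewrite exprn_even_ge0].
have a1 : 0 <= t * y ^+ 2 by rewrite mulr_ge0// ltW.
have a2 : 0 <= s^-1 * y ^+ 2 by rewrite mulr_ge0// ltW.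
have a3 : 0 <= z ^+ 2 / t by rewrite divr_ge0// ltW.
rewrite !(mulrDl _ _ (_ ^+ 2)) mul1r [t^-1 * _]mulrC.
rewrite [y ^+ 4 * s]mulrC in h3.
exact: (assemble_large (y3 := `|y| ^+ 3)).
Qed.

Lemma step_expansion_small (y z t s W L : R) : 0 < t -> 0 < s -> 0 <= W -> 0 <= L ->
  0 < 1 + (y + z) -> - L <= ln (1 + (y + z)) ->
  `|ln (1 + (y + z)) - (y + z) + (y + z) ^+ 2 / 2| + `|y * z| + z ^+ 2 / 2 + W <=
  33 * ((t + s^-1 + 1) * y ^+ 2 + (t^-1 + 1 + 1) * z ^+ 2 + W + s * y ^+ 4) + (1 + L).
Proof.
move=> t0 s0 W0 L0 x0 xL; have h1 := log_remainder_small x0 xL L0.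
have h2 := mul_le_weighted y z t0; have h3 := sqrD_le y z.
have hy : 0 <= y ^+ 2 := sqr_ge0 y; have hz : 0 <= z ^+ 2 := sqr_ge0 z.
have hy4 : 0 <= s * y ^+ 4.
  by apply: mulr_ge0; [exact: ltW|rewrite exprn_even_ge0].
have a1 : 0 <= t * y ^+ 2 by rewrite mulr_ge0// ltW.
have a2 : 0 <= s^-1 * y ^+ 2 by rewrite mulr_ge0// invr_ge0 ltW.
have a3 : 0 <= z ^+ 2 / t by rewrite divr_ge0// ltW.
rewrite !(mulrDl _ _ (_ ^+ 2)) !mul1r [t^-1 * _]mulrC.
exact: (assemble_small (p0 := (y + z) ^+ 2 / 2)).
Qed.

End expansion.

Section smoothing.
Context (d : measure_display) (T : measurableType d) (R : realType)
  (P : probability T R).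
Variable X : T -> R.
Hypothesis mX : measurable_fun setT X.

Lemma measurable_sublevel (y : R) : measurable [set w | X w <= y].
Proof.
rewrite -[X in measurable X]setTI; exact: measurable_fun_ler.
Qed.

Lemma itg_heat (a u : R) : itg P (fun w => heat a u (X w)).
Proof.
apply: (@bounded_itg _ _ _ _ _ 1).
  by apply: measurableT_comp => //; exact: measurable_heat.
by move=> w; rewrite ger0_norm ?heat_ge0 ?heat_le1.
Qed.

(** If X <= y, then after adding a Gaussian of standard deviation [dl] the value stays below y + kp
    dl with probability at least Phi(kp). *)
Lemma smooth_upper (y kp dl : R) : 0 < dl ->
  Phi kp * Pr P [set w | X w <= y] <= Ex P (fun w => heat (y + kp * dl) (dl ^+ 2) (X w)).
Proof.
move=> d0; have mE := measurable_sublevel y.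
rewrite -Ex_indic// -ExZ; last exact: itg_indic.
apply: le_Ex; [by apply: itgZ; exact: itg_indic|exact: itg_heat|move=> w].
rewrite indicE; case: (boolP (w \in _)) => h; last by rewrite mulr0 heat_ge0.
rewrite mulr1 /heat sqrtr_sqr (gtr0_norm d0); apply: le_Phi.
rewrite inE/= in h; rewrite ler_pdivlMr//; move: h; lra.
Qed.

Lemma smooth_lower (y kp dl : R) : 0 < dl ->
  Ex P (fun w => heat (y - kp * dl) (dl ^+ 2) (X w)) <=
  Pr P [set w | X w <= y] + Phi (- kp).
Proof.
move=> d0; have mE := measurable_sublevel y.
have i1 := itg_indic P mE; have i2 := itg_cst P (Phi (- kp) : R).
rewrite -Ex_indic// -[X in _ <= _ + X](Ex_cst P) -(ExD i1 i2).
apply: le_Ex; [exact: itg_heat|exact: itgD|move=> w].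
rewrite indicE; case: (boolP (w \in _)) => h.
  by apply: (le_trans (heat_le1 _ _ _)); rewrite lerDl Phi_ge0.
rewrite add0r /heat sqrtr_sqr (gtr0_norm d0); apply: le_Phi.
have {}h : y < X w by rewrite ltNge; apply: contra h => h; rewrite inE.
rewrite ler_pdivrMr//; move: h; lra.
Qed.

End smoothing.

Section tails.
Variable R : realType.

Lemma Phi_scale_le (x t s : R) : 1 <= s -> `|Phi ((x + t) / s) - Phi x| <= `|t| + `|x| * (s ^+ 2 - 1).
Proof.
move=> s1; have s0 : 0 < s by rewrite (lt_le_trans ltr01).
apply: (le_trans (Phi_lip _ _)).
have -> : (x + t) / s - x = (t - x * (s - 1)) / s by field; rewrite gt_eqF.
rewrite normrM [`|s^-1|]gtr0_norm ?invr_gt0//.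
apply: (@le_trans _ _ `|t - x * (s - 1)|).
  by rewrite ler_piMr// invf_le1.
apply: (le_trans (ler_normB _ _)); rewrite lerD2l normrM ler_wpM2l//.
by rewrite ger0_norm ?subr_ge0// lerB// expr2 ler_peMr// ltW.
Qed.

Lemma Phi_tails (e : R) : 0 < e -> exists kp, [/\ 0 < kp, Phi (- kp) <= e & 1 - Phi kp <= e].
Proof.
move=> e0; pose N := normal_prob (0 : R) 1.
have lim0 : (fun n : nat => N [set` `]-oo, - n%:R]]) @ \oo --> N set0.
  rewrite -(_ : \bigcap_n [set` `]-oo, (- n%:R : R)]] = set0).
    apply: nonincreasing_cvg_mu => //.
    - by rewrite (le_lt_trans (probability_le1 _ _))// ltry.
    - exact: bigcapT_measurable.
    - move=> n m nm; apply/subsetPset => z/=; rewrite !in_itv/= => /le_trans; apply.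
      by rewrite lerN2 ler_nat.
  apply/seteqP; split => // z /= h.
  have := h (Num.bound `|z|) Logic.I; rewrite /= in_itv/= leNgt => /negP; apply.
  by rewrite ltrNl (le_lt_trans _ (archi_boundP (normr_ge0 z)))// -normrN ler_norm.
have lim1 : (fun n : nat => N [set` `]-oo, (n%:R : R)]]) @ \oo --> N setT.
  rewrite -(_ : \bigcup_n [set` `]-oo, (n%:R : R)]] = setT).
    apply: nondecreasing_cvg_mu => //.
    - exact: bigcupT_measurable.
    - move=> n m nm; apply/subsetPset => z/=; rewrite !in_itv/= => /le_trans; apply.
      by rewrite ler_nat.
  apply/seteqP; split => // z _; exists (Num.bound `|z|) => //=; rewrite in_itv/=.
  by rewrite (le_trans (ler_norm _))// ltW// archi_boundP.
have N0 : N set0 = 0%E := measure0 N; have N1 : N setT = 1%E := probability_setT N.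
rewrite {}N0 in lim0; rewrite {}N1 in lim1.
have {}lim0 : (fun n : nat => Phi (- n%:R : R)) @ \oo --> (0 : R) by exact: (fine_cvg lim0).
have {}lim1 : (fun n : nat => Phi (n%:R : R)) @ \oo --> (1 : R) by exact: (fine_cvg lim1).
have /cvgrPdist_le/(_ _ e0)[n0 _ h0] := lim0.
have /cvgrPdist_le/(_ _ e0)[n1 _ h1] := lim1.
exists (maxn n0 n1).+1%:R; split => //.
- have := h0 (maxn n0 n1).+1; rewrite /= sub0r normrN ger0_norm ?Phi_ge0//; apply.
  by rewrite (leq_trans (leq_maxl _ n1)).
- have := h1 (maxn n0 n1).+1; rewrite /= ger0_norm ?subr_ge0 ?Phi_le1//; apply.
  by rewrite (leq_trans (leq_maxr n0 _)).
Qed.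

(** Twice the normalising constant of the theorem, because the argument works with the logarithm of
    the squared determinant. *)
Definition sigma (n : nat) : R := Num.sqrt (2 * ln n%:R).

Lemma sigma_sqr n : (0 < n)%N -> sigma n ^+ 2 = 2 * ln n%:R.
Proof. by move=> n0; rewrite sqr_sqrtr// mulr_ge0// ln_ge0// ler1n. Qed.

Lemma sigma_le_sqrt n : (0 < n)%N -> sigma n <= Num.sqrt n%:R.
Proof.
move=> n0; rewrite ler_wsqrtr//.
have nR : 0 < n%:R :> R by rewrite ltr0n.
have sn : 0 < Num.sqrt n%:R :> R by rewrite sqrtr_gt0.
have nE : n%:R = Num.sqrt n%:R ^+ 2 :> R by rewrite sqr_sqrtr// ltW.
rewrite {}nE; move: (Num.sqrt _) sn => s s0.
rewrite lnXn// -mulr_natl.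
have := @ln_upper R (s - 1); rewrite (_ : 1 + (s - 1) = s); last by ring.
move=> /(_ s0); have := sqr_ge0 (s - 2); move: (ln s) => l; nra.
Qed.

End tails.

(** * Rows of the random matrix *)

Section EW_numeric.
Variable R : realType.

(* [gW C m] is a supersolution of the recursion
   [E W_k+1 <= (1 - (2 / m - C / m^(3/2))) * E W_k] with [m = n - k]. *)
Definition gW (C x : R) : R := x ^+ 2 + 4 * C * (x * Num.sqrt x).

Lemma gW_step (C m : R) : 0 <= C -> 2 <= m -> 16 * C ^+ 2 <= m ->
  (1 - (2 / m - C / (m * Num.sqrt m))) * gW C m <= gW C (m - 1).
Proof.
move=> C0 m2 mC; have m0 : 0 < m by apply: lt_le_trans m2.
pose s := Num.sqrt m; have s0 : 0 < s by rewrite sqrtr_gt0.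
have ms : m = s ^+ 2 by rewrite sqr_sqrtr// ltW.
have sC : 4 * C <= s.
  rewrite -(@ler_pXn2r _ 2)// ?nnegrE ?mulr_ge0 ?(ltW s0)// -ms exprMn.
  by rewrite -natrX.
have m10 : 0 <= m - 1 by lra.
pose t := Num.sqrt (m - 1).
have tE : t ^+ 2 = m - 1 by rewrite sqr_sqrtr.
have t0 : 0 <= t by exact: sqrtr_ge0.
(* The convexity bound (m - 1)^(3/2) >= m^(3/2) - (3/2) m^(1/2), proved by squaring. *)
have key : m * s - 3 / 2 * s <= (m - 1) * t.
  rewrite -(@ler_pXn2r _ 2)// ?nnegrE ?mulr_ge0//; last first.
    rewrite -mulrBl; apply: mulr_ge0; [lra|exact: ltW].
  rewrite -mulrBl !exprMn tE -ms -subr_ge0.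
  rewrite (_ : _ - _ = 3 / 4 * m - 1); [lra|by field].
rewrite /gW -/s -/t.
apply: (@le_trans _ _ ((m - 1) ^+ 2 + 4 * C * (m * s - 3 / 2 * s))); last first.
  by rewrite lerD2l ler_wpM2l// mulr_ge0.
(* All that survives the cancellation; it is positive because 16 C^2 <= m means 4 C <= s. *)
rewrite -subr_ge0 (_ : _ - _ = 1 + C * (s - 4 * C)).
  by rewrite addr_ge0// mulr_ge0// subr_ge0.
by rewrite ms; field; rewrite gt_eqF.
Qed.

Lemma gW_le (C x : R) : 0 <= C -> 1 <= x -> gW C x <= (1 + 4 * C) * x ^+ 2.
Proof.
move=> C0 x1; have x0 : 0 <= x by rewrite (le_trans ler01).
rewrite /gW [leRHS](_ : _ = x ^+ 2 + 4 * C * (x * x)); last by ring.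
rewrite lerD2l ler_wpM2l ?mulr_ge0// ler_wpM2l// -[leRHS]ger0_norm// -sqrtr_sqr ler_wsqrtr//.
by rewrite expr2 ler_peMl.
Qed.

Lemma le_gW (C x y : R) : 0 <= C -> 0 <= x -> x <= y -> gW C x <= gW C y.
Proof.
move=> C0 x0 xy; apply: lerD.
  by rewrite lerXn2r// nnegrE// (le_trans x0).
by rewrite ler_wpM2l ?mulr_ge0//; apply: ler_pM => //; exact: ler_wsqrtr.
Qed.

End EW_numeric.

(** The arithmetic of the smoothing argument. Division by [q], a probability close to 1, is avoided
    through p <= q p + (1 - q). *)
Lemma sandwich (R : realType) (p q p' e1 e2 h1 h2 f A1 A2 t k X C : R) :
  p <= 1 -> q <= 1 -> 0 <= p' -> q * p <= e1 -> e2 <= p + p' ->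
  `|e1 - h1| <= C -> `|e2 - h2| <= C ->
  `|h1 - f| <= A1 + X -> `|h2 - f| <= A2 + X -> A1 <= t + k -> A2 <= t + k ->
  `|p - f| <= p' + (1 - q) + k + t + X + C.
Proof.
move=> p1 q1 p'0 U D; rewrite !ler_norml => /andP[_ LU] /andP[LD _] /andP[_ hU] /andP[hD _] nU nD.
have pk : p <= q * p + (1 - q).
  have : 0 <= (1 - q) * (1 - p) by rewrite mulr_ge0 ?subr_ge0.
  by rewrite mulrBr mulr1 mulrBl mul1r; lra.
by apply/andP; split; lra.
Qed.

Lemma rate_sandwich (R : realType) (p pU pD f q K E k d2 xd s c1 c2 B b1 : R) :
  `|pU - f| <= K + q + k + E + d2 + c1 -> `|pD - f| <= K + q + k + E + d2 + c1 ->
  p <= pU + B -> pD <= p + B -> B <= b1 + c2 -> d2 <= xd + s ->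
  `|p - f| <= K + q + (k + xd) + b1 + (E + s + c1 + c2).
Proof.
rewrite !ler_norml => /andP[_ hU] /andP[hD _] U D pB x0.
by apply/andP; split; lra.
Qed.

(** * Estimates along the sequence of rows for fixed n *)

Section process.
Context (d : measure_display) (T : measurableType d) (R : realType)
  (P : probability T R) (n : nat) (a : 'I_n -> 'I_n -> {RV P >-> R}).
Hypothesis a_indep : mutually_independent (fun ij : 'I_n * 'I_n => a ij.1 ij.2).
Notation itg := (itg P).
Notation Ex := (Ex P).
Notation X := (fun ij : 'I_n * 'I_n => a ij.1 ij.2).
Notation Am := (random_matrix a).
Variable K0 : R.
Hypotheses (K01 : 1 <= K0) (a4i : forall i j, itg (fun w => a i j w ^+ 4))
  (a1 : forall i j, Ex (a i j) = 0) (a2 : forall i j, Ex (fun w => a i j w ^+ 2) = 1)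
  (a4 : forall i j, Ex (fun w => a i j w ^+ 4) <= K0).

Notation m k := ((n - k)%:R : R).
Notation MF Q := (fun i j : 'I_n => fun_of_matrix Q i j).
Notation YQ k Q r := (Yf (MF Q) (m k) (fun i => fun_of_matrix r 0 i)).
Notation ZQ k Q r := (Zf (MF Q) (m k) (fun i => fun_of_matrix r 0 i)).
Notation Yk k w := (YQ k (rproj (Am w) k) (nrow (Am w) k)).
Notation Zk k w := (ZQ k (rproj (Am w) k) (nrow (Am w) k)).
Notation Wk k w := (Wf (MF (rproj (Am w) k))).

Lemma nrow_fun k (kn : (k < n)%N) w : (fun i => nrow (Am w) k 0 i) = fun i => a (Ordinal kn) i w.
Proof. by apply/funext => i; exact: nrow_Am. Qed.

Lemma m_ge1 k : (k < n)%N -> 1 <= m k.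
Proof. by move=> kn; rewrite ler1n subn_gt0. Qed.

Lemma m_gt0 k : (k < n)%N -> 0 < m k.
Proof. by move=> /m_ge1; exact: lt_le_trans. Qed.

Lemma rproj_proj k w : (k <= n)%N -> is_proj (MF (rproj (Am w) k)) (m k).
Proof.
move=> kn; have [QP <-] := rprojP (Am w) kn; exact: orthoproj_is_proj.
Qed.

Definition row_meas k (F : 'M[R]_n -> 'rV[R]_n -> R) :=
  measurable_fun setT ((fun z => F (rproj (Am z.1) k) (nrow (Am z.2) k))
     : sigT X (past n k) * sigT X (present n k) -> R).

Definition trproj k (Q : 'M[R]_n) := orthoproj Q /\ \tr Q = m k.

Lemma rproj_trproj k w : (k <= n)%N -> trproj k (rproj (Am w) k).
Proof. by move=> kn; split; have [] := rprojP (Am w) kn. Qed.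

Lemma trproj_is_proj k Q : trproj k Q -> is_proj (fun i j => Q i j) (m k).
Proof. by move=> [QP <-]; exact: orthoproj_is_proj. Qed.

(** This plays the role of conditioning on the earlier rows: a bound valid for each fixed projector
    of trace n - k is integrated over the random one. [F] and [B] see the past only through the
    projector, so freezing it is enough. *)
Lemma row_step k (F : 'M[R]_n -> 'rV[R]_n -> R) (B : 'M[R]_n -> R) : (k < n)%N ->
  row_meas k F -> (forall Q r, 0 <= F Q r) ->
  (forall Q, trproj k Q -> itg (fun w => F Q (nrow (Am w) k)) /\
     Ex (fun w => F Q (nrow (Am w) k)) <= B Q) ->
  itg (fun w => B (rproj (Am w) k)) ->
  itg (fun w => F (rproj (Am w) k) (nrow (Am w) k)) /\
  Ex (fun w => F (rproj (Am w) k) (nrow (Am w) k)) <= Ex (fun w => B (rproj (Am w) k)).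
Proof.
move=> kn mF F0 hF iB.
have hT w := hF _ (rproj_trproj w (ltnW kn)).
have [//|||||_ iE iD eD] := @decoupling_Ex _ _ _ _ _ _ a_indep (past n k) (present n k)
  (fun w w' => F (rproj (Am w) k) (nrow (Am w') k)) (fun w => B (rproj (Am w) k))
  (@past_present n k).
- by move=> w w'; exact: F0.
- by move=> w; exact: (hT w).1.
- by move=> w; exact: (hT w).2.
- by [].
split => //; rewrite eD; apply: le_Ex => // w; exact: (hT w).2.
Qed.

Let mQz k i j : measurable_fun setT
  ((fun z => rproj (Am z.1) k i j) : sigT X (past n k) * sigT X (present n k) -> R).
Proof. exact: rproj_pair_meas. Qed.

Let mrz k i : measurable_fun setT
  ((fun z => nrow (Am z.2) k 0 i) : sigT X (past n k) * sigT X (present n k) -> R).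
Proof. exact: nrow_pair_meas. Qed.

Lemma Y_meas k : row_meas k (fun Q r => Yf (fun i j => Q i j) (m k) (fun i => r 0 i)).
Proof. by apply: measurable_Yf; [exact: mQz|exact: mrz]. Qed.

Lemma Z_meas k : row_meas k (fun Q r => Zf (fun i j => Q i j) (m k) (fun i => r 0 i)).
Proof. by apply: measurable_Zf; [exact: mQz|exact: mrz]. Qed.

Lemma W_measT k : measurable_fun setT (fun w => Wk k w).
Proof. by apply: measurable_Wf => i j; exact: rprojT_meas. Qed.

Lemma itg_W k : (k <= n)%N -> itg (fun w => Wk k w).
Proof.
move=> kn; apply: (@bounded_itg _ _ _ _ _ (m k)); first exact: W_measT.
by move=> w; rewrite ger0_norm ?Wf_ge0// Wf_le//; exact: rproj_proj.
Qed.

Definition CW : R := 84 * K0 ^+ 2.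

Lemma CW_ge0 : 0 <= CW.
Proof. by rewrite /CW mulr_ge0// sqr_ge0. Qed.

Lemma deflate_Wk k w : (k < n)%N -> Wk k.+1 w <= Wk k w.
Proof.
move=> kn; have [QP tQ] := rproj_trproj w (ltnW kn).
have t0 : \tr (rproj (Am w) k) != 0 by rewrite tQ gt_eqF// m_gt0.
apply: ler_sum => i _ /=.
have /andP[p0 pQ] := pivot_sqr_le (nrow (Am w) k) QP t0 i.
rewrite deflate_diag// lerXn2r ?nnegrE ?subr_ge0//; last by rewrite gerBl.
exact: orthoproj_diag_ge0.
Qed.

Lemma EW_step k : (k < n)%N ->
  Ex (fun w => Wk k.+1 w) <=
  (1 - (2 / m k - CW / (m k * Num.sqrt (m k)))) * Ex (fun w => Wk k w).
Proof.
move=> kn; rewrite -ExZ; last exact: itg_W (ltnW kn).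
set c := 1 - _.
have := @row_step k (fun Q r => Wf (fun i j => deflate Q r i j))
  (fun Q => c * Wf (fun i j => Q i j)) kn.
move=> [||Q0 hQ||_ //].
- apply: measurable_Wf => i j.
  by apply: measurable_deflate; [exact: rproj_pair_meas|exact: nrow_pair_meas].
- by move=> Q0 r0; exact: Wf_ge0.
- have [QP tQ] := hQ; have t0 : \tr Q0 != 0 by rewrite tQ gt_eqF// m_gt0.
  have iD : itg (fun w => Wf (fun i j => deflate Q0 (nrow (Am w) k) i j)).
    apply: (@bounded_itg _ _ _ _ _ (m k - 1)).
      apply: measurable_Wf => i j; apply: measurable_deflate; last exact: nrowT_meas.
      by move=> ? ?; exact: measurable_cst.
    move=> w; rewrite ger0_norm ?Wf_ge0//; apply: Wf_le.
    rewrite -tQ -(deflate_trace (nrow (Am w) k) QP t0).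
    exact/orthoproj_is_proj/deflate_orthoproj.
  split => //.
  have [ig eg] := @row_gain_Ex _ _ _ _ _ _ (row_indep a_indep (Ordinal kn)) K0 K01
    (a4i _) (a1 _) (a2 _) (a4 _) (fun i j => Q0 i j) (m k) (m_ge1 kn) (trproj_is_proj hQ).
  apply: (@le_trans _ _ (Ex (fun w => Wf (fun i j => Q0 i j) -
     row_gain (fun i j => Q0 i j) (m k) (fun i => a (Ordinal kn) i w)))).
    apply: le_Ex => //; first by apply: itgB => //; exact: itg_cst.
    move=> w; rewrite -(nrow_fun kn); apply: deflate_Wf => //; exact: m_gt0.
  rewrite ExB//; last exact: itg_cst.
  rewrite Ex_cst /c -/CW mulrC mulrBr mulr1 lerD2l lerN2; exact: eg.
- by apply: itgZ; exact: itg_W (ltnW kn).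
Qed.

(** From this rank on [gW_step] applies; the two extra successors secure its condition m >= 2. *)
Definition m0W : nat := (Num.bound (16 * CW ^+ 2)).+2.

Lemma m0W_ge : 16 * CW ^+ 2 <= m0W%:R :> R.
Proof.
have h : 0 <= 16 * CW ^+ 2 by rewrite mulr_ge0// sqr_ge0.
have := archi_boundP h => /ltW/le_trans; apply.
by rewrite ler_nat; exact: (leq_trans (leqnSn _) (leqnSn _)).
Qed.

Lemma EW_le_gW k : (k <= n)%N -> (0 < n)%N ->
  Ex (fun w => Wk k w) <= gW CW (maxn (n - k) m0W)%:R / n%:R.
Proof.
move=> + n0; have nR : 0 < n%:R :> R by rewrite ltr0n.
elim: k => [_|k ih kn].
  rewrite subn0 ler_pdivlMr//.
  apply: (@le_trans _ _ (n%:R ^+ 2)).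
    rewrite expr2 ler_wpM2r ?(ltW nR)// -[leRHS](Ex_cst P); apply: le_Ex.
    - exact: itg_W.
    - exact: itg_cst.
    - by move=> w; have := Wf_le (rproj_proj w (leq0n n)); rewrite subn0.
  apply: (@le_trans _ _ (gW CW n%:R)).
    by rewrite lerDl; apply: mulr_ge0; rewrite mulr_ge0 ?CW_ge0 ?sqrtr_ge0 ?ler0n.
  by apply: le_gW; rewrite ?CW_ge0 ?ler0n// ler_nat leq_maxl.
have {}ih := ih (ltnW kn).
have [mk|mk] := leqP (n - k) m0W.
  (* Below the threshold the recursion gives way to monotonicity of W_k, so the bound stays frozen
     at [m0W]. *)
  rewrite (maxn_idPr _); last by rewrite (leq_trans _ mk)// leq_sub2l.
  rewrite (maxn_idPr mk) in ih; apply: le_trans ih.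
  apply: le_Ex; [exact: itg_W|exact: itg_W (ltnW kn)|].
  by move=> w; exact: deflate_Wk.
have mk' : (m0W <= n - k.+1)%N by rewrite subnS -ltnS prednK// (leq_ltn_trans _ mk).
rewrite (maxn_idPl mk'); rewrite (maxn_idPl (ltnW mk)) in ih.
have m2 : 2 <= m k :> R by rewrite ler_nat (leq_trans _ (ltnW mk)).
apply: (le_trans (EW_step kn)).
apply: (@le_trans _ _ ((1 - (2 / m k - CW / (m k * Num.sqrt (m k)))) *
    (gW CW (m k) / n%:R))).
  rewrite ler_wpM2l// opprB addrA subr_ge0 (@le_trans _ _ 1)//.
    by rewrite ler_pdivrMr ?mul1r// (lt_le_trans _ m2).
  by rewrite lerDl divr_ge0 ?CW_ge0// mulr_ge0 ?sqrtr_ge0.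
rewrite mulrA ler_wpM2r ?invr_ge0 ?ler0n//.
have -> : m k.+1 = m k - 1 :> R by rewrite subnS -subn1 [in LHS]natrB ?subn_gt0.
apply: gW_step => //; first exact: CW_ge0.
by rewrite (le_trans m0W_ge)// ler_nat ltnW.
Qed.

Definition DW : R := (1 + 4 * CW) * m0W%:R ^+ 2.

Lemma DW_ge0 : 0 <= DW.
Proof. by rewrite mulr_ge0 ?sqr_ge0// addr_ge0// mulr_ge0// CW_ge0. Qed.

Lemma EW_le k : (k < n)%N -> Ex (fun w => Wk k w) <= DW * m k ^+ 2 / n%:R.
Proof.
move=> kn; have n0 : (0 < n)%N by rewrite (leq_ltn_trans _ kn).
apply: (le_trans (EW_le_gW (ltnW kn) n0)).
rewrite ler_wpM2r ?invr_ge0 ?ler0n//.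
have mx1 : (1 <= maxn (n - k) m0W)%N by rewrite leq_max orbT.
apply: (@le_trans _ _ ((1 + 4 * CW) * (maxn (n - k) m0W)%:R ^+ 2)).
  by apply: gW_le; [exact: CW_ge0|rewrite ler1n].
rewrite /DW [leRHS](_ : _ = (1 + 4 * CW) * (m0W%:R * m k) ^+ 2); last by ring.
have c0 : 0 <= 1 + 4 * CW by rewrite addr_ge0// mulr_ge0// CW_ge0.
rewrite ler_wpM2l//.
rewrite lerXn2r ?nnegrE ?mulr_ge0 ?ler0n// -natrM ler_nat geq_max.
by rewrite leq_pmull// leq_pmulr// subn_gt0.
Qed.

Lemma row_funE k (kn : (k < n)%N) (H : ('I_n -> R) -> R) :
  (fun w => H (fun i => nrow (Am w) k 0 i)) = (fun w => H (fun i => a (Ordinal kn) i w)).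
Proof. by apply/funext => w; rewrite (nrow_fun kn). Qed.

Lemma row_Y k Q0 : (k < n)%N -> trproj k Q0 ->
  let Y w := YQ k Q0 (nrow (Am w) k) in
  [/\ measurable_fun setT Y, itg (fun w => Y w ^+ 4), Ex Y = 0,
      Ex (fun w => Y w ^+ 2) = 2 * (m k - Wf (MF Q0)) / m k ^+ 2 &
      Ex (fun w => Y w ^+ 4) <= cY K0 / m k ^+ 2].
Proof.
move=> kn hQ Y.
have [L e1 e2 e4] := Yf_moments (row_indep a_indep (Ordinal kn)) K01
    (a4i _) (a1 _) (a2 _) (a4 _) (m_ge1 kn) (trproj_is_proj hQ).
rewrite /Y (row_funE kn (fun x => Yf (MF Q0) (m k) x)).
rewrite (row_funE kn (fun x => Yf (MF Q0) (m k) x ^+ 4)).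
rewrite (row_funE kn (fun x => Yf (MF Q0) (m k) x ^+ 2)).
by split => //; [exact: L4_meas L|exact: L.2].
Qed.

Lemma row_Z k Q0 : (k < n)%N -> trproj k Q0 ->
  let Z w := ZQ k Q0 (nrow (Am w) k) in
  [/\ itg Z, itg (fun w => Z w ^+ 2), Ex Z = 0,
      Ex (fun w => Z w ^+ 2) <= K0 * Wf (MF Q0) / m k ^+ 2 &
      Pr P [set w | 1 + Z w <= 2^-1] <= cT K0 * Wf (MF Q0) ^+ 2 / m k ^+ 4].
Proof.
move=> kn hQ Z.
have [i1 i2 e1 e2] := Zf_moments (row_indep a_indep (Ordinal kn))
    (a4i _) (a2 _) (a4 _) (MF Q0) (m_ge1 kn).
have tl := Zf_lower_tail (row_indep a_indep (Ordinal kn)) K01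
    (a4i _) (a2 _) (a4 _) (m_ge1 kn) (trproj_is_proj hQ).
rewrite /Z (row_funE kn (fun x => Zf (MF Q0) (m k) x)).
rewrite (row_funE kn (fun x => Zf (MF Q0) (m k) x ^+ 2)).
split => //; rewrite (_ : [set _ | _] =
    [set w | 1 + Zf (MF Q0) (m k) (fun i => a (Ordinal kn) i w) <= 2^-1])//.
by apply/seteqP; split => w /=; rewrite (nrow_fun kn).
Qed.

Lemma Y_process k : (k < n)%N ->
  [/\ itg (fun w => Yk k w ^+ 4), Ex (fun w => Yk k w ^+ 4) <= cY K0 / m k ^+ 2,
      itg (fun w => Yk k w ^+ 2) & Ex (fun w => Yk k w ^+ 2) <= 2 / m k].
Proof.
move=> kn.
have [//||Q0 r0|Q0 hQ||i4 e4] := @row_step k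
  (fun Q0 r0 => YQ k Q0 r0 ^+ 4) (fun=> cY K0 / m k ^+ 2).
- by apply: measurable_funX; exact: Y_meas.
- by rewrite exprn_even_ge0.
- by have [_ ? _ _ ?] := row_Y kn hQ.
- exact: itg_cst.
have [//||Q0 r0|Q0 hQ||i2 e2] := @row_step k
  (fun Q0 r0 => YQ k Q0 r0 ^+ 2) (fun=> 2 / m k).
- by apply: measurable_funX; exact: Y_meas.
- exact: sqr_ge0.
- have [mY iY _ eY _] := row_Y kn hQ.
  split; first exact: (le_moment2 mY iY).1.
  rewrite eY ler_pdivrMr ?exprn_gt0 ?m_gt0//.
  rewrite (_ : 2 / m k * m k ^+ 2 = 2 * m k); last by field; rewrite gt_eqF// m_gt0.
  by rewrite ler_wpM2l// gerBl Wf_ge0.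
- exact: itg_cst.
by split => //; [move: e4|move: e2]; rewrite Ex_cst.
Qed.

Lemma Z_process k : (k < n)%N ->
  itg (fun w => Zk k w ^+ 2) /\ Ex (fun w => Zk k w ^+ 2) <= K0 * DW / n%:R.
Proof.
move=> kn.
have iW := itg_W (ltnW kn).
have [//||Q0 r0|Q0 hQ||i2 e2] := @row_step k
  (fun Q0 r0 => ZQ k Q0 r0 ^+ 2) (fun Q0 => K0 / m k ^+ 2 * Wf (MF Q0)).
- by apply: measurable_funX; exact: Z_meas.
- exact: sqr_ge0.
- have [_ iZ _ eZ _] := row_Z kn hQ; split => //.
  by rewrite mulrAC.
- exact: itgZ.
split => //; apply: (le_trans e2); rewrite ExZ//.
rewrite [leRHS](_ : _ = K0 / m k ^+ 2 * (DW * m k ^+ 2 / n%:R)).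
  rewrite ler_wpM2l// ?EW_le//; apply: divr_ge0; first exact: le_trans K01.
  exact: sqr_ge0.
by field; rewrite !gt_eqF ?m_gt0// ltr0n (leq_ltn_trans _ kn).
Qed.

Lemma W_process k : (k < n)%N ->
  itg (fun w => Wk k w / m k ^+ 2) /\ Ex (fun w => Wk k w / m k ^+ 2) <= DW / n%:R.
Proof.
move=> kn; have iW := itg_W (ltnW kn).
have e w : Wk k w / m k ^+ 2 = (m k ^+ 2)^-1 * Wk k w by rewrite mulrC.
rewrite (funext e); split; first exact: itgZ.
rewrite ExZ// mulrC ler_pdivrMr ?exprn_gt0 ?m_gt0// mulrAC; exact: EW_le.
Qed.

Lemma Pr_bool (b : T -> bool) : measurable_fun setT b ->
  itg (fun w => (b w)%:R) /\ Ex (fun w => (b w)%:R) = Pr P [set w | b w].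
Proof.
move=> mb; have mB : measurable [set w | b w].
  by rewrite -[X in measurable X]setTI; exact: (mb measurableT [set true]).
have e : (fun w => (b w)%:R) = \1_[set w | b w] :> (T -> R).
  apply/funext => w; rewrite indicE; congr (_%:R); congr nat_of_bool.
  by apply/idP/idP; rewrite inE.
by rewrite e; split; [exact: itg_indic|exact: Ex_indic].
Qed.

Lemma row_Pr k (b : 'M[R]_n -> 'rV[R]_n -> bool) (B : 'M[R]_n -> R) : (k < n)%N ->
  measurable_fun setT ((fun z => b (rproj (Am z.1) k) (nrow (Am z.2) k))
     : sigT X (past n k) * sigT X (present n k) -> bool) ->
  (forall Q0, trproj k Q0 -> measurable_fun setT (fun w => b Q0 (nrow (Am w) k)) /\
     Pr P [set w | b Q0 (nrow (Am w) k)] <= B Q0) ->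
  itg (fun w => B (rproj (Am w) k)) ->
  measurable_fun setT (fun w => b (rproj (Am w) k) (nrow (Am w) k)) /\
  Pr P [set w | b (rproj (Am w) k) (nrow (Am w) k)] <= Ex (fun w => B (rproj (Am w) k)).
Proof.
move=> kn mb hb iB.
have mbT : measurable_fun setT (fun w => b (rproj (Am w) k) (nrow (Am w) k)).
  exact: (measurableT_comp mb (@measurable_diag_sigT _ _ _ _ _ X (past n k) (present n k))).
split => //.
have [//||Q0 r0|Q0 hQ||_] := @row_step k
  (fun Q0 r0 => (b Q0 r0)%:R) B.
- rewrite /row_meas (_ : (fun z => _) = fun z : sigT X (past n k) * sigT X (present n k) =>
    if b (rproj (Am z.1) k) (nrow (Am z.2) k) then (1 : R) else 0).
    by apply: measurable_fun_ifT => //; exact: measurable_cst.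
  by apply/funext => z; case: (b _ _).
- exact: ler0n.
- have [m1 le1] := hb _ hQ; have [i1 e1] := Pr_bool m1.
  by rewrite e1.
- by [].
by rewrite (Pr_bool mbT).2.
Qed.

(** W^2 <= m W reduces the tail to the first moment of W_k. The factor 1/m gained over Chebyshev's
    inequality makes the sum over the rows tend to 0. *)
Lemma Z_tail k : (k < n)%N ->
  measurable [set w | 1 + Zk k w <= 2^-1] /\
  Pr P [set w | 1 + Zk k w <= 2^-1] <= cT K0 * DW / (m k * n%:R).
Proof.
move=> kn; have iW := itg_W (ltnW kn); have m0 := m_gt0 kn.
have n0 : 0 < n%:R :> R by rewrite ltr0n (leq_ltn_trans _ kn).
have [//||Q0 hQ||mb h] := @row_Pr k (fun Q0 r0 => 1 + ZQ k Q0 r0 <= 2^-1)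
  (fun Q0 => cT K0 / m k ^+ 3 * Wf (MF Q0)).
- apply: measurable_fun_ler; last exact: measurable_cst.
  by apply: measurable_funD; [exact: measurable_cst|exact: Z_meas].
- have [iZ _ _ _ tl] := row_Z kn hQ; split.
    apply: measurable_fun_ler; last exact: measurable_cst.
    by apply: measurable_funD; [exact: measurable_cst|exact: itg_meas iZ].
  apply: (le_trans tl).
  have W0 := Wf_ge0 (MF Q0); have Wm := Wf_le (trproj_is_proj hQ).
  rewrite ler_pdivrMr ?exprn_gt0//.
  rewrite [leRHS](_ : _ = cT K0 * Wf (MF Q0) * m k); last by field; rewrite gt_eqF.
  rewrite expr2 mulrA ler_wpM2l// mulr_ge0//.
  by rewrite /cT !mulr_ge0 ?exprn_ge0// ?mulr_ge0 ?exprn_ge0// ?mulr_ge0// (le_trans ler01).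
- exact: itgZ.
split.
  by rewrite -[X in measurable X]setTI; exact: (mb measurableT [set true]).
apply: (le_trans h); rewrite ExZ//.
rewrite [leRHS](_ : _ = cT K0 / m k ^+ 3 * (DW * m k ^+ 2 / n%:R)).
  rewrite ler_wpM2l ?EW_le//; apply: divr_ge0; last by rewrite exprn_ge0// ltW.
  by rewrite /cT !mulr_ge0 ?exprn_ge0// ?mulr_ge0 ?exprn_ge0// ?mulr_ge0// (le_trans ler01).
by field; rewrite !gt_eqF.
Qed.

(** The distance dominates the linear form of [unit_in_range], and the resulting bound is affine in
    W_k, so that averaging it requires only [EW_le]. *)
Lemma dist_small_ball k (eps th : R) : (k < n)%N -> 0 < eps -> 0 < th ->
  measurable [set w | sprod (nrow (Am w) k *m rproj (Am w) k) (nrow (Am w) k) <= eps ^+ 2] /\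
  Pr P [set w | sprod (nrow (Am w) k *m rproj (Am w) k) (nrow (Am w) k) <= eps ^+ 2] <=
  cB R * (4 * eps + 2 * (3 / eps ^+ 3 * (th + K0 * (DW * m k ^+ 2 / n%:R) / th) +
    10 / eps ^+ 4 * (DW * m k ^+ 2 / n%:R))).
Proof.
move=> kn e0 th0; have iW := itg_W (ltnW kn); have m0 := m_gt0 kn.
pose c1 := cB R * (4 * eps + 6 / eps ^+ 3 * th).
pose c2 := cB R * (6 / eps ^+ 3 * K0 / th + 20 / eps ^+ 4).
have cB0 := @cB_gt0 R; have K00 : 0 <= K0 by rewrite (le_trans ler01).
have c20 : 0 <= c2.
  rewrite /c2 mulr_ge0 ?(ltW cB0)// addr_ge0//; last by rewrite divr_ge0// exprn_ge0// ltW.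
  by rewrite divr_ge0 ?(ltW th0)// mulr_ge0// divr_ge0// exprn_ge0// ltW.
have [//||Q0 hQ||mb h] := @row_Pr k (fun Q0 r0 => sprod (r0 *m Q0) r0 <= eps ^+ 2)
  (fun Q0 => c1 + c2 * Wf (MF Q0)).
- apply: measurable_fun_ler; last exact: measurable_cst.
  apply: measurable_sprod; last exact: nrow_pair_meas.
  by apply: measurable_mulmx; [exact: nrow_pair_meas|exact: rproj_pair_meas].
- split.
    apply: measurable_fun_ler; last exact: measurable_cst.
    apply: measurable_sprod; last exact: nrowT_meas.
    by apply: measurable_mulmx; [exact: nrowT_meas|move=> ? ?; exact: measurable_cst].
  have [QP tQ] := hQ; have t0 : \tr Q0 != 0 by rewrite tQ gt_eqF.
  have [v [v1 v4 vr]] := unit_in_range QP t0.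
  have := small_ball (row_indep a_indep (Ordinal kn)) K01 (a4i _) (a1 _) (a2 _) (a4 _)
    e0 th0 v1.
  set E := [set w | _ <= eps] => hE.
  have mE : measurable E.
    rewrite -[X in measurable X]setTI; apply: measurable_fun_ler => //.
    apply: measurableT_comp => //; apply: measurable_sum => i.
    by apply: measurable_funM => //; exact: measurable_cst.
  apply: (@le_trans _ _ (Pr P E)).
    apply: le_Pr => //.
      rewrite -[X in measurable X]setTI; apply: measurable_fun_ler => //.
      apply: measurable_sprod; last exact: nrowT_meas.
      by apply: measurable_mulmx; [exact: nrowT_meas|move=> ? ?; exact: measurable_cst].
    move=> w /= hw; rewrite /E/=.
    rewrite -(@ler_pXn2r _ 2)// ?nnegrE ?(ltW e0)// real_normK ?num_real//.
    apply: le_trans hw; apply: le_trans (vr (nrow (Am w) k)).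
    apply: eq_ler; congr (_ ^+ 2).
    by apply: eq_bigr => j _; rewrite (nrow_Am a kn).
  apply: (le_trans hE); rewrite /c1 /c2.
  rewrite [leRHS](_ : _ = cB R * (4 * eps + 6 / eps ^+ 3 * th +
    (6 / eps ^+ 3 * K0 / th + 20 / eps ^+ 4) * Wf (MF Q0))); last by ring.
  rewrite ler_wpM2l ?(ltW cB0)//.
  have V0 : 0 <= \sum_j v j ^+ 4.
    by apply: sumr_ge0 => j _; rewrite exprn_even_ge0.
  rewrite [leLHS](_ : _ = 4 * eps + 6 / eps ^+ 3 * th +
    (6 / eps ^+ 3 * K0 / th + 20 / eps ^+ 4) * \sum_j v j ^+ 4).
    rewrite lerD2l ler_wpM2l// addr_ge0//; last by rewrite divr_ge0// exprn_ge0// ltW.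
    by rewrite divr_ge0 ?(ltW th0)// mulr_ge0// divr_ge0// exprn_ge0// ltW.
  by move: (\sum_j _) => V; field; rewrite !gt_eqF.
- by apply: itgD; [exact: itg_cst|exact: itgZ].
split.
  by rewrite -[X in measurable X]setTI; exact: (mb measurableT [set true]).
apply: (le_trans h); rewrite ExD; [|exact: itg_cst|exact: itgZ].
rewrite Ex_cst ExZ//.
apply: (@le_trans _ _ (c1 + c2 * (DW * m k ^+ 2 / n%:R))).
  by rewrite lerD2l ler_wpM2l// EW_le.
apply: eq_ler.
move: (DW * m k ^+ 2 / n%:R) => V; rewrite /c1 /c2.
by field; rewrite !gt_eqF.
Qed.

Lemma row_meas_past k (F : 'M[R]_n -> 'rV[R]_n -> R) : row_meas k F ->
  measurable_fun setT
    ((fun w => F (rproj (Am w) k) (nrow (Am w) k)) : sigT X (past n k.+1) -> R).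
Proof.
move=> mF; have mid (J K : {set 'I_n * 'I_n}) : J \subset K ->
    measurable_fun setT (id : sigT X K -> sigT X J).
  move=> JK; exact: (@measurable_sigT_sub _ _ _ _ _ X _ (sigT X J) J K id JK).
have mg : measurable_fun setT ((fun w => (w, w)) :
    sigT X (past n k.+1) -> sigT X (past n k) * sigT X (present n k)).
  by apply/measurable_fun_pair; apply: mid; [exact: pastS|exact: presentS].
exact: (measurableT_comp mF mg).
Qed.

Lemma row_sum_meas (D : nat -> 'M[R]_n -> 'rV[R]_n -> R) l :
  (forall k, (k < l)%N -> row_meas k (D k)) ->
  measurable_fun setT ((fun w => \sum_(k < l) D k (rproj (Am w) k) (nrow (Am w) k))
    : sigT X (past n l) -> R).
Proof.
move=> mD; apply: measurable_sum => k.
apply: (@measurable_sigT_sub _ _ _ _ _ X _ _ (past n k.+1) _ _ _ (row_meas_past (mD k _))) => //.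
by apply/fintype.subsetP => ij; rewrite !inE => /leq_trans; apply.
Qed.

(** Orthogonality of martingale increments: with the past frozen, the cross term is a constant times
    a centred variable. *)
Lemma mart_var (D : nat -> 'M[R]_n -> 'rV[R]_n -> R) (B : nat -> 'M[R]_n -> R)
    (b : nat -> R) :
  (forall k, (k < n)%N -> row_meas k (D k)) ->
  (forall k Q, (k < n)%N -> trproj k Q -> let f w := D k Q (nrow (Am w) k) in
    [/\ measurable_fun setT f, itg (fun w => f w ^+ 2), Ex f = 0 &
     Ex (fun w => f w ^+ 2) <= B k Q]) ->
  (forall k, (k < n)%N -> itg (fun w => B k (rproj (Am w) k)) /\
     Ex (fun w => B k (rproj (Am w) k)) <= b k) ->
  forall l, (l <= n)%N ->
  let S w := \sum_(k < l) D k (rproj (Am w) k) (nrow (Am w) k) in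
  itg (fun w => S w ^+ 2) /\ Ex (fun w => S w ^+ 2) <= \sum_(k < l) b k.
Proof.
move=> mD hD hB; elim=> [_ S|l ih ln S].
  rewrite big_ord0 (_ : (fun w => _) = fun=> 0); last first.
    by apply/funext => w; rewrite /S big_ord0 expr0n.
  by rewrite Ex_cst; split => //; exact: itg_cst.
have [iS eS] := ih (ltnW ln).
pose S' w := \sum_(k < l) D k (rproj (Am w) k) (nrow (Am w) k).
have mS' : measurable_fun setT (S' : sigT X (past n l) -> R).
  by apply: row_sum_meas => k kl; apply: mD; exact: ltn_trans ln.
have [iB eB] := hB l ln.
have QT w : trproj l (rproj (Am w) l) by exact: rproj_trproj (ltnW ln).
pose f w w' := D l (rproj (Am w) l) (nrow (Am w') l).
have inner w : itg (fun w' => (S' w + f w w') ^+ 2) /\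
    Ex (fun w' => (S' w + f w w') ^+ 2) = S' w ^+ 2 + Ex (fun w' => f w w' ^+ 2).
  have [mf if2 f0 _] := hD l _ ln (QT w).
  have if1 : itg (f w).
    apply: (@le_itg _ _ _ _ _ (fun w' => 1 + f w w' ^+ 2)) => //.
      move=> w'; rewrite -(real_normK (num_real (f w w'))).
      by have := normr_ge0 (f w w'); nra.
    by apply: itgD => //; exact: itg_cst.
  have e w' : (S' w + f w w') ^+ 2 = (S' w ^+ 2 + 2 * S' w * f w w') + f w w' ^+ 2 by ring.
  have i1 : itg (fun w' => S' w ^+ 2 + 2 * S' w * f w w').
    by apply: itgD; [exact: itg_cst|exact: itgZ].
  rewrite (funext e); split; first exact: itgD.
  rewrite ExD// ExD//; [|exact: itg_cst|exact: itgZ].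
  by rewrite Ex_cst ExZ// f0 mulr0 addr0.
have iSB : itg (fun w => S' w ^+ 2 + B l (rproj (Am w) l)) by exact: itgD.
have le_in w : Ex (fun w' => (S' w + f w w') ^+ 2) <= S' w ^+ 2 + B l (rproj (Am w) l).
  by rewrite (inner w).2 lerD2l; have [] := hD l _ ln (QT w).
have [||||//|_ iE iD eD] := @decoupling_Ex _ _ _ _ _ _ a_indep (past n l) (present n l)
  (fun w w' => (S' w + f w w') ^+ 2) (fun w => S' w ^+ 2 + B l (rproj (Am w) l))
  (@past_present n l).
- apply: measurable_funX; apply: measurable_funD; last exact: mD.
  exact: (measurableT_comp mS').
- by move=> w w'; exact: sqr_ge0.
- by move=> w; exact: (inner w).1.
- exact: le_in.
have SE w : S w ^+ 2 = (S' w + f w w) ^+ 2 by rewrite /S big_ord_recr.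
rewrite (funext SE); split => //; rewrite eD.
apply: (le_trans (le_Ex iE iSB le_in)).
by rewrite ExD// big_ord_recr/= lerD.
Qed.

Definition lind_err (dl sg x : R) : R :=
  3 / dl ^+ 3 * ((2 + cY K0) / (x * Num.sqrt x * sg ^+ 3)) +
  10 / dl ^+ 4 * (2 / (x * sg ^+ 2)) ^+ 2.

(** The last row is replaced first: given the earlier ones, its increment is traded for a
    deterministic increase of [u], and the induction goes on with the larger [u]. The conditional
    variance of [Y_k] falls short of 2/m by 2 W_k/m^2, a random error that enters only through its
    mean. *)
Lemma lindeberg (dl sg c : R) l : 0 < dl -> 0 < sg -> (l <= n)%N ->
  forall u, dl ^+ 2 <= u ->
  `|Ex (fun w => heat c u (\sum_(k < l) Yk k w / sg)) -
    heat c (u + \sum_(k < l) 2 / (m k * sg ^+ 2)) 0| <=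
  \sum_(k < l) (2 * (DW / n%:R) / sg ^+ 2 / dl ^+ 2 + lind_err dl sg (m k)).
Proof.
move=> dl0 sg0; elim: l => [_ u _|l ih ln u ud].
  rewrite !big_ord0 (@eq_Ex _ _ _ _ _ (fun=> heat c u 0)) ?Ex_cst ?addr0 ?subrr ?normr0//.
  by move=> w; rewrite big_ord0.
have m0 := m_gt0 ln.
pose s := 2 / (m l * sg ^+ 2).
have s0 : 0 <= s by rewrite divr_ge0// mulr_ge0 ?exprn_ge0// ltW.
have h := ih (ltnW ln) (u + s) (le_trans ud _).
rewrite lerDl s0 in h; move/(_ isT) : h => h.
rewrite !big_ord_recr/=.
pose S w := \sum_(k < l) Yk k w / sg.
have mS : measurable_fun setT (S : sigT X (past n l) -> R).
  rewrite (_ : S = fun w => \sum_(k < l)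
      (fun Q r => YQ k Q r / sg) (rproj (Am w) k) (nrow (Am w) k))//.
  apply: (@row_sum_meas (fun k Q r => YQ k Q r / sg)) => k kl.
  by apply: measurable_funM; [exact: Y_meas|exact: measurable_cst].
pose f w w' := YQ l (rproj (Am w) l) (nrow (Am w') l) / sg.
pose er := lind_err dl sg (m l).
pose B w := 2 / sg ^+ 2 / dl ^+ 2 * (Wk l w / m l ^+ 2) + er.
have [iW eW] := W_process ln.
have iB : itg B by apply: itgD; [exact: itgZ|exact: itg_cst].
have EB : Ex B <= 2 * (DW / n%:R) / sg ^+ 2 / dl ^+ 2 + er.
  rewrite /B ExD; [|exact: itgZ|exact: itg_cst].
  rewrite Ex_cst lerD2r ExZ//.
  rewrite [leRHS](_ : _ = 2 / sg ^+ 2 / dl ^+ 2 * (DW / n%:R)); last by ring.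
  by rewrite ler_wpM2l// !mulr_ge0// invr_ge0 exprn_ge0// ltW.
have mfw w : measurable_fun setT (f w).
  have [mY _ _ _ _] := row_Y ln (rproj_trproj w (ltnW ln)).
  by apply: measurable_funM => //; exact: measurable_cst.
have hd := @heat_decouple _ _ _ _ _ _ a_indep (past n l) (present n l) c u (u + s) S f B
  (@past_present n l) mS _ mfw iB.
rewrite (@eq_Ex _ _ _ _ _ (fun w => heat c u (S w + f w w))); last first.
  by move=> w; rewrite big_ord_recr.
apply: le_trans (ler_distD (Ex (fun w => heat c (u + s) (S w))) _ _) _.
rewrite -addrA [s + _]addrC in h.
rewrite [leRHS]addrC; apply: lerD; last exact: h.
apply: le_trans EB; apply: hd => [|w].
  by apply: measurable_funM; [exact: Y_meas|exact: measurable_cst].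
have [mY iY4 Y0 Y2 Y4] := row_Y ln (rproj_trproj w (ltnW ln)).
have [iY2 iY] := le_moment2 mY iY4.
(* This weight balances the second moment, of order (m sg^2)^-1, against the fourth, of order (m
   sg^2)^-2; both parts become of order (sqrt m sg)^-3. *)
pose th := (Num.sqrt (m l) * sg)^-1.
have sm0 : 0 < Num.sqrt (m l) by rewrite sqrtr_gt0.
have th0 : 0 < th by rewrite invr_gt0 mulr_gt0.
have e4 w' : f w w' ^+ 4 = sg^-1 ^+ 4 * YQ l (rproj (Am w) l) (nrow (Am w') l) ^+ 4.
  by rewrite /f exprMn mulrC.
have e2 w' : f w w' ^+ 2 = sg^-1 ^+ 2 * YQ l (rproj (Am w) l) (nrow (Am w') l) ^+ 2.
  by rewrite /f exprMn mulrC.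
have if4 : itg (fun w' => f w w' ^+ 4) by rewrite (funext e4); exact: itgZ.
have f0 : Ex (f w) = 0.
  rewrite (_ : f w = fun w' => sg^-1 * YQ l (rproj (Am w) l) (nrow (Am w') l)).
    by rewrite ExZ// Y0 mulr0.
  by apply/funext => w'; rewrite mulrC.
have := heat_step c (S w) dl0 ud s0 th0 (mfw w) if4 f0.
move=> /le_trans; apply.
rewrite (funext e4) (funext e2) !ExZ// Y2.
move: Y4; set y4 := Ex _ => Y4; set W := Wf _.
have W0 : 0 <= W by exact: Wf_ge0.
have Wm : W <= m l by apply: Wf_le; exact: trproj_is_proj (rproj_trproj w (ltnW ln)).
have p1 : `|sg^-1 ^+ 2 * (2 * (m l - W) / m l ^+ 2) - s| / dl ^+ 2 =
    2 / sg ^+ 2 / dl ^+ 2 * (W / m l ^+ 2).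
  rewrite (_ : _ - s = - (2 * W / (m l ^+ 2 * sg ^+ 2))).
    rewrite normrN ger0_norm; first by field; rewrite !gt_eqF.
    by rewrite divr_ge0 ?mulr_ge0 ?exprn_ge0// ltW.
  by rewrite /s; field; rewrite !gt_eqF.
have p2 : th * (sg^-1 ^+ 2 * (2 * (m l - W) / m l ^+ 2)) + sg^-1 ^+ 4 * y4 / th <=
    (2 + cY K0) / (m l * Num.sqrt (m l) * sg ^+ 3).
  have q := Num.sqrt (m l).
  have mq : m l = Num.sqrt (m l) ^+ 2 by rewrite sqr_sqrtr// ltW.
  rewrite [leRHS]mulrDl; apply: lerD.
    apply: (@le_trans _ _ (th * (sg^-1 ^+ 2 * (2 / m l)))).
      rewrite ler_wpM2l ?(ltW th0)// ler_wpM2l ?exprn_ge0 ?invr_ge0 ?(ltW sg0)//.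
      rewrite ler_pdivrMr ?exprn_gt0//.
      rewrite (_ : 2 / m l * m l ^+ 2 = 2 * m l); last by field; rewrite gt_eqF.
      by rewrite ler_wpM2l// gerBl.
    apply: eq_ler; rewrite /th.
    by field; rewrite !gt_eqF.
  apply: (@le_trans _ _ (sg^-1 ^+ 4 * (cY K0 / m l ^+ 2) / th)).
    have thV0 : 0 <= th^-1 by rewrite invr_ge0 ltW.
    have sgV0 : 0 <= sg^-1 ^+ 4 by rewrite exprn_ge0// invr_ge0 ltW.
    by apply: ler_wpM2r => //; exact: ler_wpM2l.
  apply: eq_ler; rewrite /th.
  move: (Num.sqrt (m l)) mq sm0 m0 => t -> t0 _.
  by field; rewrite !gt_eqF.
rewrite p1 /B -addrA lerD2l /er /lind_err -/s lerD2r ler_wpM2l//.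
by rewrite divr_ge0// exprn_ge0// ltW.
Qed.

Hypothesis n0 : (0 < n)%N.
Notation sk k w := (sprod (nrow (Am w) k *m rproj (Am w) k) (nrow (Am w) k)).

Let nR : 0 < n%:R :> R. Proof. by rewrite ltr0n. Qed.
Let K00 : 0 <= K0. Proof. by rewrite (le_trans ler01). Qed.
Let cY0 : 0 <= cY K0.
Proof. by rewrite /cY !mulr_ge0// exprn_ge0. Qed.
Let cT0 : 0 <= cT K0.
Proof. by rewrite /cT mulr_ge0 ?exprn_ge0// mulr_ge0// exprn_ge0// exprn_ge0// mulr_ge0. Qed.
Let DW0 : 0 <= DW := DW_ge0.

Lemma sumZ_var : itg (fun w => (\sum_(k < n) Zk k w) ^+ 2) /\
  Ex (fun w => (\sum_(k < n) Zk k w) ^+ 2) <= K0 * DW.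
Proof.
have [|||i e] := @mart_var (fun k Q r => ZQ k Q r)
  (fun k Q => K0 * (Wf (MF Q) / m k ^+ 2)) (fun=> K0 * (DW / n%:R)) _ _ _ n (leqnn n).
- by move=> k kn; exact: Z_meas.
- move=> k Q kn hQ f; have [i1 i2 e1 e2 _] := row_Z kn hQ.
  by split => //; [exact: itg_meas i1|rewrite mulrA].
- move=> k kn; have [iW eW] := W_process kn.
  by split; [exact: itgZ|rewrite ExZ// ler_wpM2l].
split => //; apply: (le_trans e); rewrite sumr_const card_ord -[leLHS]mulr_natr.
by rewrite -mulrA divfK// gt_eqF.
Qed.

Notation DQ k Q r := (YQ k Q r ^+ 2 - 2 * (m k - Wf (MF Q)) / m k ^+ 2).
Notation Dk k w := (DQ k (rproj (Am w) k) (nrow (Am w) k)).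

(** [D_k] is [Y_k] squared minus its conditional variance. Its own conditional variance is at most
    cY/m^2, which is summable, so the squares may be replaced by their conditional means up to
    O(1). *)
Lemma sumD_var : itg (fun w => (\sum_(k < n) Dk k w) ^+ 2) /\
  Ex (fun w => (\sum_(k < n) Dk k w) ^+ 2) <= 2 * cY K0.
Proof.
have [|||i e] := @mart_var (fun k Q r => DQ k Q r)
  (fun k Q => cY K0 / m k ^+ 2) (fun k => cY K0 / m k ^+ 2) _ _ _ n (leqnn n).
- move=> k kn; apply: measurable_funB; first by apply: measurable_funX; exact: Y_meas.
  apply: measurable_funM; last exact: measurable_cst.
  apply: measurable_funM; first exact: measurable_cst.
  apply: measurable_funB; first exact: measurable_cst.
  by apply: measurable_Wf => i j; exact: rproj_pair_meas.
- move=> k Q kn hQ f; have [mY i4 e1 e2 e4] := row_Y kn hQ.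
  have [i2 i1] := le_moment2 mY i4.
  have mf : measurable_fun setT f.
    by apply: measurable_funB; [exact: measurable_funX|exact: measurable_cst].
  rewrite /f; move: e2; set c := 2 * _ / _ => e2.
  have fE w : (YQ k Q (nrow (Am w) k) ^+ 2 - c) ^+ 2 =
    YQ k Q (nrow (Am w) k) ^+ 4 - 2 * c * YQ k Q (nrow (Am w) k) ^+ 2 + c ^+ 2 by ring.
  have if2 : itg (fun w => YQ k Q (nrow (Am w) k) ^+ 4 - 2 * c * YQ k Q (nrow (Am w) k) ^+ 2).
    by apply: itgB => //; exact: itgZ.
  split => //.
  + by rewrite (funext fE); apply: itgD => //; exact: itg_cst.
  + by rewrite ExB ?Ex_cst ?e2 ?subrr//; exact: itg_cst.
  + rewrite (funext fE) ExD//; last exact: itg_cst.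
    rewrite ExB//; last exact: itgZ.
    rewrite ExZ// e2 Ex_cst; apply: le_trans e4.
    by have := sqr_ge0 c; set y4 := Ex _; nra.
- by move=> k kn; rewrite Ex_cst; split => //; exact: itg_cst.
split => //; apply: (le_trans e).
rewrite (sum_rev (fun j => cY K0 / j%:R ^+ 2)) -mulr_sumr mulrC ler_wpM2r//.
exact: sum_inv_sqr.
Qed.

(** * The exceptional event and the expansion of the determinant outside it *)

Section exceptional.
Variables (M : nat) (eps : R).
Hypotheses (M0 : (0 < M)%N) (eps0 : 0 < eps).

Notation small k := ((n - k <= M)%N%:R : R).
Notation th k := (Num.sqrt (m k) / Num.sqrt n%:R).

(** The weight t = sqrt(m/n) balances t E Y^2 <= 2 t/m against E Z^2/t = O(1/(n t)): both are
    O(1/sqrt(m n)), with bounded sum over the rows. Likewise the weight sqrt m turns |Y|^3 into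
    terms with mean O(m^(-3/2)). [small] marks the last [M] rows, where the square of Y + Z has to
    be paid for in full. *)
Definition al (k : nat) : R := th k + (Num.sqrt (m k))^-1 + small k.
Definition be (k : nat) : R := (th k)^-1 + 1 + small k.

Definition step_bound (k : nat) (w : T) : R :=
  al k * Yk k w ^+ 2 + be k * Zk k w ^+ 2 + Wk k w / m k ^+ 2 +
  Num.sqrt (m k) * Yk k w ^+ 4.

Definition total_bound (w : T) : R :=
  (\sum_(k < n) Zk k w) ^+ 2 + (\sum_(k < n) Dk k w) ^+ 2 +
  \sum_(k < n) step_bound k w.

Let al_ge0 k : (k < n)%N -> 0 <= al k.
Proof.
by move=> kn; rewrite !addr_ge0 ?divr_ge0 ?invr_ge0 ?sqrtr_ge0.
Qed.

Let be_ge0 k : (k < n)%N -> 0 <= be k.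
Proof.
by move=> kn; rewrite !addr_ge0 ?invr_ge0 ?divr_ge0 ?sqrtr_ge0.
Qed.

Lemma step_bound_ge0 k w : (k < n)%N -> 0 <= step_bound k w.
Proof.
move=> kn; rewrite !addr_ge0//.
- by rewrite mulr_ge0 ?al_ge0 ?sqr_ge0.
- by rewrite mulr_ge0 ?be_ge0 ?sqr_ge0.
- by rewrite divr_ge0 ?Wf_ge0 ?sqr_ge0.
- by rewrite mulr_ge0 ?sqrtr_ge0// exprn_even_ge0.
Qed.

Lemma sum_small : \sum_(k < n) small k <= M%:R.
Proof.
rewrite (sum_rev (fun j => (j <= M)%N%:R)) -natr_sum ler_nat.
have [nM|Mn] := leqP n M.
  apply: leq_trans nM; rewrite -[leqRHS]card_ord -sum1_card.
  by apply: leq_sum => i _; exact: leq_b1.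
rewrite -(subnKC (ltnW Mn)) big_split_ord/=.
rewrite [X in (_ + X)%N]big1 ?addn0 => [|i _]; last by rewrite ltnNge leq_addr.
by rewrite -[leqRHS]card_ord -sum1_card; apply: leq_sum => i _; exact: leq_b1.
Qed.

Lemma sum_inv_sqrt_n : \sum_(k < n) (Num.sqrt (m k) * Num.sqrt n%:R)^-1 <= 2.
Proof.
have sn : 0 < Num.sqrt n%:R :> R by rewrite sqrtr_gt0.
rewrite (sum_rev (fun j => (Num.sqrt j%:R * Num.sqrt n%:R)^-1)).
under eq_bigr do rewrite invfM.
rewrite -mulr_suml ler_pdivrMr//; exact: sum_inv_sqrt.
Qed.

Definition CV : R := 10 + 5 * (K0 * DW) + DW + 5 * cY K0 + 2 * M%:R.

Lemma step_bound_Ex k : (k < n)%N -> itg (step_bound k) /\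
  Ex (step_bound k) <= 2 * (Num.sqrt (m k) * Num.sqrt n%:R)^-1 +
    2 * (m k * Num.sqrt (m k))^-1 + 2 * small k +
    (K0 * DW) * (Num.sqrt (m k) * Num.sqrt n%:R)^-1 + 2 * (K0 * DW) / n%:R +
    DW / n%:R + cY K0 * (m k * Num.sqrt (m k))^-1.
Proof.
move=> kn; have m0 := m_gt0 kn; have m1 := m_ge1 kn.
have [iY4 eY4 iY2 eY2] := Y_process kn.
have [iZ2 eZ2] := Z_process kn.
have [iW eW] := W_process kn.
have j1 : itg (fun w => al k * Yk k w ^+ 2) by exact: itgZ.
have j2 : itg (fun w => be k * Zk k w ^+ 2) by exact: itgZ.
have j4 : itg (fun w => Num.sqrt (m k) * Yk k w ^+ 4) by exact: itgZ.
have j12 := itgD j1 j2; have j123 := itgD j12 iW.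
split; first exact: itgD.
rewrite /step_bound (ExD j123 j4) (ExD j12 iW) (ExD j1 j2) !ExZ//.
have sm : 0 < Num.sqrt (m k) by rewrite sqrtr_gt0.
have sn : 0 < Num.sqrt n%:R :> R by rewrite sqrtr_gt0.
have mE : m k = Num.sqrt (m k) ^+ 2 by rewrite sqr_sqrtr// ltW.
have nE : n%:R = Num.sqrt n%:R ^+ 2 :> R by rewrite sqr_sqrtr// ltW.
have b1 : al k * Ex (fun w => Yk k w ^+ 2) <=
   2 * (Num.sqrt (m k) * Num.sqrt n%:R)^-1 + 2 * (m k * Num.sqrt (m k))^-1 + 2 * small k.
  apply: (@le_trans _ _ (al k * (2 / m k))); first by rewrite ler_wpM2l ?al_ge0.
  rewrite [al k * _]mulrDl [(th k + _) * _]mulrDl; apply: lerD; first apply: lerD.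
  - apply: eq_ler.
    move: (Num.sqrt (m k)) mE sm => t -> t0; by field; rewrite !gt_eqF.
  - apply: eq_ler.
    by field; rewrite !gt_eqF.
  - rewrite [leLHS]mulrC; apply: ler_wpM2r => //.
    by rewrite ler_pdivrMr// ler_peMr.
have b2 : be k * Ex (fun w => Zk k w ^+ 2) <=
   (K0 * DW) * (Num.sqrt (m k) * Num.sqrt n%:R)^-1 + 2 * (K0 * DW) / n%:R.
  apply: (@le_trans _ _ (be k * (K0 * DW / n%:R))); first by rewrite ler_wpM2l ?be_ge0.
  rewrite /be -addrA [X in X <= _]mulrDl; apply: lerD.
    apply: eq_ler.
    move: (Num.sqrt n%:R) nE sn => t -> t0.
    by field; rewrite !gt_eqF.
  rewrite -[X in _ <= X]mulrA; apply: ler_wpM2r.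
    by apply: divr_ge0; [exact: mulr_ge0|exact: ltW].
  by case: (_ <= _)%N => /=; lra.
have b4 : Num.sqrt (m k) * Ex (fun w => Yk k w ^+ 4) <= cY K0 * (m k * Num.sqrt (m k))^-1.
  apply: (@le_trans _ _ (Num.sqrt (m k) * (cY K0 / m k ^+ 2))).
    by rewrite ler_wpM2l ?sqrtr_ge0.
  apply: eq_ler.
  move: (Num.sqrt (m k)) mE sm => t -> t0; by field; rewrite !gt_eqF.
apply: le_trans (lerD (lerD (lerD b1 b2) eW) b4) _.
by rewrite !addrA.
Qed.

Lemma total_bound_Ex : itg total_bound /\ Ex total_bound <= CV.
Proof.
have [iZ eZ] := sumZ_var; have [iD eD] := sumD_var.
have iS : itg (fun w => \sum_(k < n) step_bound k w).
  by apply: itg_sum => k _; exact: (step_bound_Ex (ltn_ord k)).1.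
have iZD := itgD iZ iD.
split; first exact: itgD.
rewrite /total_bound (ExD iZD iS) (ExD iZ iD).
have eS : Ex (fun w => \sum_(k < n) step_bound k w) <=
   2 * 2 + 2 * 3 + 2 * M%:R + (K0 * DW) * 2 + 2 * (K0 * DW) + DW + cY K0 * 3.
  rewrite Ex_sum; last by move=> k _; exact: (step_bound_Ex (ltn_ord k)).1.
  apply: (le_trans (ler_sum _ (fun (k : 'I_n) _ => (step_bound_Ex (ltn_ord k)).2))).
  have cst (c : R) : \sum_(k < n) c / n%:R = c.
    by rewrite sumr_const card_ord -[LHS]mulr_natr divfK// gt_eqF.
  have s32 : \sum_(k < n) (m k * Num.sqrt (m k))^-1 <= 3.
    rewrite (sum_rev (fun j => (j%:R * Num.sqrt j%:R)^-1)); exact: sum_inv_32.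
  rewrite !big_split/= !cst -!mulr_sumr.
  have KD : 0 <= K0 * DW by rewrite mulr_ge0.
  by do ! apply: lerD => //; rewrite ler_wpM2l// ?sum_small ?sum_inv_sqrt_n.
rewrite /CV; move: eZ eD eS.
set x1 := Ex _; set x2 := Ex _; set x3 := Ex _.
move: (K0 * DW) (DW) (cY K0) => t1 t2 t3; lra.
Qed.

(** In the last [M] rows [Y] and [Z] are not small with high probability, so there only a lower
    bound on the distance is asked for. *)
Definition bad_row (k : nat) : set T :=
  if (M < n - k)%N then [set w | 4^-1 <= `|Yk k w|] `|` [set w | 1 + Zk k w <= 2^-1]
  else [set w | sk k w <= eps ^+ 2].

Definition Ceps : R := 2 * (3 / eps ^+ 3 * (1 + K0 * DW * M%:R ^+ 2) +
  10 / eps ^+ 4 * (DW * M%:R ^+ 2)).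

Lemma bad_row_Pr k : (k < n)%N -> measurable (bad_row k) /\
  Pr P (bad_row k) <= (M < n - k)%N%:R * (4 ^+ 4 * cY K0 / m k ^+ 2) +
    cT K0 * DW / n%:R * (Num.sqrt (m k))^-1 +
    small k * (cB R * (4 * eps + Ceps / Num.sqrt n%:R)).
Proof.
move=> kn; have m0 := m_gt0 kn; have m1 := m_ge1 kn.
have sm : 0 < Num.sqrt (m k) by rewrite sqrtr_gt0.
have sn : 0 < Num.sqrt n%:R :> R by rewrite sqrtr_gt0.
have n1 : 1 <= n%:R :> R by rewrite ler1n.
have nE : n%:R = Num.sqrt n%:R ^+ 2 :> R by rewrite sqr_sqrtr// ltW.
have s1 : 1 <= Num.sqrt n%:R :> R by rewrite -[leLHS]sqrtr1 ler_wsqrtr.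
have t0 : 0 <= cT K0 * DW / n%:R * (Num.sqrt (m k))^-1.
  apply: mulr_ge0; last by rewrite invr_ge0 ltW.
  by apply: divr_ge0; [exact: mulr_ge0|exact: ltW].
have cB0 := @cB_gt0 R.
rewrite /bad_row [(_ <= M)%N]leqNgt; case: (ltnP M (n - k)) => Mk /=; last first.
  (* In these rows W_k has mean O(1/n), so with weight 1/sqrt n both the weight and W_k divided by
     it are of order 1/sqrt n. *)
  have [mB pB] := @dist_small_ball k eps
    (Num.sqrt n%:R)^-1 kn eps0 (etrans (invr_gt0 _) sn).
  split => //; rewrite mul0r add0r mul1r.
  apply: le_trans pB _; apply: (@le_trans _ _ (cB R * (4 * eps + Ceps / Num.sqrt n%:R))).
    2: by rewrite lerDr.
  have mM : m k ^+ 2 <= M%:R ^+ 2 by rewrite lerXn2r ?nnegrE ?ler0n// ler_nat.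
  have V0 : 0 <= DW * M%:R ^+ 2 by apply: mulr_ge0 => //; exact: sqr_ge0.
  have U : DW * m k ^+ 2 / n%:R <= DW * M%:R ^+ 2 / n%:R.
    by apply: ler_wpM2r; [rewrite invr_ge0 ltW|exact: ler_wpM2l].
  have e3 : 0 <= 3 / eps ^+ 3 by apply: divr_ge0 => //; apply: exprn_ge0; exact: ltW.
  have e4 : 0 <= 10 / eps ^+ 4 by apply: divr_ge0 => //; apply: exprn_ge0; exact: ltW.
  apply: ler_wpM2l; first exact: ltW.
  rewrite lerD2l /Ceps -[X in _ <= X]mulrA; apply: ler_wpM2l => //.
  rewrite [X in _ <= X]mulrDl invrK; apply: lerD.
    rewrite -[X in _ <= X]mulrA; apply: ler_wpM2l => //.
    rewrite [X in _ <= X]mulrDl mul1r lerD2l.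
    apply: (@le_trans _ _ (K0 * (DW * M%:R ^+ 2 / n%:R) * Num.sqrt n%:R)).
      by apply: ler_wpM2r; [exact: ltW|exact: ler_wpM2l].
    apply: eq_ler.
    by move: (Num.sqrt n%:R) nE sn => t -> t00; field; rewrite gt_eqF.
  rewrite -[X in _ <= X]mulrA; apply: ler_wpM2l => //.
  apply: (le_trans U); apply: ler_wpM2l => //.
  by rewrite lef_pV2 ?posrE// {2}nE expr2 ler_peMl// ltW.
have [iY4 eY4 iY2 eY2] := Y_process kn.
have [mZ pZ] := Z_tail kn.
have mY : measurable_fun setT (fun w => Yk k w).
  apply: measurable_Yf; [move=> i j; exact: rprojT_meas|move=> i; exact: nrowT_meas].
have mE : measurable [set w | 4^-1 <= `|Yk k w|].
  rewrite -[X in measurable X]setTI; apply: measurable_fun_ler => //.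
  exact: measurableT_comp.
split; first exact: measurableU.
apply: (le_trans (PrU _ mE mZ)); rewrite mul1r mul0r addr0; apply: lerD.
  have y4 w : 0 <= Yk k w ^+ 4 by rewrite exprn_even_ge0.
  have := @markov_Ex _ _ _ P _ _ (4^-1 ^+ 4) _ mE iY4 y4.
  move=> /(_ _ _)/le_trans; apply.
  - by rewrite exprn_gt0.
  - move=> w /= h; have -> : Yk k w ^+ 4 = `|Yk k w| ^+ 4.
      by rewrite -normrX ger0_norm.
    by rewrite lerXn2r// nnegrE.
  by rewrite exprVn invrK mulrC -mulrA ler_wpM2l ?exprn_ge0.
apply: (le_trans pZ); rewrite [X in X <= _](_ : _ = cT K0 * DW / n%:R * (m k)^-1); last first.
  by field; rewrite !gt_eqF.
apply: ler_wpM2l; first by apply: divr_ge0; [exact: mulr_ge0|exact: ltW].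
have sm1 : 1 <= Num.sqrt (m k) by rewrite -[leLHS]sqrtr1 ler_wsqrtr.
have mE2 : m k = Num.sqrt (m k) ^+ 2 by rewrite sqr_sqrtr// ltW.
by rewrite lef_pV2 ?posrE// [leRHS]mE2 expr2 ler_peMl// ltW.
Qed.

Definition bad : set T := \big[setU/set0]_(k < n) bad_row k.

(** The terms stem from large values of [Y], where the tail of the sum of 1/m^2 gives 1/M, from low
    values of [Z], and from the last [M] rows. As n grows only 1/M and M eps remain, so [eps] has to
    be chosen after [M]. *)
Lemma bad_Pr : measurable bad /\
  Pr P bad <= 4 ^+ 4 * cY K0 / M%:R + 2 * (cT K0 * DW) / Num.sqrt n%:R +
    M%:R * (cB R * (4 * eps + Ceps / Num.sqrt n%:R)).
Proof.
have sn : 0 < Num.sqrt n%:R :> R by rewrite sqrtr_gt0.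
have mb k : (k < n)%N -> measurable (bad_row k) by move=> /bad_row_Pr[].
split; first by apply: bigsetU_measurable => k _; exact: mb.
have hb : Pr P bad <= \sum_(k < n) Pr P (bad_row k).
  rewrite /bad (eq_bigr (fun k : 'I_n => if (k < n)%N then bad_row k else set0)); last first.
    by move=> k _; rewrite ltn_ord.
  apply: (le_trans (Pr_bigU _ _ _ _)) => [k|]; first by case: ifP => // /mb.
  by apply: ler_sum => k _; rewrite ltn_ord.
apply: (le_trans hb).
apply: (le_trans (ler_sum _ (fun (k : 'I_n) _ => (bad_row_Pr (ltn_ord k)).2))).
rewrite !big_split/=; apply: lerD; first apply: lerD.
- rewrite (sum_rev (fun j => (M < j)%N%:R * (4 ^+ 4 * cY K0 / j%:R ^+ 2))).
  rewrite (eq_bigr (fun i : 'I_n => if (M <= i)%N then 4 ^+ 4 * cY K0 * (i.+1%:R ^+ 2)^-1 else 0)).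
    rewrite -big_mkcond/= -mulr_sumr ler_wpM2l//.
      by rewrite mulr_ge0// exprn_ge0.
    exact: sum_inv_sqr_tail.
  by move=> i _; rewrite ltnS; case: leqP; rewrite ?mul1r ?mul0r.
- rewrite (sum_rev (fun j => cT K0 * DW / n%:R * (Num.sqrt j%:R)^-1)) -mulr_sumr.
  apply: (@le_trans _ _ (cT K0 * DW / n%:R * (2 * Num.sqrt n%:R))).
    apply: ler_wpM2l; last exact: sum_inv_sqrt.
    by apply: divr_ge0; [exact: mulr_ge0|exact: ltW].
  have nE : n%:R = Num.sqrt n%:R ^+ 2 :> R by rewrite sqr_sqrtr// ltW.
  apply: eq_ler.
  by move: (Num.sqrt n%:R) nE sn => t -> t0; field; rewrite gt_eqF.
- have e3 : 0 <= 3 / eps ^+ 3 by apply: divr_ge0 => //; apply: exprn_ge0; exact: ltW.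
  have e4 : 0 <= 10 / eps ^+ 4 by apply: divr_ge0 => //; apply: exprn_ge0; exact: ltW.
  have V0 : 0 <= DW * M%:R ^+ 2 by apply: mulr_ge0 => //; exact: sqr_ge0.
  rewrite -mulr_suml; apply: ler_wpM2r; last exact: sum_small.
  apply: mulr_ge0; first by apply: ltW; exact: cB_gt0.
  apply: addr_ge0; first by apply: mulr_ge0 => //; exact: ltW.
  apply: divr_ge0; last exact: ltW.
  apply: mulr_ge0 => //; apply: addr_ge0; apply: mulr_ge0 => //.
  by apply: addr_ge0 => //; rewrite -mulrA mulr_ge0.
Qed.

Lemma skE k w : (k < n)%N -> sk k w = m k * (1 + (Yk k w + Zk k w)).
Proof.
move=> kn; have m0 := m_gt0 kn.
have m0' : m k != 0 by rewrite gt_eqF.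
have [_ _ tr] := rproj_proj w (ltnW kn).
have := xfE (fun i => nrow (Am w) k 0 i) m0' tr; rewrite xf_sprod -addrA => <-.
by rewrite mulrC divfK.
Qed.

Definition logL : R := `|ln (eps ^+ 2 / M%:R)|.

Lemma good_step k w : (k < n)%N -> ~ bad_row k w ->
  0 < 1 + (Yk k w + Zk k w) /\
  `|ln (1 + (Yk k w + Zk k w)) - (Yk k w + Zk k w) + (Yk k w + Zk k w) ^+ 2 / 2| +
   `|Yk k w * Zk k w| + Zk k w ^+ 2 / 2 + Wk k w / m k ^+ 2 <=
   33 * step_bound k w + small k * (1 + logL).
Proof.
move=> kn; have m0 := m_gt0 kn; have sm : 0 < Num.sqrt (m k) by rewrite sqrtr_gt0.
have sn : 0 < Num.sqrt n%:R :> R by rewrite sqrtr_gt0.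
have t0 : 0 < Num.sqrt (m k) / Num.sqrt n%:R by rewrite divr_gt0.
have W0 : 0 <= Wk k w / m k ^+ 2 by rewrite divr_ge0 ?Wf_ge0 ?sqr_ge0.
rewrite /bad_row /step_bound /al /be [(_ <= M)%N]leqNgt; case: ltnP => Mk /= nb.
  have /not_orP[/= nY nZ] := nb.
  have y4 : `|Yk k w| <= 4^-1 by rewrite leNgt; apply/negP => /ltW.
  have z2 : - 2^-1 <= Zk k w.
    rewrite leNgt; apply/negP => h; apply: nZ; move: h; lra.
  split.
    by move: y4; rewrite ler_norml => /andP[y1 y2]; move: y1 z2; lra.
  rewrite mul0r addr0 !addr0; exact: step_expansion_large.
have x0 : 0 < 1 + (Yk k w + Zk k w).
  have : eps ^+ 2 < sk k w by rewrite ltNge; apply/negP.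
  by move=> /(lt_trans (exprn_gt0 2 eps0)); rewrite skE// pmulr_rgt0.
have xL : - logL <= ln (1 + (Yk k w + Zk k w)).
  have h : eps ^+ 2 / M%:R <= 1 + (Yk k w + Zk k w).
    have MR : 0 < M%:R :> R by rewrite ltr0n.
    have : eps ^+ 2 <= sk k w by rewrite leNgt; apply/negP => /ltW.
    rewrite skE// => h; rewrite ler_pdivrMr// mulrC; apply: (le_trans h).
    by apply: ler_wpM2r; [exact: ltW|rewrite ler_nat].
  have e0 : 0 < eps ^+ 2 / M%:R by rewrite divr_gt0 ?exprn_gt0 ?ltr0n.
  apply: (@le_trans _ _ (ln (eps ^+ 2 / M%:R))); first by rewrite lerNl ler_normr lexx orbT.
  by rewrite ler_ln ?posrE.
split => //; rewrite mul1r; apply: step_expansion_small => //; exact: normr_ge0.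
Qed.

Lemma norm_le_1D_sqr (x : R) : `|x| <= 1 + x ^+ 2.
Proof.
have := sqr_ge0 (`|x| - 1); rewrite -(real_normK (num_real x)).
by move: `|x| => t; nra.
Qed.

Lemma good_log_det w : ~ bad w ->
  \det (Am w) != 0 /\
  `|2 * ln `|\det (Am w)| - ln (n`!)%:R - \sum_(k < n) Yk k w + \sum_(k < n) (m k)^-1| <=
   2 + M%:R * (1 + logL) + 33 * total_bound w.
Proof.
move=> nb.
have good k : (k < n)%N -> ~ bad_row k w.
  move=> kn hk; apply: nb; rewrite /bad -bigcup_mkord; by exists k.
have s0 (k : 'I_n) : 0 < sk k w.
  have kn := ltn_ord k; have [x0 _] := good_step kn (good _ kn).
  by rewrite skE// mulr_gt0// m_gt0.
have d2 : 0 < \det (Am w) ^+ 2 by rewrite det_sqr prodr_gt0.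
have d0 : \det (Am w) != 0 by apply: contraTneq d2 => ->; rewrite expr0n/= ltxx.
split => //.
have lnprod (F : 'I_n -> R) : (forall k, 0 < F k) -> ln (\prod_k F k) = \sum_k ln (F k).
  move=> F0; have : forall s : seq 'I_n, 0 < \prod_(k <- s) F k /\
     ln (\prod_(k <- s) F k) = \sum_(k <- s) ln (F k).
    elim=> [|i s [p0 e]]; first by rewrite !big_nil ln1.
    by rewrite !big_cons lnM ?posrE// e mulr_gt0.
  by move=> /(_ (index_enum _))[].
have e1 : 2 * ln `|\det (Am w)| = \sum_(k < n) ln (sk k w).
  rewrite -lnprod// -det_sqr -(real_normK (num_real (\det (Am w)))) lnXn ?normr_gt0//.
  by rewrite mulr_natl.
have e2 : ln (n`!)%:R = \sum_(k < n) ln (m k) :> R.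
  rewrite (sum_rev (fun j => ln j%:R)); move: (n); elim=> [|l ih].
    by rewrite fact0 ln1 big_ord0.
  by rewrite big_ord_recr/= -ih factS natrM lnM ?posrE ?ltr0n ?fact_gt0// addrC.
rewrite e1 e2 -!sumrB -big_split/=.
pose rho k := ln (1 + (Yk k w + Zk k w)) - (Yk k w + Zk k w) + (Yk k w + Zk k w) ^+ 2 / 2.
(* Here -Y^2/2 is rewritten as -D/2 - 1/m + W/m^2. This isolates the deterministic drift and leaves
   the two martingale sums and a remainder bounded by [good_step]. *)
have eS (k : 'I_n) : ln (sk k w) - ln (m k) - Yk k w + (m k)^-1 =
  Zk k w - Dk k w / 2 + (rho k - Yk k w * Zk k w - Zk k w ^+ 2 / 2 + Wk k w / m k ^+ 2).
  have kn := ltn_ord k; have [x0 _] := good_step kn (good _ kn).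
  have m0 := m_gt0 kn; rewrite skE// lnM ?posrE// /rho.
  move: (ln (1 + (Yk k w + Zk k w))) (ln (m k)) => l l'.
  move: (Yk k w) (Zk k w) (Wk k w) => y z W.
  by move: (m k) m0 => mk mk0; field; rewrite gt_eqF.
rewrite (eq_bigr _ (fun k _ => eS k)) big_split/= sumrB -mulr_suml.
have h3 : `|\sum_(k < n) (rho k - Yk k w * Zk k w - Zk k w ^+ 2 / 2 + Wk k w / m k ^+ 2)| <=
   33 * \sum_(k < n) step_bound k w + M%:R * (1 + logL).
  apply: (le_trans (ler_norm_sum _ _ _)).
  apply: (@le_trans _ _ (\sum_(k < n) (33 * step_bound k w + small k * (1 + logL)))).
    apply: ler_sum => k _; have kn := ltn_ord k; have [_] := good_step kn (good _ kn).
    apply: le_trans; apply: (le_trans (ler_normD _ _)); apply: lerD; last first.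
      by rewrite ger0_norm// divr_ge0 ?Wf_ge0 ?sqr_ge0.
    apply: (le_trans (ler_normB _ _)); apply: lerD; last first.
      by rewrite ger0_norm// divr_ge0 ?sqr_ge0.
    exact: ler_normB.
  rewrite big_split/= -mulr_sumr -mulr_suml lerD2l; apply: ler_wpM2r.
    by rewrite addr_ge0// normr_ge0.
  exact: sum_small.
have h1 := norm_le_1D_sqr (\sum_(k < n) Zk k w).
have h2 := norm_le_1D_sqr (\sum_(k < n) Dk k w).
apply: (le_trans (ler_normD _ _)); apply: (le_trans (lerD (ler_normB _ _) h3)).
rewrite normrM [`|2^-1|]ger0_norm// /total_bound.
have q1 := sqr_ge0 (\sum_(k < n) Zk k w); have q2 := sqr_ge0 (\sum_(k < n) Dk k w).
move: h1 h2 q1 q2; move: (_ ^+ 2) => z2; move: (_ ^+ 2) => D2.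
move: `|_| => z; move: `|_| => D; move: (\sum_(k < n) _) (M%:R * _) => s q.
lra.
Qed.

End exceptional.

(** * Distance to the normal distribution function for fixed n *)

Hypothesis sg1 : 1 <= sigma R n.
Notation sg := (sigma R n).

Let sg0 : 0 < sg. Proof. by rewrite (lt_le_trans ltr01). Qed.

Let normalized_sum (w : T) : R := \sum_(k < n) Yk k w / sg.

Let mT : measurable_fun setT normalized_sum.
Proof.
apply: measurable_sum => k; apply: measurable_funM; last exact: measurable_cst.
by apply: measurable_Yf; [move=> i j; exact: rprojT_meas|move=> i; exact: nrowT_meas].
Qed.

Definition Clind (dl : R) : R :=
  2 * DW / dl ^+ 2 + 9 * (2 + cY K0) / dl ^+ 3 + 80 / dl ^+ 4.

Let sgV j : (0 < j)%N -> (sg ^+ j)^-1 <= sg^-1.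
Proof.
by case: j => // j _; rewrite lef_pV2 ?posrE ?exprn_gt0// exprS ler_peMr ?exprn_ege1 ?(ltW sg0).
Qed.

Lemma lind_sum_le (dl : R) : 0 < dl ->
  \sum_(k < n) (2 * (DW / n%:R) / sg ^+ 2 / dl ^+ 2 + lind_err dl sg (m k)) <=
  Clind dl / sg.
Proof.
move=> dl0; have d2 : 0 < dl ^+ 2 by rewrite exprn_gt0.
have d3 : 0 < dl ^+ 3 by rewrite exprn_gt0.
have d4 : 0 < dl ^+ 4 by rewrite exprn_gt0.
rewrite big_split/= sumr_const card_ord.
have -> : 2 * (DW / n%:R) / sg ^+ 2 / dl ^+ 2 *+ n = 2 * DW / dl ^+ 2 * (sg ^+ 2)^-1.
  by rewrite -[LHS]mulr_natr; field; rewrite !gt_eqF.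
rewrite /Clind -[X in _ <= X / _]addrA [X in _ <= X]mulrDl; apply: lerD.
  by apply: ler_wpM2l; [apply: divr_ge0; [exact: mulr_ge0|exact: ltW]|exact: sgV].
have cY2 : 0 <= 2 + cY K0 by rewrite addr_ge0.
rewrite /lind_err big_split/= [X in _ <= X]mulrDl; apply: lerD.
  have -> : \sum_(k < n) 3 / dl ^+ 3 * ((2 + cY K0) / (m k * Num.sqrt (m k) * sg ^+ 3)) =
     3 / dl ^+ 3 * (2 + cY K0) * (sg ^+ 3)^-1 * \sum_(k < n) (m k * Num.sqrt (m k))^-1.
    rewrite mulr_sumr; apply: eq_bigr => k _; have m0 := m_gt0 (ltn_ord k).
    have sm0 : 0 < Num.sqrt (m k) by rewrite sqrtr_gt0.
    by move: (m k) (Num.sqrt _) m0 sm0 => x s x0 s0; field; rewrite !gt_eqF.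
  have s3 : \sum_(k < n) (m k * Num.sqrt (m k))^-1 <= 3.
    by rewrite (sum_rev (fun j => (j%:R * Num.sqrt j%:R)^-1)); exact: sum_inv_32.
  have c0 : 0 <= 3 / dl ^+ 3 * (2 + cY K0).
    by apply: mulr_ge0 => //; apply: divr_ge0 => //; exact: ltW.
  apply: (@le_trans _ _ (3 / dl ^+ 3 * (2 + cY K0) * sg^-1 * 3)).
    apply: ler_pM => //; last exact: ler_wpM2l (sgV _).
      by apply: mulr_ge0 => //; rewrite invr_ge0 exprn_ge0// ltW.
    by apply: sumr_ge0 => k _; rewrite invr_ge0 mulr_ge0 ?sqrtr_ge0.
  by apply: eq_ler; field; rewrite !gt_eqF.
have -> : \sum_(k < n) 10 / dl ^+ 4 * (2 / (m k * sg ^+ 2)) ^+ 2 =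
   40 / dl ^+ 4 * (sg ^+ 4)^-1 * \sum_(k < n) (m k ^+ 2)^-1.
  rewrite mulr_sumr; apply: eq_bigr => k _; have m0 := m_gt0 (ltn_ord k).
  by move: (m k) m0 => x x0; field; rewrite !gt_eqF.
have s2 : \sum_(k < n) (m k ^+ 2)^-1 <= 2.
  by rewrite (sum_rev (fun j => (j%:R ^+ 2)^-1)); exact: sum_inv_sqr.
have c0 : 0 <= 40 / dl ^+ 4 by apply: divr_ge0 => //; exact: ltW.
apply: (@le_trans _ _ (40 / dl ^+ 4 * sg^-1 * 2)).
  apply: ler_pM => //; last exact: ler_wpM2l (sgV _).
    by apply: mulr_ge0 => //; rewrite invr_ge0 exprn_ge0// ltW.
  by apply: sumr_ge0 => k _; rewrite invr_ge0 sqr_ge0.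
by apply: eq_ler; field; rewrite !gt_eqF.
Qed.

Let harmonic : R := \sum_(k < n) (m k)^-1.

Lemma inv_sum_bounds : ln n%:R <= harmonic /\ harmonic <= 1 + ln n%:R.
Proof.
rewrite /harmonic (sum_rev (fun j => (j%:R : R)^-1)); split; last exact: harmonic_upper.
apply: (le_trans _ (harmonic_lower R n)); rewrite ler_ln ?posrE ?ltr0n// ler_nat.
exact: leqnSn.
Qed.

Let total_var : R := \sum_(k < n) 2 / (m k * sg ^+ 2).

(** The total increase of [u] is the n-th harmonic number divided by ln n, hence 1 + O(1/ln n). *)
Lemma total_var_bounds : 1 <= total_var /\ total_var <= 1 + 2 / sg.
Proof.
have vE : total_var = 2 * harmonic / sg ^+ 2.
  rewrite /total_var /harmonic mulr_sumr mulr_suml; apply: eq_bigr => k _.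
  by have m0 := m_gt0 (ltn_ord k); move: (m k) m0 => x x0; field; rewrite !gt_eqF.
have s2 : 0 < sg ^+ 2 by rewrite exprn_gt0.
have [h1 h2] := inv_sum_bounds; have sE := sigma_sqr R n0.
rewrite vE; split.
  by rewrite ler_pdivlMr// mul1r sE ler_wpM2l.
apply: (@le_trans _ _ (1 + 2 * (sg ^+ 2)^-1)).
  rewrite ler_pdivrMr// [leRHS]mulrDl mul1r mulfVK ?gt_eqF// sE; move: h2; lra.
by rewrite lerD2l ler_wpM2l// sgV.
Qed.

Lemma heat_limit (x t dl : R) : 0 < dl -> 
  `|heat (x + t) (dl ^+ 2 + total_var) 0 - Phi x| <= `|t| + `|x| * (dl ^+ 2 + 2 / sg).
Proof.
move=> dl0; have [v1 v2] := total_var_bounds.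
have s1 : 1 <= Num.sqrt (dl ^+ 2 + total_var).
  by rewrite -[leLHS]sqrtr1 ler_wsqrtr// (le_trans v1)// lerDr sqr_ge0.
rewrite /heat subr0; apply: (le_trans (Phi_scale_le _ _ s1)); rewrite lerD2l ler_wpM2l//.
rewrite sqr_sqrtr; last by rewrite addr_ge0 ?sqr_ge0// (le_trans ler01).
by move: v2; lra.
Qed.

Lemma Pr_martingale (x t kp dl : R) : 0 < dl -> 0 < kp ->
  `|Pr P [set w | normalized_sum w <= x + t] - Phi x| <=
  Phi (- kp) + (1 - Phi kp) + kp * dl + `|t| + `|x| * (dl ^+ 2 + 2 / sg) + Clind dl / sg.
Proof.
move=> dl0 kp0.
have L c := le_trans (@lindeberg dl sg c n dl0 sg0
  (leqnn n) (dl ^+ 2) (lexx _)) (lind_sum_le dl0).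
have U := smooth_upper P mT (x + t) kp dl0; have D := smooth_lower P mT (x + t) kp dl0.
have p1 := Pr_le1 P (measurable_sublevel mT (x + t)).
have LU := L (x + t + kp * dl); have LD := L (x + t - kp * dl).
have kd : 0 < kp * dl by rewrite mulr_gt0.
have hU := heat_limit x (t + kp * dl) dl0; have hD := heat_limit x (t - kp * dl) dl0.
rewrite !addrA in hU hD.
have nU := ler_normD t (kp * dl); have nD := ler_normB t (kp * dl).
rewrite [`|kp * dl|]gtr0_norm// in nU nD.
have k0 := Phi_ge0 (- kp); have k1 := Phi_le1 kp; have k2 := Phi_ge0 kp.
have p0 := Pr_ge0 P [set w | normalized_sum w <= x + t].
exact: (sandwich p1 k1 k0 U D LU LD hU hD nU nD).
Qed.

(** The real inequality is also right for a singular matrix: the left side is then -oo <= x and the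
    right side compares 0 with an exponential. *)
Lemma normalized_log_det_le (A : 'M[R]_n) (x : R) :
  (normalized_log_det A <= x%:E)%E =
  (`|\det A| <= expR ((x * sg + ln (n.-1`!)%:R) / 2)).
Proof.
have se : Num.sqrt (2^-1 * ln n%:R) = sg / 2.
  rewrite -[RHS]gtr0_norm ?divr_gt0// -sqrtr_sqr; congr Num.sqrt.
  by rewrite expr_div_n sigma_sqr//; field.
rewrite /normalized_log_det se; have [->|d0] := eqVneq (\det A) 0.
  rewrite normr0 expR_ge0 le0_lneNy//= addNye.
  by rewrite gt0_mulNye ?lte_fin ?invr_gt0 ?divr_gt0// leNye.
have d1 : 0 < `|\det A| by rewrite normr_gt0.
rewrite lne_EFin// -EFinB -EFinM lee_fin ler_pdivrMr ?divr_gt0//.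
rewrite -[X in _ = (X <= _)]lnK ?posrE// ler_expR.
by apply/idP/idP; lra.
Qed.

Lemma measurable_normalized_log_det_le (x : R) :
  measurable [set w | (normalized_log_det (Am w) <= x%:E)%E].
Proof.
under eq_set do rewrite normalized_log_det_le.
apply: measurable_sublevel; apply: measurableT_comp => //.
apply: measurable_det => i j; rewrite (_ : (fun w => _) = a i j) //.
by apply/funext => w; rewrite mxE.
Qed.

Definition remainder_bound (M : nat) (eps A : R) : R :=
  3 + M%:R * (1 + logL M eps) + 33 * A.

Lemma normalized_log_det_close M eps A w (x : R) : (0 < M)%N -> 0 < eps ->
  ~ bad M eps w -> total_bound M w <= A ->
  let eta := remainder_bound M eps A / sg in
  ((normalized_log_det (Am w) <= x%:E)%E -> normalized_sum w <= x + eta) /\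
  (normalized_sum w <= x - eta -> (normalized_log_det (Am w) <= x%:E)%E).
Proof.
move=> M0 e0 nb tA; have [d0 hd] := good_log_det M0 e0 nb.
have d1 : 0 < `|\det (Am w)| by rewrite normr_gt0.
have [H1 H2] := inv_sum_bounds.
have TE : normalized_sum w * sg = \sum_(k < n) Yk k w by rewrite /normalized_sum -mulr_suml divfK// gt_eqF.
(* This is where (n-1)! appears: the drift sum of 1/m exceeds ln n by a number between 0 and 1,
   which raises the 2 of [good_log_det] to the 3 in [remainder_bound]. *)
have fE : ln (n`!)%:R = ln n%:R + ln (n.-1`!)%:R :> R.
  by rewrite -{1}(prednK n0) factS prednK// natrM lnM ?posrE ?ltr0n ?fact_gt0.
rewrite normalized_log_det_le -[X in X <= expR _]lnK ?posrE// ler_expR.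
move: hd; rewrite -TE fE -/harmonic ler_norml => /andP[h1 h2].
have rE : remainder_bound M eps A / sg * sg = remainder_bound M eps A by rewrite divfK// gt_eqF.
split => hx.
  by rewrite -(ler_pM2r sg0) mulrDl rE /remainder_bound; move: hx h1 h2 H1 H2 tA; lra.
rewrite -(ler_pM2r sg0) mulrBl rE /remainder_bound in hx.
by move: hx h1 h2 H1 H2 tA; lra.
Qed.

Let Cbad (M : nat) (eps A : R) : R :=
  4 ^+ 4 * cY K0 / M%:R + M%:R * (cB R * (4 * eps)) + CV M / A.

Lemma exceptional_Pr M eps A : (0 < M)%N -> 0 < eps -> 0 < A ->
  measurable (bad M eps `|` [set w | A <= total_bound M w]) /\
  Pr P (bad M eps `|` [set w | A <= total_bound M w]) <= Cbad M eps A +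
    (2 * (cT K0 * DW) + M%:R * cB R * Ceps M eps) / sg.
Proof.
move=> M0 e0 A0.
have [mB pB] := bad_Pr M0 e0.
have [itb etb] := total_bound_Ex M.
have mtb : measurable [set w | A <= total_bound M w].
  rewrite -[X in measurable X]setTI; apply: measurable_fun_ler => //; exact: itg_meas itb.
split; first exact: measurableU.
apply: (le_trans (PrU _ mB mtb)).
have tb0 w : 0 <= total_bound M w.
  rewrite addr_ge0 ?addr_ge0 ?sqr_ge0// sumr_ge0// => k _; exact: step_bound_ge0.
have ptb : Pr P [set w | A <= total_bound M w] <= CV M / A.
  apply: (le_trans (markov_Ex A0 mtb itb tb0 (fun w h => h))).
  by rewrite ler_wpM2r// invr_ge0 ltW.
apply: (le_trans (lerD pB ptb)).
have sn : 0 < Num.sqrt n%:R :> R by rewrite sqrtr_gt0.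
have sV : (Num.sqrt n%:R)^-1 <= sg^-1 by rewrite lef_pV2 ?posrE// sigma_le_sqrt.
have C0 : 0 <= 2 * (cT K0 * DW) + M%:R * cB R * Ceps M eps.
  have Ce : 0 <= Ceps M eps.
    have e3 : 0 <= 3 / eps ^+ 3 by apply: divr_ge0 => //; apply: exprn_ge0; exact: ltW.
    have e4 : 0 <= 10 / eps ^+ 4 by apply: divr_ge0 => //; apply: exprn_ge0; exact: ltW.
    have V0 : 0 <= DW * M%:R ^+ 2 by apply: mulr_ge0 => //; exact: sqr_ge0.
    apply: mulr_ge0 => //; apply: addr_ge0; apply: mulr_ge0 => //.
    by apply: addr_ge0 => //; rewrite -mulrA mulr_ge0.
  have cB0 := ltW (@cB_gt0 R).
  by apply: addr_ge0; [apply: mulr_ge0 => //; exact: mulr_ge0|apply: mulr_ge0 => //; exact: mulr_ge0].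
rewrite /Cbad; have := ler_wpM2l C0 sV.
rewrite [X in X <= _](_ : _ = 2 * (cT K0 * DW) / Num.sqrt n%:R +
  M%:R * (cB R * (Ceps M eps / Num.sqrt n%:R))); last by field; rewrite gt_eqF.
rewrite [M%:R * (cB R * (4 * eps + _))](_ : _ = M%:R * (cB R * (4 * eps)) +
  M%:R * (cB R * (Ceps M eps / Num.sqrt n%:R))); last by ring.
move: (M%:R * (cB R * (Ceps _ _ / _))) (M%:R * (cB R * (4 * eps))) => u1 u2.
move: (2 * (cT K0 * DW) / Num.sqrt n%:R) (4 ^+ 4 * cY K0 / M%:R) (CV M / A) => u3 u4 u5.
move: (_ / sg) => u6; lra.
Qed.

Definition Crate (x dl : R) (M : nat) (eps A : R) : R :=
  remainder_bound M eps A + 2 * `|x| + Clind dl +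
  (2 * (cT K0 * DW) + M%:R * cB R * Ceps M eps).

(** The terms without n are made small by choosing [kp], then [dl], and [M], then [eps] and [A]; the
    remaining one is a constant depending on these choices over [sigma]. *)
Lemma log_det_rate (x kp dl : R) M eps A : 0 < dl -> dl <= 1 -> 0 < kp ->
  (0 < M)%N -> 0 < eps -> 0 < A ->
  `|Pr P [set w | (normalized_log_det (Am w) <= x%:E)%E] - Phi x| <=
  Phi (- kp) + (1 - Phi kp) + (kp + `|x|) * dl +
  (4 ^+ 4 * cY K0 / M%:R + M%:R * (cB R * (4 * eps)) + CV M / A) +
  Crate x dl M eps A / sg.
Proof.
move=> dl0 dl1 kp0 M0 e0 A0; have [mB pB] := exceptional_Pr M0 e0 A0.
have mE := measurable_normalized_log_det_le x.
pose eta := remainder_bound M eps A / sg.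
have eta0 : 0 <= eta.
  rewrite divr_ge0 ?(ltW sg0)// !addr_ge0 ?mulr_ge0 ?(ltW A0)// addr_ge0//.
  exact: normr_ge0.
have close w : ~ (bad M eps `|` [set w | A <= total_bound M w]) w ->
  ((normalized_log_det (Am w) <= x%:E)%E -> normalized_sum w <= x + eta) /\
  (normalized_sum w <= x - eta -> (normalized_log_det (Am w) <= x%:E)%E).
  move=> /not_orP[nb /= nA]; apply: normalized_log_det_close => //.
  by rewrite leNgt; apply/negP => /ltW.
have hU := Pr_martingale x eta dl0 kp0; have hD := Pr_martingale x (- eta) dl0 kp0.
have mU := measurable_sublevel mT (x + eta); have mD := measurable_sublevel mT (x - eta).
have U : Pr P [set w | (normalized_log_det (Am w) <= x%:E)%E] <=
    Pr P [set w | normalized_sum w <= x + eta] + Pr P (bad M eps `|` [set w | A <= total_bound M w]).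
  apply: le_trans (PrU P mU mB); apply: le_Pr => //; first exact: measurableU.
  by move=> w /= h; have [hb|/close[h1 _]] := pselect ((bad M eps `|` [set w | A <= total_bound M w]) w); [by right; exact: hb|left; exact: h1].
have D : Pr P [set w | normalized_sum w <= x - eta] <=
    Pr P [set w | (normalized_log_det (Am w) <= x%:E)%E] +
    Pr P (bad M eps `|` [set w | A <= total_bound M w]).
  apply: le_trans (PrU P mE mB); apply: le_Pr => //; first exact: measurableU.
  by move=> w /= h; have [hb|/close[_ h1]] := pselect ((bad M eps `|` [set w | A <= total_bound M w]) w); [by right; exact: hb|left; exact: h1].
rewrite normrN in hD; rewrite (ger0_norm eta0) in hU hD.
have x0 : `|x| * (dl ^+ 2 + 2 / sg) <= `|x| * dl + 2 * `|x| / sg.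
  rewrite [leLHS](_ : _ = `|x| * dl ^+ 2 + 2 * `|x| / sg); last by ring.
  by rewrite lerD2r ler_wpM2l// expr2 ler_piMl// ltW.
have CE : Crate x dl M eps A / sg = eta + 2 * `|x| / sg + Clind dl / sg +
   (2 * (cT K0 * DW) + M%:R * cB R * Ceps M eps) / sg.
  by rewrite /Crate /eta -!mulrDl.
rewrite {}CE [(kp + `|x|) * dl]mulrDl; exact: (rate_sandwich hU hD U D pB x0).
Qed.

End process.

(** * The central limit theorem *)

Lemma sigma_ge (R : realType) (B : R) : \forall n \near \oo, B <= sigma R n.
Proof.
exists (Num.bound (expR (B ^+ 2 / 2))).+1 => // n /= hn.
have n0 : (0 < n)%N by exact: leq_ltn_trans hn.
have eB : expR (B ^+ 2 / 2) <= n%:R.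
  apply: ltW; apply: (lt_le_trans (archi_boundP (expR_ge0 _))).
  by rewrite ler_nat ltnW.
apply: (le_trans (ler_norm B)); rewrite -sqrtr_sqr ler_wsqrtr//.
rewrite -ler_pdivrMl// mulrC -ler_expR lnK// posrE ltr0n//.
Qed.

Section moments.
Context (d : measure_display) (T : measurableType d) (R : realType)
  (P : probability T R) (X : {RV P >-> R}).

Lemma Ex_of_expectation : ('E_P[X] = 0)%E -> Ex P X = 0.
Proof. by rewrite unlock /Ex /Rintegral => ->. Qed.

Lemma Ex_of_variance : ('E_P[X] = 0)%E -> ('V_P[X] = 1)%E -> Ex P (fun w => X w ^+ 2) = 1.
Proof.
move=> EX; rewrite /variance unlock EX /= unlock => VX.
rewrite /Ex /Rintegral -[RHS]/(fine 1%E) -VX; congr fine; apply: eq_integral => w _ /=.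
by rewrite expr2 -[X w]subr0.
Qed.

Lemma Ex_of_moment4 (K : R) : ('E_P[(fun w => (X w : R) ^+ 4)%R] <= K%:E)%E ->
  itg P (fun w => X w ^+ 4) /\ Ex P (fun w => X w ^+ 4) <= K.
Proof.
rewrite unlock => h.
have i4 : itg P (fun w => X w ^+ 4).
  apply/integrableP; split.
    by apply/measurable_EFinP; exact: measurable_funX.
  rewrite (eq_integral (fun w => (X w ^+ 4)%:E)) => [|w _ /=].
    by rewrite (le_lt_trans h)// ltry.
  by rewrite ger0_norm// exprn_even_ge0.
by split => //; rewrite -lee_fin -integral_Ex.
Qed.

End moments.

Lemma exists_small_mul (R : realType) (e b : R) : 0 < e -> 0 <= b ->
  exists2 dl : R, 0 < dl <= 1 & b * dl <= e.
Proof.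
move=> e0 b0; have b1 : 0 < b + 1 by rewrite ltr_wpDl.
exists (Num.min 1 (e / (b + 1))); first by rewrite lt_min ltr01 divr_gt0//= ge_min lexx.
apply: (@le_trans _ _ (b * (e / (b + 1)))); first by rewrite ler_wpM2l// ge_min lexx orbT.
by rewrite mulrCA ler_piMr ?(ltW e0)// ler_pdivrMr// mul1r lerDl.
Qed.

Unset Implicit Arguments.

Theorem theorem1p1 (R : realType) (d : nat -> measure_display)
    (T : forall n : nat, measurableType (d n))
    (P : forall n : nat, probability (T n) R)
    (a : forall n : nat, 'I_n -> 'I_n -> {RV (P n) >-> R})
    (a_indep : forall n : nat,
       mutually_independent (fun ij : 'I_n * 'I_n => a n ij.1 ij.2))
    (a_mean : forall (n : nat) (i j : 'I_n), ('E_(P n)[a n i j] = 0)%E)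
    (a_var : forall (n : nat) (i j : 'I_n), ('V_(P n)[a n i j] = 1)%E)
    (a_moment4 :
       (ereal_sup [set m : \bar R | exists (n : nat) (i j : 'I_n),
          m = 'E_(P n)[(fun w => (a n i j w : R) ^+ 4)%R]] < +oo)%E) :
  cvg_in_distribution P
    (fun (n : nat) (w : T n) => normalized_log_det (random_matrix (a n) w))
    (normal_prob 0 1).
Proof.
have [K [K1 hK]] : exists K : R, 1 <= K /\ forall n (i j : 'I_n),
    ('E_(P n)[(fun w => (a n i j w : R) ^+ 4)%R] <= K%:E)%E.
  move: a_moment4; set S := [set m | _] => hS.
  (* The supremum is below +oo, hence equals its finite part unless it is -oo, and then any real
     bound will do. *)
  exists (Num.max 1 (fine (ereal_sup S))); split; first by rewrite le_max lexx.
  move=> n i j; have hm : ('E_(P n)[(fun w => (a n i j w : R) ^+ 4)%R] <= ereal_sup S)%E.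
    by apply: ereal_sup_ubound; exists n, i, j.
  apply: (le_trans hm).
  case: (ereal_sup S) hS => [r||]//= _; last by rewrite leNye.
  by rewrite lee_fin le_max lexx orbT.
have a4 n i j := Ex_of_moment4 (hK n i j).
have a1 n i j := Ex_of_expectation (a_mean n i j).
have a2 n i j := Ex_of_variance (a_mean n i j) (a_var n i j).
move=> x _; have PhiE : normal_prob 0 1 [set` `]-oo, x]] = (Phi x)%:E by exact: PrE.
suff : P n [set w | (normalized_log_det (random_matrix (a n) w) <= x%:E)%E] @[n --> \oo] -->
    (Phi x)%:E by rewrite -PhiE.
have big : \forall n \near \oo, 1 <= sigma R n /\ (0 < n)%N.
  have [N _ hN] := sigma_ge (1 : R); exists N.+1 => // n /= nN; split; first exact: hN (ltnW nN).
  exact: leq_ltn_trans nN.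
apply/fine_cvgP; split.
  apply: filterS big => n [s1 n0].
  by rewrite fin_num_measure//; exact: measurable_normalized_log_det_le n0 s1 x.
apply/cvgrPdist_le => e0 e00.
(* Seven errors of size at most [e] follow: two Gaussian tails, the smoothing, three from the
   exceptional event, and the one divided by [sigma]. *)
pose e := e0 / 8; have e_gt0 : 0 < e by rewrite divr_gt0.
have [kp [kp0 k1 k2]] := Phi_tails e_gt0.
have [dl /andP[dl0 dl1] hdl] := exists_small_mul e_gt0 (addr_ge0 (ltW kp0) (normr_ge0 x)).
have K0 : 0 <= K by rewrite (le_trans ler01).
have cY0 : 0 <= cY K by rewrite /cY !mulr_ge0// exprn_ge0.
pose M := (Num.bound (4 ^+ 4 * cY K / e)).+1.
have hM : 4 ^+ 4 * cY K / M%:R <= e.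
  rewrite ler_pdivrMr ?ltr0n// -ler_pdivrMl// mulrC.
  have c0 : 0 <= 4 ^+ 4 * cY K / e by rewrite divr_ge0 ?(ltW e_gt0)// mulr_ge0// exprn_ge0.
  by apply: ltW; apply: (lt_le_trans (archi_boundP c0)); rewrite ler_nat.
have MR : 0 < M%:R :> R by rewrite ltr0n.
pose eps := e / (M%:R * cB R * 4).
have eps0 : 0 < eps by rewrite divr_gt0// !mulr_gt0// cB_gt0.
have heps : M%:R * (cB R * (4 * eps)) = e.
  by rewrite /eps; have := @cB_gt0 R => c0; field; rewrite !gt_eqF.
have CV0 : 0 < CV K M.
  have D0 := DW_ge0 K; have KD : 0 <= K * DW K by exact: mulr_ge0.
  by rewrite /CV; move: (K * DW K) (DW K) (cY K) M%:R KD D0 cY0 MR => t1 t2 t3 t4; lra.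
pose A := CV K M / e; have A0 : 0 < A by rewrite divr_gt0.
have hA : CV K M / A = e by rewrite /A; field; rewrite !gt_eqF.
have hs := sigma_ge (Crate K x dl M eps A / e).
near=> n.
have [s1 n0] : 1 <= sigma R n /\ (0 < n)%N by near: n.
have hn : Crate K x dl M eps A / e <= sigma R n by near: n.
have := log_det_rate (a_indep n) K1 (fun i j => (a4 n i j).1) (a1 n) (a2 n)
  (fun i j => (a4 n i j).2) n0 s1 x dl0 dl1 kp0 (ltn0Sn _ : (0 < M)%N) eps0 A0.
rewrite distrC => /le_trans; apply.
have hC : Crate K x dl M eps A / sigma R n <= e.
  by rewrite ler_pdivrMr ?(lt_le_trans ltr01)// -ler_pdivrMl// mulrC.
rewrite heps hA; have e8 : e0 = e * 8 by rewrite /e divfK.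
by rewrite e8; move: k1 k2 hdl hM hC; lra.
Unshelve. all: by end_near.
Qed.
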